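(* Let $k\ge1$ be an integer and $r>0$. Consider the heteroscedastic regression model $$y_j=S(x_j)+\sigma_j(S)\xi_j,\qquad x_j=j/n,\ 1\le j\le n,$$ with $\sigma_j(S)=g(x_j,S)$, and assume that $g$ satisfies conditions $\mathbf H_2$, $\mathbf H_3$, $\mathbf H_4$ (stated in the context). Then $$\liminf_{n\to\infty}n^{2k/(2k+1)}\inf_{\hat S_n}\sup_{S\in W_r^k}\frac{\mathcal R_n(\hat S_n,S)}{\gamma_k(S)}\ge1,$$ where the infimum is over all estimators $\hat S_n$ (measurable functions of $y_1,\dots,y_n$).
   Context: Noise: $(\xi_j)$ i.i.d., centered, unit variance, $\mathbf E\xi_1^4\le\xi^*$ with fixed $\xi^*\ge3$; $\mathcal P_*$ is the family of all such noise densities; $\mathbf E_{S,p}$ is expectation when the regression function is $S$ and the noise density is $p$. $\|f\|_n^2=\frac1n\sum_{l=1}^n f^2(x_l)$, $\|f\|^2=\int_0^1f^2$, $|f|_*=\sup_{0\le t\le1}|f(t)|$, $|f|_1=\int_0^1|f(t)|dt$. Risk: $\mathcal R_n(\hat S,S)=\sup_{p\in\mathcal P_*}\mathbf E_{S,p}\|\hat S-S\|_n^2$. $W_r^k$: 1-periodic $k$ times differentiable $f:\mathbb R\to\mathbb R$ with $\sum_{j=0}^k\|f^{(j)}\|^2\le r$. $g:[0,1]\times L_1[0,1]\to\mathbb R_+$, square integrable in $x$, $\varsigma(S)=\int_0^1g^2(x,S)dx$, and $\gamma_k(S)=\Gamma_k^*r^{1/(2k+1)}(\varsigma(S))^{2k/(2k+1)}$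 with $\Gamma_k^*=(2k+1)^{1/(2k+1)}(k/(\pi(k+1)))^{2k/(2k+1)}$. $\mathbf H_2$: for every $x\in[0,1]$, the map $g^2(x,\cdot):C[0,1]\to\mathbb R$ is Fréchet differentiable at every $f_0\in C[0,1]$: for $f$ near $f_0$ in $C[0,1]$, $g^2(x,f)=g^2(x,f_0)+\mathbf L_{x,f_0}(f-f_0)+\Upsilon(x,f_0,f)$ with $\mathbf L_{x,f_0}:C[0,1]\to\mathbb R$ bounded linear and $\lim_{|f-f_0|_*\to0}|\Upsilon(x,f_0,f)|/|f-f_0|_*=0$ for each $x$. $\mathbf H_3$: there is $C^*>0$ such that for all $S,f\in C[0,1]$ and $x\in[0,1]$, $|\mathbf L_{x,S}(f)|\le C^*(|S(x)f(x)|+|f|_1+\|S\|\,\|f\|)$. $\mathbf H_4$: $g_0^2(\cdot)=g^2(\cdot,S_0)$ with $S_0\equiv0$ is continuous on $[0,1]$, and $\lim_{\delta\to0}\sup_{0\le x\le1}\sup_{|S|_*\le\delta}|g^2(x,S)-g^2(x,S_0)|=0$.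
   Formalization: The values of g in R_+ are taken to be strictly positive for every x in [0,1] and every S; if g may vanish, gamma_k(S) can be zero and the ratio undefined (for example g = 0), and the bound can fail. *)

(* Defs.v *)
From HB Require Import structures.
From mathcomp Require Import all_boot all_order all_algebra.
From mathcomp Require Import all_classical all_reals all_analysis.

Set Implicit Arguments.
Unset Strict Implicit.
Unset Printing Implicit Defensive.

Import Order.TTheory GRing.Theory Num.Theory.
Import numFieldNormedType.Exports.

Local Open Scope classical_set_scope.
Local Open Scope ring_scope.

Section Defs.
Variable R : realType.

Local Notation leb := (@lebesgue_measure R).

Definition I01 : set R := `[0, 1].

(* design points x_j = j/n, j = 1..n, indexed by j : 'I_n as (j+1)/n *)
Definition design (n : nat) (j : 'I_n) : R := (j.+1)%:R / n%:R.

Definition supnorm (f : R -> R) : R := sup [set `|f t| | t in I01].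

Definition L1norm (f : R -> R) : R :=
  fine (\int[leb]_(t in I01) (`|f t|)%:E)%E.

Definition L2norm (f : R -> R) : R :=
  Num.sqrt (fine (\int[leb]_(t in I01) ((f t) ^+ 2)%:E)%E).

Definition L1fun (f : R -> R) : Prop := leb.-integrable I01 (EFin \o f).

Definition C01 (f : R -> R) : Prop := {within I01, continuous f}.

Definition Wkr (k : nat) (r : R) : set (R -> R) :=
  [set f : R -> R | (forall t, f (t + 1) = f t)
         /\ (forall j, (j < k)%N -> forall t, derivable (derive1n j f) t 1)
         /\ (\sum_(j < k.+1)
               \int[leb]_(t in I01) (((derive1n j f) t) ^+ 2)%:E <= r%:E)%E].

Definition noise_densities (xistar : R) : set (R -> R) :=
  [set p : R -> R | measurable_fun setT p
         /\ (forall t, 0 <= p t)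
         /\ (\int[leb]_(t in setT) (p t)%:E = 1)%E
         /\ (\int[leb]_(t in setT) (t * p t)%:E = 0)%E
         /\ (\int[leb]_(t in setT) (t ^+ 2 * p t)%:E = 1)%E
         /\ (\int[leb]_(t in setT) (t ^+ 4 * p t)%:E <= xistar%:E)%E].

(* expectation of a nonnegative functional of (xi_1,...,xi_n), xi_j i.i.d.
   with density p: the iterated integral
   int p(xi_1) int p(xi_2) ... F(xi_1,...,xi_n) dxi_n ... dxi_1 *)
Fixpoint iid_expect (p : R -> R) (n : nat) :
    (n.-tuple R -> \bar R) -> \bar R :=
  match n return (n.-tuple R -> \bar R) -> \bar R with
  | 0%N => fun F => F [tuple]
  | m.+1 => fun F =>
      (\int[leb]_(t in setT)
         ((p t)%:E * iid_expect p (fun u : m.-tuple R => F (cons_tuple t u))))%E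
  end.

Definition observations (g : R -> (R -> R) -> R) (S : R -> R) (n : nat)
    (xi : n.-tuple R) : n.-tuple R :=
  [tuple S (design j) + g (design j) S * tnth xi j | j < n].

Definition empnorm2 (n : nat) (f : R -> R) : R :=
  n%:R^-1 * \sum_(l < n) (f (design l)) ^+ 2.

Definition estimator (n : nat) (Sh : n.-tuple R -> R -> R) : Prop :=
  forall t, measurable_fun setT (fun y : n.-tuple R => Sh y t).

Definition risk (xistar : R) (g : R -> (R -> R) -> R) (n : nat)
    (Sh : n.-tuple R -> R -> R) (S : R -> R) : \bar R :=
  ereal_sup [set iid_expect p
      (fun xi => (empnorm2 n (fun t => Sh (observations g S xi) t - S t))%:E)
    | p in noise_densities xistar].

Definition varsigma (g : R -> (R -> R) -> R) (S : R -> R) : R :=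
  fine (\int[leb]_(x in I01) ((g x S) ^+ 2)%:E)%E.

Definition Gammastar (k : nat) : R :=
  powR (2 * k%:R + 1) (1 / (2 * k%:R + 1)) *
  powR (k%:R / (pi * (k%:R + 1))) (2 * k%:R / (2 * k%:R + 1)).

Definition gammak (k : nat) (r : R) (g : R -> (R -> R) -> R) (S : R -> R) : R :=
  Gammastar k * powR r (1 / (2 * k%:R + 1))
  * powR (varsigma g S) (2 * k%:R / (2 * k%:R + 1)).

Definition g_admissible (g : R -> (R -> R) -> R) : Prop :=
  (forall x S, x \in I01 -> L1fun S -> 0 < g x S)
  /\ (forall x S1 S2, L1fun S1 -> L1fun S2 ->
        leb.-negligible [set t | t \in I01 /\ S1 t <> S2 t] ->
        g x S1 = g x S2)
  /\ (forall S, L1fun S ->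
        measurable_fun I01 (fun x => g x S)
        /\ (\int[leb]_(x in I01) ((g x S) ^+ 2)%:E < +oo)%E).

(* H2: Frechet differentiability of g^2(x, .) on C[0,1], with derivative
   L x f0 : (R -> R) -> R *)
Definition H2 (g : R -> (R -> R) -> R) (L : R -> (R -> R) -> (R -> R) -> R)
  : Prop :=
  forall x f0, x \in I01 -> C01 f0 ->
    (forall a f h, C01 f -> C01 h ->
        L x f0 (fun t => a * f t + h t) = a * L x f0 f + L x f0 h)
    /\ (exists C : R, forall f, C01 f -> `|L x f0 f| <= C * supnorm f)
    /\ (forall e : R, 0 < e -> exists d : R, 0 < d /\
          forall f, C01 f -> supnorm (fun t => f t - f0 t) < d ->
            `|g x f ^+ 2 - g x f0 ^+ 2 - L x f0 (fun t => f t - f0 t)|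
              <= e * supnorm (fun t => f t - f0 t)).

Definition H3 (L : R -> (R -> R) -> (R -> R) -> R) : Prop :=
  exists Cstar : R, 0 < Cstar /\
    forall S f x, C01 S -> C01 f -> x \in I01 ->
      `|L x S f| <= Cstar * (`|S x * f x| + L1norm f + L2norm S * L2norm f).

Definition H4 (g : R -> (R -> R) -> R) : Prop :=
  {within I01, continuous (fun x => g x (fun _ => 0) ^+ 2)}
  /\ (forall e : R, 0 < e -> exists d : R, 0 < d /\
        forall x S, x \in I01 -> L1fun S ->
          (forall t, t \in I01 -> `|S t| <= d) ->
          `|g x S ^+ 2 - g x (fun _ => 0) ^+ 2| <= e).

End Defs.

(* Main.v *)
Require Import Defs.
From HB Require Import structures.
From mathcomp Require Import all_boot all_order all_algebra.
From mathcomp Require Import all_classical all_reals all_analysis.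
From mathcomp Require Import measurable_realfun ring lra zify.

(** Pinsker's lower bound by a Bayesian argument, with Gaussian noise. The
    interval is cut into K cells, and in the cell m the regression function is
    sum_i sqrt(eps_m^2 u_i) zeta_(m,i) chi(x) phi_i(x), x in [0,1], where
    phi_i = sqrt 2 sin(pi (i+1) x), i < N, where chi is a polynomial cutoff that
    makes the cells glue in C^k, where u_i = (N/(i+1))^k - 1 are Pinsker's
    weights, eps_m^2 = g^2(m/K, 0) K/n, and where the zeta_(m,i) are independent
    centred binomial variables of variance 1. The prior is finite, and as M
    grows each coordinate obeys a discrete van Trees inequality that replaces
    the Gaussian one: the squared loss in the coordinate (m,i) is at least about
    eps_m^2 u_i / (1 + u_i). The Fisher information enters only through the
    chi-square distance between neighbouring parameters; H2 and H3 show that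
    the dependence of the variance on S changes it negligibly.
    With K^(2k+1) ~ alpha n, where alpha is fixed by the energy constraint, the
    prior charges W_r^k up to O(1/K) by Chebyshev (the K cells are independent),
    the total loss is (K/n) varsigma(0) sum_i u_i/(1 + u_i), and H4 lets one
    replace gamma_k(S) by gamma_k(0). Letting first n, then N grow gives
    Pinsker's constant. *)

Set Implicit Arguments.
Unset Strict Implicit.
Unset Printing Implicit Defensive.

Import Order.TTheory GRing.Theory Num.Theory.
Import numFieldNormedType.Exports.
Local Open Scope classical_set_scope.
Local Open Scope ring_scope.

(** * Iterated Lebesgue integrals and Gaussian noise *)

Section IteratedIntegral.
Variable R : realType.
Local Notation leb := (@lebesgue_measure R).
Local Open Scope ereal_scope.

Fixpoint leb_int (n : nat) : (n.-tuple R -> \bar R) -> \bar R :=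
  match n return (n.-tuple R -> \bar R) -> \bar R with
  | 0%N => fun F => F [tuple]
  | m.+1 => fun F =>
      \int[leb]_(t in setT) leb_int (fun u : m.-tuple R => F (cons_tuple t u))
  end.

Lemma leb_int_ge0 n (F : n.-tuple R -> \bar R) :
  (forall y, 0 <= F y) -> 0 <= leb_int F.
Proof.
elim: n F => [|n IH] F F0 /=; first exact: F0.
by apply: integral_ge0 => t _; apply: IH.
Qed.

Lemma measurable_cons_tuple d (T : measurableType d) n (h : T -> R)
    (f : T -> n.-tuple R) :
  measurable_fun setT h -> measurable_fun setT f ->
  measurable_fun setT (fun t => cons_tuple (h t) (f t)).
Proof. by move=> mh mf; exact: measurable_cons. Qed.

Lemma measurable_leb_int d (T : measurableType d) n (F : T * n.-tuple (measurableTypeR R) -> \bar R) :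
  measurable_fun setT F -> (forall z, 0 <= F z) ->
  measurable_fun setT (fun t => leb_int (fun y => F (t, y))).
Proof.
elim: n d T F => [|n IH] d T F mF F0 /=.
  by apply: measurableT_comp => //; exact: measurable_fun_pair.
pose F' (z : (T * measurableTypeR R) * n.-tuple R) := F (z.1.1, cons_tuple z.1.2 z.2).
have mF' : measurable_fun setT F'.
  apply: measurableT_comp => //; apply: measurable_fun_pair => /=.
    exact: measurableT_comp.
  by apply: measurable_cons_tuple => //; exact: measurableT_comp.
have := IH _ _ F' mF' (fun z => F0 _).
move=> /(@measurable_fun_fubini_tonelli_F _ _ _ _ R leb).
apply.
by move=> z; apply: leb_int_ge0 => y; exact: F0.
Qed.

Lemma measurable_cons_leb_int n (F : n.+1.-tuple R -> \bar R) :
  measurable_fun setT F -> (forall y, 0 <= F y) ->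
  measurable_fun setT (fun t : measurableTypeR R => leb_int (fun u : n.-tuple R => F (cons_tuple t u))).
Proof.
move=> mF F0.
apply: (@measurable_leb_int _ (measurableTypeR R) n (fun z => F (cons_tuple z.1 z.2))) => //.
by apply: measurableT_comp => //; exact: measurable_cons_tuple.
Qed.

Lemma measurable_cons_section n (F : n.+1.-tuple R -> \bar R) (t : R) :
  measurable_fun setT F ->
  measurable_fun setT (fun u : n.-tuple R => F (cons_tuple t u)).
Proof. by move=> mF; apply: measurableT_comp => //; exact: measurable_cons_tuple. Qed.

Lemma le_leb_int n (F H : n.-tuple R -> \bar R) :
  measurable_fun setT F -> measurable_fun setT H ->
  (forall y, 0 <= F y) -> (forall y, F y <= H y) -> leb_int F <= leb_int H.
Proof.
elim: n F H => [|n IH] F H mF mH F0 FH /=; first exact: FH.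
have H0 y : 0 <= H y by exact: le_trans (FH y).
apply: ge0_le_integral => //.
- by move=> t _; apply: leb_int_ge0.
- exact: measurable_cons_leb_int.
- exact: measurable_cons_leb_int.
- by move=> t _; apply: IH => //; exact: measurable_cons_section.
Qed.

Lemma leb_intD n (F H : n.-tuple R -> \bar R) :
  measurable_fun setT F -> measurable_fun setT H ->
  (forall y, 0 <= F y) -> (forall y, 0 <= H y) ->
  leb_int (fun y => F y + H y) = leb_int F + leb_int H.
Proof.
elim: n F H => [|n IH] F H mF mH F0 H0 //=.
rewrite -ge0_integralD//; last first.
- exact: measurable_cons_leb_int.
- by move=> t _; apply: leb_int_ge0.
- exact: measurable_cons_leb_int.
- by move=> t _; apply: leb_int_ge0.
by apply: eq_integral => t _; apply: IH => //; exact: measurable_cons_section.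
Qed.

Lemma leb_intZl n (F : n.-tuple R -> \bar R) (c : R) : (0 <= c)%R ->
  measurable_fun setT F -> (forall y, 0 <= F y) ->
  leb_int (fun y => c%:E * F y) = c%:E * leb_int F.
Proof.
move=> c0; elim: n F => [|n IH] F mF F0 //=.
rewrite -ge0_integralZl//; last first.
- by move=> t _; apply: leb_int_ge0.
- exact: measurable_cons_leb_int.
by apply: eq_integral => t _; apply: IH => //; exact: measurable_cons_section.
Qed.

Lemma leb_int_sum n (I : Type) (s : seq I) (F : I -> n.-tuple R -> \bar R) :
  (forall i, measurable_fun setT (F i)) -> (forall i y, 0 <= F i y) ->
  leb_int (fun y => \sum_(i <- s) F i y) = \sum_(i <- s) leb_int (F i).
Proof.
move=> mF F0; elim: s => [|i s IH].
  rewrite big_nil; under eq_fun do rewrite big_nil.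
  have := @leb_intZl n (fun=> 0) 0%R (lexx _) (measurable_cst _) (fun=> lexx _).
  by under eq_fun do rewrite mule0; rewrite mul0e.
rewrite big_cons -IH -leb_intD//.
- by congr leb_int; apply/funext => y; rewrite big_cons.
- exact: emeasurable_sum.
- by move=> y; exact: sume_ge0.
Qed.

Lemma measurable_prod_tnth n (f : 'I_n -> R -> R) :
  (forall i, measurable_fun setT (f i)) ->
  measurable_fun setT (fun y : n.-tuple R => (\prod_(i < n) f i (tnth y i))%R).
Proof.
move=> mf; apply: measurable_prod => i _.
by apply: measurableT_comp => //; exact: measurable_tnth.
Qed.

Lemma leb_int_prod n (f : 'I_n -> R -> R) :
  (forall i, measurable_fun setT (f i)) -> (forall i t, (0 <= f i t)%R) ->
  leb_int (fun y : n.-tuple R => (\prod_(i < n) f i (tnth y i))%:E) =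
  \prod_(i < n) \int[leb]_(t in setT) (f i t)%:E.
Proof.
elim: n f => [|n IH] f mf f0 /=; first by rewrite !big_ord0.
rewrite big_ord_recl.
under eq_integral => t _.
  rewrite (_ : leb_int _ = (f ord0 t)%:E *
      leb_int (fun u : n.-tuple R => (\prod_(i < n) f (lift ord0 i) (tnth u i))%:E)); last first.
    rewrite -leb_intZl//; last 2 first.
    - by apply/measurable_EFinP; apply: (@measurable_prod_tnth n (fun i => f (lift ord0 i))).
    - by move=> y; rewrite lee_fin prodr_ge0.
    congr leb_int; apply/funext => u; rewrite big_ord_recl EFinM tnth0.
    by congr (_ * (_)%:E); apply: eq_bigr => i _; rewrite tnthS.
  over.
rewrite ge0_integralZr//; last 3 first.
- by apply/measurable_EFinP; exact: mf.
- by move=> t _; rewrite lee_fin.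
- by apply: leb_int_ge0 => y; rewrite lee_fin prodr_ge0.
by rewrite (IH (fun i => f (lift ord0 i))).
Qed.

End IteratedIntegral.

Section AffineChange.
Variable R : realType.
Local Notation leb := (@lebesgue_measure R).
Local Open Scope ereal_scope.

Lemma measurable_affine (a b : R) :
  measurable_fun setT (fun t : measurableTypeR R => a + b * t : measurableTypeR R)%R.
Proof. by apply: measurable_funD => //; exact: measurable_funM. Qed.

Lemma integral_affine (a b : R) (G : R -> \bar R) : (0 < b)%R ->
  measurable_fun setT G -> (forall y, 0 <= G y) ->
  \int[leb]_y G y = b%:E * \int[leb]_t G (a + b * t)%R.
Proof.
move=> b0 mG G0.
pose phi (t : measurableTypeR R) : measurableTypeR R := (a + b * t)%R.
have mphi : measurable_fun setT phi by exact: measurable_affine.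
pose pm : {measure set (measurableTypeR R) -> \bar R} :=
  measure_function_pushforward__canonical__measure_function_Measure leb mphi.
pose m := mscale (NngNum (ltW b0)) pm.
have mE A : measurable A -> leb A = m A.
  apply: lebesgue_measure_unique => _ [[c d] _ <-].
  have pre : phi @^-1` [set` `]c, d]%R] = [set` `](c - a) / b, (d - a) / b]%R].
    apply/seteqP; split=> t /=; rewrite !in_itv/= /phi ltr_pdivrMr// ler_pdivlMr//;
      by rewrite ltrBlDl lerBrDl (mulrC t).
  transitivity (b%:E * leb (phi @^-1` [set` `]c, d]%R])); last by [].
  rewrite pre.
  rewrite !lebesgue_measure_itv/= !lte_fin ltr_pM2r ?invr_gt0// ltrD2r.
  case: ifPn => cd; last by rewrite mule0.
  by rewrite -EFinB -EFinM; congr EFin; rewrite -mulrBl mulrC divfK ?gt_eqF// ; lra.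
transitivity (\int[m]_y G y).
  by apply: eq_measure_integral => A mA _; exact: mE.
rewrite ge0_integral_mscale//=; congr (_ * _).
by rewrite ge0_integral_pushforward.
Qed.

Lemma iid_expect_affine (p : R -> R) n (mu sg : 'I_n -> R) (G : n.-tuple R -> \bar R) :
  measurable_fun setT p -> (forall t, (0 <= p t)%R) -> (forall j, (0 < sg j)%R) ->
  measurable_fun setT G -> (forall y, 0 <= G y) ->
  iid_expect p (fun xi => G [tuple (mu j + sg j * tnth xi j)%R | j < n]) =
  leb_int (fun y =>
    (\prod_(j < n) ((sg j)^-1 * p ((tnth y j - mu j) / sg j)))%R%:E * G y).
Proof.
move=> mp p0; elim: n mu sg G => [|n IH] mu sg G sg0 mG G0 /=.
  by rewrite big_ord0 mul1e; congr G; apply: val_inj; rewrite /= tuple0 enum_ord0.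
pose q (j : 'I_n.+1) y := ((sg j)^-1 * p ((y - mu j) / sg j))%R.
have q0 j y : (0 <= q j y)%R by rewrite mulr_ge0// invr_ge0 ltW.
have mq j : measurable_fun setT (q j).
  apply: measurable_funM => //; apply: measurableT_comp => //.
  by apply: measurable_funM => //; exact: measurable_funB.
pose H (s : measurableTypeR R) := leb_int (fun u : n.-tuple R =>
  (\prod_(j < n) q (lift ord0 j) (tnth u j))%R%:E * G (cons_tuple s u)).
have mQ : measurable_fun setT (fun u : n.-tuple R => \prod_(j < n) q (lift ord0 j) (tnth u j))%R.
  exact: (@measurable_prod_tnth _ n (fun j => q (lift ord0 j))).
have Q0 (u : n.-tuple R) : (0 <= \prod_(j < n) q (lift ord0 j) (tnth u j))%R by exact: prodr_ge0.
have H0 s : 0 <= H s by apply: leb_int_ge0 => y; rewrite mule_ge0// lee_fin.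
have mH : measurable_fun setT H.
  apply: (@measurable_leb_int _ _ (measurableTypeR R) n (fun z =>
    (\prod_(j < n) q (lift ord0 j) (tnth z.2 j))%R%:E * G (cons_tuple z.1 z.2))).
    apply: emeasurable_funM.
      apply/measurable_EFinP.
      by apply: (@measurableT_comp _ _ _ _ _ _ (fun u : n.-tuple R => \prod_(j < n) q (lift ord0 j) (tnth u j))%R).
    apply: measurableT_comp => //; exact: measurable_cons_tuple.
  by move=> z; rewrite mule_ge0// lee_fin.
transitivity (\int[leb]_t ((p t)%:E * H (mu ord0 + sg ord0 * t)%R)).
  apply: eq_integral => t _; congr (_ * _).
  rewrite /H -(IH (fun j => mu (lift ord0 j)) (fun j => sg (lift ord0 j))
    (fun u => G (cons_tuple (mu ord0 + sg ord0 * t)%R u)))//.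
  - congr iid_expect; apply/funext => u; congr G; apply: eq_from_tnth => j.
    rewrite tnth_mktuple; have [->|j0] := eqVneq j ord0; first by rewrite !tnth0.
    have [j' ->] : exists j', j = lift ord0 j'.
      by case: (unliftP ord0 j) j0 => [j' -> _|->]; [exists j'|rewrite eqxx].
    by rewrite !tnthS tnth_mktuple.
  - exact: measurable_cons_section.
transitivity (\int[leb]_s ((q ord0 s)%:E * H s)); last first.
  apply: eq_integral => s _; rewrite /H -leb_intZl//.
  - congr leb_int; apply/funext => u; rewrite muleA -EFinM; congr (_%:E * _).
    by rewrite big_ord_recl tnth0; congr (_ * _)%R; apply: eq_bigr => j _; rewrite tnthS.
  - apply: emeasurable_funM; first exact/measurable_EFinP.
    exact: measurable_cons_section.
  - by move=> u; rewrite mule_ge0// lee_fin.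
rewrite (@integral_affine (mu ord0) (sg ord0) (fun s => (q ord0 s)%:E * H s))//; last 2 first.
- by apply: emeasurable_funM => //; apply/measurable_EFinP; exact: mq.
- by move=> y; rewrite mule_ge0// lee_fin.
rewrite -ge0_integralZl//; last 3 first.
- apply: (@measurableT_comp _ _ _ _ _ _ (fun s => (q ord0 s)%:E * H s)) => //.
    by apply: emeasurable_funM => //; apply/measurable_EFinP; exact: mq.
  exact: measurable_affine.
- by move=> y _; rewrite mule_ge0// lee_fin.
- by rewrite lee_fin ltW.
apply: eq_integral => t _; rewrite muleA -EFinM; congr (_%:E * _).
by rewrite /q mulrA divff ?gt_eqF// mul1r addrAC subrr add0r mulrAC divff ?gt_eqF// mul1r.
Qed.

End AffineChange.

Section DeriveLambda.
Variable R : realType.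
Implicit Types (f g : R -> R) (x a b c : R).

Lemma isd_cst c x : is_derive x (1 : R) (fun=> c) 0.
Proof. exact: is_derive_cst. Qed.

Lemma isd_id x : is_derive x (1 : R) (fun t => t) 1.
Proof. exact: is_derive_id. Qed.

Lemma isd_add f g x a b : is_derive x (1 : R) f a -> is_derive x (1 : R) g b ->
  is_derive x (1 : R) (fun t => f t + g t) (a + b).
Proof. by move=> ? ?; exact: is_deriveD. Qed.

Lemma isd_mul f g x a b : is_derive x (1 : R) f a -> is_derive x (1 : R) g b ->
  is_derive x (1 : R) (fun t => f t * g t) (a * g x + f x * b).
Proof.
move=> fa gb; apply: (is_derive_eq (is_deriveM fa gb)).
by rewrite /GRing.scale/= addrC mulrC.
Qed.

Lemma isd_scale c f x a : is_derive x (1 : R) f a ->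
  is_derive x (1 : R) (fun t => c * f t) (c * a).
Proof.
by move=> fa; apply: (is_derive_eq (isd_mul (isd_cst c x) fa)); rewrite mul0r add0r.
Qed.

Lemma isd_opp f x a : is_derive x (1 : R) f a -> is_derive x (1 : R) (fun t => - f t) (- a).
Proof. by move=> fa; exact: is_deriveN. Qed.

Lemma isd_comp f g x a b : is_derive (g x) (1 : R) f a -> is_derive x (1 : R) g b ->
  is_derive x (1 : R) (fun t => f (g t)) (a * b).
Proof. by move=> fa gb; exact: (@is_derive1_comp _ f g x a b fa gb). Qed.

Lemma isd_exp n f x a : is_derive x (1 : R) f a ->
  is_derive x (1 : R) (fun t => f t ^+ n.+1) (n.+1%:R * f x ^+ n * a).
Proof.
move=> fa; elim: n => [|n IH].
  by rewrite expr0 mulr1 mul1r.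
under eq_fun do rewrite exprS.
apply: (is_derive_eq (isd_mul fa IH)).
by rewrite -[in RHS]natr1 !exprS; ring.
Qed.

Lemma der_continuous f (df : R -> R) : (forall x, is_derive x (1 : R) f (df x)) ->
  continuous f.
Proof.
move=> dF x; apply/differentiable_continuous/derivable1_diffP.
exact: (@ex_derive _ _ _ _ _ _ _ (dF x)).
Qed.

End DeriveLambda.

Section GaussianMoments.
Variable R : realType.
Local Notation leb := (@lebesgue_measure R).

Lemma FTC_is_derive (f F : R -> R) (a b : R) : a < b -> continuous f ->
  (forall x, is_derive x (1 : R) F (f x)) ->
  (\int[leb]_(x in `[a, b]) (f x)%:E = (F b - F a)%:E)%E.
Proof.
move=> ab cf dF.
have cF : continuous F.
  by move=> x; apply/differentiable_continuous/derivable1_diffP; exact: (@ex_derive _ _ _ _ _ _ _ (dF x)).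
rewrite (@continuous_FTC2 _ f F) ?EFinB//.
- exact: continuous_subspaceT.
- split.
  + by move=> x _; exact: (@ex_derive _ _ _ _ _ _ _ (dF x)).
  + by apply: cvg_at_right_filter; exact: cF.
  + by apply: cvg_at_left_filter; exact: cF.
- by move=> x _; rewrite derive1E; exact: (@derive_val _ _ _ _ _ _ _ (dF x)).
Qed.

Definition gauss_mono (j : nat) (x : R) : R := x ^+ j * expR (2^-1 * - x ^+ 2).

Lemma continuous_gauss_mono j : continuous (gauss_mono j).
Proof.
move=> x; apply: cvgM; first exact: exprn_continuous.
apply: continuous_comp; last exact: continuous_expR.
by apply: cvgMl_tmp; apply: cvgN; exact: exprn_continuous.
Qed.

Lemma measurable_gauss_mono j : measurable_fun setT (gauss_mono j).
Proof. by apply: continuous_measurable_fun => x; exact: continuous_gauss_mono. Qed.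

Lemma is_derive_gauss_mono j (x : R) :
  is_derive x (1 : R) (gauss_mono j.+1) (j.+1%:R * gauss_mono j x - gauss_mono j.+2 x).
Proof.
apply: (is_derive_eq (isd_mul (isd_exp j (isd_id x)) (isd_comp (is_derive_expR _)
  (isd_scale 2^-1 (isd_opp (isd_exp 1 (isd_id x))))))).
rewrite /gauss_mono; set e := expR _.
by rewrite !exprS expr0; field.
Qed.

Lemma gauss_mono_cvg0 j : gauss_mono j (n%:R : R) @[n --> \oo] --> (0 : R).
Proof.
pose C : R := 2 ^+ j.+1 * j.+1`!%:R.
have H (n : nat) : 0 <= gauss_mono j (n.+1%:R : R) <= C / n.+1%:R.
  set x : R := n.+1%:R.
  have x0 : 0 < x by rewrite ltr0n.
  have x1 : 1 <= x by rewrite ler1n.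
  rewrite /gauss_mono mulr_ge0 ?expR_ge0 ?exprn_ge0 ?(ltW x0)//=.
  rewrite ler_pdivlMr// mulrAC -exprSr mulrN (mulrC 2^-1) expRN ler_pdivrMr ?expR_gt0//.
  have := @expR_ge1Dxn R (x ^+ 2 / 2) j _.
  rewrite divr_ge0 ?sqr_ge0// => /(_ isT) le1.
  have f0 : 0 < (j.+1`!%:R : R) by rewrite ltr0n fact_gt0.
  have : C * ((x ^+ 2 / 2) ^+ j.+1 / j.+1`!%:R) <= C * expR (x ^+ 2 / 2).
    by apply: ler_wpM2l; [rewrite mulr_ge0// exprn_ge0|lra].
  apply: le_trans.
  have -> : C * ((x ^+ 2 / 2) ^+ j.+1 / j.+1`!%:R) = (x ^+ j.+1) ^+ 2.
    by rewrite /C expr_div_n -exprM mulnC exprM; field; rewrite ?expf_neq0 ?gt_eqF.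
  by rewrite ler_eXnr// exprn_ege1.
rewrite -cvg_shiftS /=.
apply: (@squeeze_cvgr _ _ _ _ (fun=> 0) (fun n => C / n.+1%:R)).
- by near=> n; exact: H.
- exact: cvg_cst.
- rewrite -[X in _ --> X](mulr0 C); apply: cvgMl_tmp => //.
  exact: cvg_harmonic.
Unshelve. all: by end_near. Qed.

Lemma gauss_mono_rec_half j : (forall x, 0 <= gauss_mono j x) ->
  (\int[leb]_(x in `[0%R, +oo[) (gauss_mono j.+2 x)%:E =
   j.+1%:R%:E * \int[leb]_(x in `[0%R, +oo[) (gauss_mono j x)%:E)%E.
Proof.
move=> g0.
have g20 x : 0 <= gauss_mono j.+2 x.
  have -> : gauss_mono j.+2 x = x ^+ 2 * gauss_mono j x.
    by rewrite /gauss_mono !exprS expr0; ring.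
  by rewrite mulr_ge0 ?sqr_ge0// g0.
have ig i (a b : R) : leb.-integrable `[a, b] (EFin \o gauss_mono i).
  apply: continuous_compact_integrable; first exact: segment_compact.
  exact/continuous_subspaceT/continuous_gauss_mono.
have c1 := @ge0_cvgn_integral R leb _ g20 (measurable_gauss_mono _).
have c0 := @ge0_cvgn_integral R leb _ g0 (measurable_gauss_mono _).
pose a n : \bar R := (\int[leb]_(x in `[0%R, n%:R]) (gauss_mono j.+2 x)%:E)%E.
pose b n : \bar R := (\int[leb]_(x in `[0%R, n%:R]) (gauss_mono j x)%:E)%E.
have E n : (j.+1%:R%:E * b n.+1 = a n.+1 + (gauss_mono j.+1 n.+1%:R)%:E)%E.
  have cf : continuous (fun x => j.+1%:R * gauss_mono j x - gauss_mono j.+2 x).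
    move=> x; apply: cvgB; last exact: continuous_gauss_mono.
    by apply: cvgMl_tmp; exact: continuous_gauss_mono.
  have := @FTC_is_derive _ _ 0 n.+1%:R (ltr0Sn _ _) cf (is_derive_gauss_mono j).
  have -> : gauss_mono j.+1 0 = 0 by rewrite /gauss_mono expr0n mul0r.
  rewrite subr0 => <-.
  under [X in (_ + X)%E]eq_integral do rewrite EFinB EFinM.
    rewrite integralB//=; last 2 first.
    + by apply: integrableZl => //; exact: ig.
    + exact: ig.
    rewrite integralZl//; last exact: ig.
    rewrite -/(a n.+1) -/(b n.+1) addeC subeK//.
    by apply: integrable_fin_num => //; exact: ig.
have cb : (j.+1%:R%:E * b n)%E @[n --> \oo] -->
    (j.+1%:R%:E * \int[leb]_(x in `[0%R, +oo[) (gauss_mono j x)%:E)%E.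
  by apply: cvgeZl.
have ca : (a n + (gauss_mono j.+1 n%:R)%:E)%E @[n --> \oo] -->
    (\int[leb]_(x in `[0%R, +oo[) (gauss_mono j.+2 x)%:E + 0)%E.
  apply: cvgeD => //; first by rewrite fin_num_adde_defl.
  apply: cvg_EFin; first exact: nearW.
  exact: gauss_mono_cvg0.
move: cb ca; rewrite -cvg_shiftS/= -[X in _ -> X -> _]cvg_shiftS/= adde0.
under eq_fun do rewrite E.
move=> /cvg_lim h1 /cvg_lim h2; rewrite -h1//.
by rewrite h2.
Qed.

Lemma gauss_mono_even_ge0 i x : 0 <= gauss_mono i.*2 x.
Proof. by rewrite /gauss_mono -mul2n exprM mulr_ge0 ?expR_ge0// exprn_ge0 ?sqr_ge0. Qed.

Lemma integral_gauss_mono_even i :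
  (\int[leb]_x (gauss_mono i.*2 x)%:E =
   2%:E * \int[leb]_(x in `[0%R, +oo[) (gauss_mono i.*2 x)%:E)%E.
Proof.
rewrite set_itvcy; apply: ge0_symfun_integralT.
- exact: gauss_mono_even_ge0.
- exact: continuous_gauss_mono.
- by move=> x; rewrite /gauss_mono/= -mul2n !exprM !sqrrN.
Qed.

Lemma integral_gauss_mono_rec i :
  (\int[leb]_x (gauss_mono i.*2.+2 x)%:E =
   (i.*2.+1)%:R%:E * \int[leb]_x (gauss_mono i.*2 x)%:E)%E.
Proof.
rewrite -doubleS !integral_gauss_mono_even doubleS.
rewrite gauss_mono_rec_half; last exact: gauss_mono_even_ge0.
exact: muleCA.
Qed.

Lemma std_normalE (t : R) : normal_pdf 0 1 t = normal_peak 1 * gauss_mono 0 t.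
Proof.
rewrite normal_pdfE ?oner_eq0// /gauss_mono /normal_fun expr0 mul1r.
by rewrite subr0 expr1n (mulrC 2^-1).
Qed.

Lemma integral_std_normal_mono i :
  (\int[leb]_t (t ^+ i.*2 * normal_pdf 0 1 t)%:E =
   (normal_peak 1)%:E * \int[leb]_x (gauss_mono i.*2 x)%:E)%E.
Proof.
rewrite -ge0_integralZl//; last 3 first.
- by apply/measurable_EFinP; exact: measurable_gauss_mono.
- by move=> x _; rewrite lee_fin gauss_mono_even_ge0.
- by rewrite lee_fin normal_peak_ge0.
apply: eq_integral => t _; rewrite -EFinM std_normalE /gauss_mono expr0 mul1r.
by congr EFin; ring.
Qed.

Lemma std_normal_moment2 : (\int[leb]_t (t ^+ 2 * normal_pdf 0 1 t)%:E = 1)%E.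
Proof.
rewrite (integral_std_normal_mono 1) (integral_gauss_mono_rec 0) mul1e.
rewrite -(integral_std_normal_mono 0) -[RHS](@integral_normal_pdf R 0 1).
by apply: eq_integral => t _; rewrite mul1r.
Qed.

Lemma std_normal_moment4 : (\int[leb]_t (t ^+ 4 * normal_pdf 0 1 t)%:E = 3%:E)%E.
Proof.
rewrite (integral_std_normal_mono 2) (integral_gauss_mono_rec 1) muleCA.
by rewrite -(integral_std_normal_mono 1) std_normal_moment2 mule1.
Qed.

Lemma std_normal_mean : (\int[leb]_t (t * normal_pdf 0 1 t)%:E = 0)%E.
Proof.
have mf : measurable_fun setT (fun t : R => t * normal_pdf 0 1 t).
  by apply: measurable_funM => //; exact: measurable_normal_pdf.
have if_ : leb.-integrable setT (EFin \o (fun t : R => t * normal_pdf 0 1 t)).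
  apply: (@le_integrable _ _ _ leb _ measurableT _ (EFin \o (fun t : R => normal_pdf 0 1 t + t ^+ 2 * normal_pdf 0 1 t))) => //.
  - exact/measurable_EFinP.
  - move=> t _; rewrite lee_fin.
    have p0 := normal_pdf_ge0 0 1 t.
    rewrite [leRHS]ger0_norm; last by rewrite addr_ge0// mulr_ge0// sqr_ge0.
    rewrite normrM (ger0_norm p0) -[X in _ <= X + _]mul1r -mulrDl.
    rewrite ler_wpM2r//.
    have := sqr_ge0 (`|t| - 1); rewrite sqrrB1 real_normK ?num_real//.
    have := normr_ge0 t; lra.
  - rewrite (_ : _ \o _ = (fun t => (normal_pdf 0 1 t)%:E) \+
        (fun t => (t ^+ 2 * normal_pdf 0 1 t)%:E))%E//.
    apply: integrableD => //; first exact: integrable_normal_pdf.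
    apply/integrableP; split.
      apply/measurable_EFinP; apply: measurable_funM => //; exact: measurable_normal_pdf.
    under eq_integral => t _.
      rewrite gee0_abs; last by rewrite lee_fin (mulr_ge0 (sqr_ge0 _) (normal_pdf_ge0 _ _ _)).
      over.
    by rewrite std_normal_moment2 ltry.
pose opp (t : measurableTypeR R) : measurableTypeR R := - t.
have mopp : measurable_fun setT opp.
  have -> : opp = (fun t => 0 + (- 1) * t) by apply/funext => t; rewrite add0r mulN1r.
  exact: measurable_affine.
have E : (\int[leb]_t (t * normal_pdf 0 1 t)%:E =
          - \int[leb]_t (t * normal_pdf 0 1 t)%:E)%E.
  transitivity (\int[pushforward leb opp]_t (t * normal_pdf 0 1 t)%:E)%E.
    by apply: eq_measure_integral => A mA _; exact/esym/lebesgue_measureN.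
  rewrite integral_pushforward//=; last first.
    rewrite /comp /opp.
    move: (integrableN if_); apply: eq_integrable => // t _ /=.
    congr EFin; rewrite !normal_pdfE ?oner_eq0// /normal_fun !subr0 sqrrN.
    by rewrite (mulNr t).
    by apply/measurable_EFinP; exact: mf.
  rewrite -integralN; last exact: integrable_add_def.
  apply: eq_integral => t _; rewrite /opp -EFinN; congr EFin.
  rewrite !normal_pdfE ?oner_eq0// /normal_fun !subr0 sqrrN.
  by rewrite (mulNr t).
have : (\int[leb]_t (t * normal_pdf 0 1 t)%:E)%E \is a fin_num by exact: integrable_fin_num.
move: E; case: (integral _ _ _) => [z| |]//= [zE] _; congr EFin; lra.
Qed.

Lemma normal_pdf_affine (m s y : R) : 0 < s ->
  s^-1 * normal_pdf 0 1 ((y - m) / s) = normal_pdf m s y.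
Proof.
move=> s0; rewrite !normal_pdfE ?oner_eq0 ?gt_eqF// mulrA; congr (_ * _).
  rewrite /normal_peak expr1n mul1r -mulrnAr sqrtrM ?sqr_ge0// sqrtr_sqr.
  by rewrite gtr0_norm// invfM.
rewrite /normal_fun subr0 expr1n; congr expR.
by rewrite -(mulr_natr 1) -(mulr_natr (s ^+ 2)) mul1r; field; rewrite gt_eqF.
Qed.

Lemma normal_pdf_gt0 (m s y : R) : 0 < s -> 0 < normal_pdf m s y.
Proof.
by move=> s0; rewrite normal_pdfE ?gt_eqF// mulr_gt0 ?expR_gt0 ?normal_peak_gt0 ?gt_eqF.
Qed.

Lemma chi2_normal (m0 s0 m1 s1 : R) : 0 < s0 -> 0 < s1 ->
  let a := (s1 ^+ 2 - s0 ^+ 2) / s0 ^+ 2 in 2 * a ^+ 2 <= 1 ->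
  (\int[leb]_x (normal_pdf m1 s1 x ^+ 2 / normal_pdf m0 s0 x)%:E <=
   (expR (a ^+ 2 + (m1 - m0) ^+ 2 / (2 * s0 ^+ 2 - s1 ^+ 2)))%:E)%E.
Proof.
move=> s00 s10 a a1.
set v0 := s0 ^+ 2 in a a1 *; set v1 := s1 ^+ 2 in a a1 *.
have v00 : 0 < v0 by rewrite exprn_gt0.
have v10 : 0 < v1 by rewrite exprn_gt0.
have av : a * v0 = v1 - v0 by rewrite /a divfK// gt_eqF.
have alt1 : a < 1 by nra.
have w0 : 0 < 2 * v0 - v1 by nra.
pose vs := v0 * v1 / (2 * v0 - v1).
have vs0 : 0 < vs by rewrite divr_gt0 ?mulr_gt0.
pose ss := Num.sqrt vs.
have ss0 : 0 < ss by rewrite sqrtr_gt0.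
have ssE : ss ^+ 2 = vs by rewrite sqr_sqrtr ?ltW.
pose ms := (2 * m1 * v0 - m0 * v1) / (2 * v0 - v1).
pose C0 : R := normal_peak s1 ^+ 2 / (normal_peak s0 * normal_peak ss).
have pk s : 0 < s -> 0 < normal_peak s :> R by move=> s'; rewrite normal_peak_gt0 ?gt_eqF.
have C00 : 0 < C0 by rewrite divr_gt0 ?exprn_gt0 ?mulr_gt0 ?pk.
have pk2 (s : R) : normal_peak s ^+ 2 = (s ^+ 2 * pi * 2)^-1.
  by rewrite /normal_peak exprVn sqr_sqrtr ?mulr_natr// mulrn_wge0// mulr_ge0 ?sqr_ge0 ?pi_ge0.
have C0E : C0 ^+ 2 = v0 ^+ 2 / (v1 * (2 * v0 - v1)).
  have -> : C0 ^+ 2 = (normal_peak s1 ^+ 2) ^+ 2 / (normal_peak s0 ^+ 2 * normal_peak ss ^+ 2).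
    by rewrite /C0; field; rewrite !gt_eqF ?pk.
  rewrite (pk2 s1) (pk2 s0) (pk2 ss) ssE -/v0 -/v1 /vs.
  have alg (p w x y : R) : p != 0 -> w != 0 -> x != 0 -> y != 0 ->
      (y * p * 2)^-1 ^+ 2 / ((x * p * 2)^-1 * (x * y / w * p * 2)^-1) = x ^+ 2 / (y * w).
    by move=> p_ w_ x_ y_; field; rewrite p_ w_ x_ y_.
  by apply: alg; rewrite gt_eqF// pi_gt0.
have C0a : C0 <= expR (a ^+ 2).
  have C1 : C0 ^+ 2 = (1 - a ^+ 2)^-1.
    rewrite C0E /a; have := w0; rewrite -/v0 -/v1 => w0'.
    field; rewrite gt_eqF ?gt_eqF//=.
    nra.
  have : C0 ^+ 2 <= expR (a ^+ 2) ^+ 2.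
    rewrite C1 -expRM_natl; have := expR_ge1Dx (2%:R * a ^+ 2).
    have a2 := sqr_ge0 a.
    move=> h; apply: le_trans h; rewrite -div1r ler_pdivrMr; last by lra.
    nra.
  by rewrite ler_pXn2r// nnegrE ?expR_ge0// (ltW C00).
pose d := (m1 - m0) ^+ 2 / (2 * v0 - v1).
have nf (m s x : R) : normal_fun m s x = expR (- (x - m) ^+ 2 / (s ^+ 2 * 2)).
  by rewrite /normal_fun mulr_natr.
have E x : normal_pdf m1 s1 x ^+ 2 / normal_pdf m0 s0 x = C0 * expR d * normal_pdf ms ss x.
  rewrite !normal_pdfE ?gt_eqF// !nf.
  have -> : C0 * expR d * (normal_peak ss * expR (- (x - ms) ^+ 2 / (ss ^+ 2 * 2))) =
    normal_peak s1 ^+ 2 / normal_peak s0 * expR (d - (x - ms) ^+ 2 / (ss ^+ 2 * 2)).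
    by rewrite expRD mulNr /C0; field; rewrite !gt_eqF ?pk.
  rewrite (exprMn _ (normal_peak s1)) (invfM (normal_peak s0)) mulrACA; congr (_ * _).
  rewrite -expRN -expRM_natl -expRD; congr expR.
  rewrite ssE /d /ms /vs -/v0 -/v1.
  by field; rewrite !gt_eqF.
under eq_integral do rewrite E EFinM.
rewrite ge0_integralZl//; last 3 first.
- by apply/measurable_EFinP; exact: measurable_normal_pdf.
- by move=> x _; rewrite lee_fin normal_pdf_ge0.
- by rewrite lee_fin mulr_ge0 ?expR_ge0 ?ltW.
by rewrite integral_normal_pdf mule1 lee_fin expRD ler_wpM2r ?expR_ge0.
Qed.

Lemma std_normal_noise (xistar : R) : 3 <= xistar ->
  noise_densities xistar (normal_pdf 0 1).
Proof.
move=> x3; split; first exact: measurable_normal_pdf.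
split; first by move=> t; exact: normal_pdf_ge0.
split; first exact: integral_normal_pdf.
split; first exact: std_normal_mean.
split; first exact: std_normal_moment2.
by rewrite std_normal_moment4 lee_fin.
Qed.

End GaussianMoments.

(** * Discrete van Trees inequality and product priors *)

Section Binomial.
Variable R : realFieldType.

Definition binw (M j : nat) : R := 'C(M, j)%:R / 2 ^+ M.

Lemma binw_ge0 M j : 0 <= binw M j.
Proof. by rewrite divr_ge0// exprn_ge0. Qed.

Lemma binw_sum M : \sum_(j < M.+1) binw M j = 1.
Proof.
rewrite -mulr_suml -natr_sum.
have -> : (\sum_(i < M.+1) 'C(M, i) = 2 ^ M)%N.
  rewrite -[2%N]/(1 + 1)%N expnDn; apply: eq_bigr => i _.
  by rewrite !exp1n !muln1.
by rewrite natrX divff// expf_neq0// pnatr_eq0.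
Qed.

Lemma binw_step M j : (j < M.+1)%N ->
  j.+1%:R * binw M j.+1 = (M%:R - j%:R) * binw M j.
Proof.
move=> jM; rewrite /binw !mulrA; congr (_ / _).
rewrite -natrB -?natrM; last by rewrite -ltnS.
by rewrite mul_bin_left.
Qed.

Lemma binw_summation_by_parts M (h : nat -> R) :
  \sum_(j < M.+1) j%:R * binw M j * h j =
  \sum_(j < M.+1) (M%:R - j%:R) * binw M j * h j.+1.
Proof.
rewrite big_ord_recl/= !mul0r add0r [RHS]big_ord_recr/= subrr !mul0r addr0.
apply: eq_bigr => j _; rewrite /bump/= add1n.
by rewrite binw_step// ltnS ltnW.
Qed.

Lemma binw_mean M : \sum_(j < M.+1) j%:R * binw M j = M%:R / 2.
Proof.
have := binw_summation_by_parts M (fun=> 1).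
under eq_bigr do rewrite mulr1.
under [RHS]eq_bigr do rewrite mulr1 mulrBl.
rewrite sumrB -mulr_sumr binw_sum mulr1 => E.
set s := \sum_(j < _) _ in E *; lra.
Qed.

Lemma binw_sqr M : \sum_(j < M.+1) j%:R ^+ 2 * binw M j = (M%:R ^+ 2 + M%:R) / 4.
Proof.
have E := binw_summation_by_parts M (fun j => j%:R).
have E1 : \sum_(j < M.+1) j%:R * binw M j * j%:R = \sum_(j < M.+1) j%:R ^+ 2 * binw M j.
  by apply: eq_bigr => j _; ring.
have E2 : \sum_(j < M.+1) (M%:R - j%:R) * binw M j * j.+1%:R =
    M%:R * (\sum_(j < M.+1) binw M j) + (M%:R - 1) * (\sum_(j < M.+1) j%:R * binw M j)
    - \sum_(j < M.+1) j%:R ^+ 2 * binw M j.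
  rewrite !mulr_sumr -big_split/= -sumrB; apply: eq_bigr => j _.
  by rewrite -natr1; ring.
move: E; rewrite E1 E2 binw_sum binw_mean.
set s := \sum_(j < _) _ => E; lra.
Qed.

(* [psi] below is the discrete score of the joint density [binw j * a j]: summation
   by parts against it turns [T - (tau + j delta)] into [delta], and the bound is the
   nonnegativity of the weighted sum of [(t - lam psi)^2]. *)
Lemma van_trees_pointwise M (a : nat -> R) (T tau delta lam : R) :
  (forall j, (j <= M)%N -> 0 < a j) ->
  2 * lam * delta * (\sum_(j < M.+1) (M%:R - j%:R) * binw M j * a j) +
  2 * lam ^+ 2 * (\sum_(j < M.+1) j%:R * (M%:R - j%:R) * binw M j * a j.-1) <=
  \sum_(j < M.+1) binw M j * (a j * (T - (tau + j%:R * delta)) ^+ 2) +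
  lam ^+ 2 * (\sum_(j < M.+1) binw M j *
    (j%:R ^+ 2 * (a j.-1 ^+ 2 / a j) + (M%:R - j%:R) ^+ 2 * a j)).
Proof.
move=> a0; pose t j : R := T - (tau + j%:R * delta).
pose psi j : R := (M%:R - j%:R) - j%:R * (a j.-1 / a j).
have sq : 0 <= \sum_(j < M.+1) binw M j * (a j * (t j - lam * psi j) ^+ 2).
  apply: sumr_ge0 => j _; rewrite mulr_ge0 ?binw_ge0// mulr_ge0 ?sqr_ge0//.
  by rewrite (ltW (a0 _ _))// -ltnS.
have cross : \sum_(j < M.+1) binw M j * (a j * psi j * t j) =
    delta * (\sum_(j < M.+1) (M%:R - j%:R) * binw M j * a j).
  transitivity (\sum_(j < M.+1) (M%:R - j%:R) * binw M j * (a j * t j) -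
      \sum_(j < M.+1) j%:R * binw M j * (a j.-1 * t j)).
    rewrite -sumrB; apply: eq_bigr => j _; rewrite /psi.
    by field; rewrite gt_eqF// a0// -ltnS.
  rewrite (binw_summation_by_parts M (fun j => a j.-1 * t j)) -sumrB mulr_sumr.
  by apply: eq_bigr => j _; rewrite /t/= -natr1; ring.
have expand : \sum_(j < M.+1) binw M j * (a j * (t j - lam * psi j) ^+ 2) =
    \sum_(j < M.+1) binw M j * (a j * t j ^+ 2) +
    lam ^+ 2 * (\sum_(j < M.+1) binw M j *
      (j%:R ^+ 2 * (a j.-1 ^+ 2 / a j) + (M%:R - j%:R) ^+ 2 * a j)) -
    2 * lam ^+ 2 * (\sum_(j < M.+1) j%:R * (M%:R - j%:R) * binw M j * a j.-1) -
    2 * lam * (\sum_(j < M.+1) binw M j * (a j * psi j * t j)).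
  rewrite !mulr_sumr -big_split/= -!sumrB; apply: eq_bigr => j _; rewrite /psi.
  by field; rewrite gt_eqF// a0// -ltnS.
move: sq; rewrite expand cross.
set A := \sum_(j < _) _; set B := \sum_(j < _) _; set C := \sum_(j < _) _.
set D := \sum_(j < _) _.
rewrite -/A -/B -/C -/D; lra.
Qed.

End Binomial.

Section VanTrees.
Variable R : realType.
Local Notation leb := (@lebesgue_measure R).

Lemma leb_int0 n : leb_int (fun _ : n.-tuple R => 0%:E) = 0%:E.
Proof.
elim: n => [//|n IH] /=; rewrite -[RHS](@integral0 _ _ _ leb setT).
by apply: eq_integral => t _; exact: IH.
Qed.

Lemma leb_int_lin n (I : finType) (c : I -> R) (F : I -> n.-tuple R -> \bar R) :
  (forall i, 0 <= c i) -> (forall i, measurable_fun setT (F i)) ->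
  (forall i y, (0 <= F i y)%E) ->
  (leb_int (fun y => \sum_i (c i)%:E * F i y) = \sum_i (c i)%:E * leb_int (F i))%E.
Proof.
move=> c0 mF F0; rewrite leb_int_sum.
- by apply: eq_bigr => i _; rewrite leb_intZl.
- by move=> i; apply: emeasurable_funM => //; exact: measurable_cst.
- by move=> i y; rewrite mule_ge0// lee_fin.
Qed.

Lemma measurable_lin n (I : finType) (c : I -> R) (F : I -> n.-tuple R -> \bar R) :
  (forall i, measurable_fun setT (F i)) ->
  measurable_fun setT (fun y => \sum_i (c i)%:E * F i y)%E.
Proof.
by move=> mF; apply: emeasurable_sum => i; apply: emeasurable_funM => //; exact: measurable_cst.
Qed.

Lemma lin_ge0 n (I : finType) (c : I -> R) (F : I -> n.-tuple R -> \bar R) y :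
  (forall i, 0 <= c i) -> (forall i y, (0 <= F i y)%E) ->
  (0 <= \sum_i (c i)%:E * F i y)%E.
Proof. by move=> c0 F0; apply: sume_ge0 => i _; rewrite mule_ge0// lee_fin. Qed.

Lemma discrete_van_trees n M (f : nat -> n.-tuple R -> R) (T : n.-tuple R -> R)
    (tau delta X : R) (z : nat -> R) :
  (0 < M)%N -> 0 <= X ->
  (forall j, (j <= M)%N -> measurable_fun setT (f j)) ->
  (forall j y, (j <= M)%N -> 0 < f j y) ->
  (forall j, (j <= M)%N -> leb_int (fun y => (f j y)%:E) = 1%E) ->
  (forall j, (j < M)%N -> measurable_fun setT (fun y => f j y ^+ 2 / f j.+1 y)) ->
  (forall j, (j < M)%N -> (leb_int (fun y => (f j y ^+ 2 / f j.+1 y)%:E) <= (1 + X)%:E)%E) ->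
  measurable_fun setT T ->
  (forall j, (j <= M)%N ->
    leb_int (fun y => (f j y * (T y - (tau + j%:R * delta)) ^+ 2)%:E) = (z j)%:E) ->
  (delta * M%:R / 2) ^+ 2 <=
  (\sum_(j < M.+1) binw R M j * z j) * (M%:R + X * ((M%:R ^+ 2 + M%:R) / 4)).
Proof.
move=> M0 X0 mf f0 f1 mr fX mT fz.
have m0 : 0 < M%:R :> R by rewrite ltr0n.
pose B : R := M%:R + X * ((M%:R ^+ 2 + M%:R) / 4).
have B0 : 0 < B by rewrite ltr_wpDr// mulr_ge0// divr_ge0// addr_ge0 ?exprn_ge0 ?ler0n.
pose lam := delta * M%:R / (2 * B).
pose w := binw R M.
have w0 j : 0 <= w j by exact: binw_ge0.
have ld : 0 <= 2 * lam * delta.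
  rewrite /lam; have -> : 2 * (delta * M%:R / (2 * B)) * delta = delta ^+ 2 * M%:R / B.
    by field; rewrite gt_eqF.
  by rewrite mulr_ge0 ?invr_ge0 ?(ltW B0)// mulr_ge0 ?sqr_ge0// ler0n.
have l2 : 0 <= lam ^+ 2 by rewrite sqr_ge0.
have jM (j : 'I_M.+1) : (j <= M)%N by rewrite -ltnS.
have jM1 (j : 'I_M.+1) : (j.-1 <= M)%N by rewrite (leq_trans (leq_pred _)).
have Mj (j : 'I_M.+1) : 0 <= (M%:R - j%:R : R) by rewrite subr_ge0 ler_nat.
pose F1 (j : 'I_M.+1) (y : n.-tuple R) : \bar R := (f j y)%:E.
pose F2 (j : 'I_M.+1) (y : n.-tuple R) : \bar R := (f j.-1 y)%:E.
pose F3 (j : 'I_M.+1) (y : n.-tuple R) : \bar R := (f j y * (T y - (tau + j%:R * delta)) ^+ 2)%:E.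
pose F4 (j : 'I_M.+1) (y : n.-tuple R) : \bar R :=
  (if j : nat is i.+1 then f i y ^+ 2 / f i.+1 y else 0)%:E.
have mF1 j : measurable_fun setT (F1 j) by apply/measurable_EFinP; exact: mf.
have mF2 j : measurable_fun setT (F2 j) by apply/measurable_EFinP; exact: mf.
have mF3 j : measurable_fun setT (F3 j).
  apply/measurable_EFinP; apply: measurable_funM; first exact: mf.
  by apply: measurable_funX; exact: measurable_funB.
have mF4 j : measurable_fun setT (F4 j).
  apply/measurable_EFinP; case: j => -[|i] //= ij; exact: mr.
have F10 j y : (0 <= F1 j y)%E by rewrite lee_fin ltW// f0.
have F20 j y : (0 <= F2 j y)%E by rewrite lee_fin ltW// f0.
have F30 j y : (0 <= F3 j y)%E by rewrite lee_fin mulr_ge0 ?sqr_ge0// ltW// f0.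
have F40 j y : (0 <= F4 j y)%E.
  rewrite lee_fin; case: j => -[|i] //= ij.
  by rewrite divr_ge0 ?sqr_ge0// ltW// f0.
pose c1 (j : 'I_M.+1) := 2 * lam * delta * ((M%:R - j%:R) * w j).
pose c2 (j : 'I_M.+1) := 2 * lam ^+ 2 * (j%:R * (M%:R - j%:R) * w j).
pose c3 (j : 'I_M.+1) := w j.
pose c4 (j : 'I_M.+1) := lam ^+ 2 * (w j * j%:R ^+ 2).
pose c5 (j : 'I_M.+1) := lam ^+ 2 * (w j * (M%:R - j%:R) ^+ 2).
have c10 j : 0 <= c1 j by rewrite mulr_ge0// mulr_ge0.
have c20 j : 0 <= c2 j.
  by apply: mulr_ge0; [exact: mulr_ge0|]; apply: mulr_ge0 => //; exact: mulr_ge0.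
have c30 j : 0 <= c3 j by exact: w0.
have c40 j : 0 <= c4 j by rewrite mulr_ge0// mulr_ge0 ?sqr_ge0.
have c50 j : 0 <= c5 j by rewrite mulr_ge0// mulr_ge0 ?sqr_ge0.
have key : (leb_int (fun y => \sum_i (c1 i)%:E * F1 i y + \sum_i (c2 i)%:E * F2 i y) <=
    leb_int (fun y => \sum_i (c3 i)%:E * F3 i y +
      (\sum_i (c4 i)%:E * F4 i y + \sum_i (c5 i)%:E * F1 i y)))%E.
  apply: le_leb_int.
  - by apply: emeasurable_funD; exact: measurable_lin.
  - by apply: emeasurable_funD; [|apply: emeasurable_funD]; exact: measurable_lin.
  - by move=> y; rewrite adde_ge0 ?lin_ge0.
  move=> y; have := @van_trees_pointwise R M (fun j => f j y) (T y) tau delta lam.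
  move=> /(_ (fun j jm => f0 j y jm)) h.
  under eq_bigr do rewrite /F1 -EFinM.
  under [X in (_ + X <= _)%E]eq_bigr do rewrite /F2 -EFinM.
  under [X in (_ <= X + _)%E]eq_bigr do rewrite /F3 -EFinM.
  under [X in (_ <= _ + (X + _))%E]eq_bigr do rewrite /F4 -EFinM.
  under [X in (_ <= _ + (_ + X))%E]eq_bigr do rewrite /F1 -EFinM.
  rewrite !sumEFin -!EFinD lee_fin.
  apply: le_trans (le_trans h _); rewrite le_eqVlt; apply/orP; left; apply/eqP.
    rewrite !mulr_sumr; congr (_ + _); apply: eq_bigr => j _; rewrite /c1 /c2 -/w; ring.
  rewrite !mulr_sumr; congr (_ + _); rewrite -big_split/=; apply: eq_bigr => j _.
  rewrite /c4 /c5 -/w; case: (j : nat) => [|i] /=; ring.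
move: key; rewrite !leb_intD ?leb_int_lin//; last 10 first.
all: try by move=> y; rewrite ?adde_ge0 ?lin_ge0.
all: try by apply: emeasurable_funD; exact: measurable_lin.
all: try by exact: measurable_lin.
rewrite (eq_bigr (fun i => (c1 i)%:E)); last by move=> i _; rewrite f1// mule1.
rewrite [X in (_ + X <= _)%E](eq_bigr (fun i => (c2 i)%:E)); last first.
  by move=> i _; rewrite f1// mule1.
rewrite [X in (_ <= X + _)%E](eq_bigr (fun i => (c3 i * z i)%:E)); last first.
  by move=> i _; rewrite fz// -EFinM.
rewrite [X in (_ <= _ + (_ + X))%E](eq_bigr (fun i => (c5 i)%:E)); last first.
  by move=> i _; rewrite f1// mule1.
have le4 : (\sum_i (c4 i)%:E * leb_int (F4 i) <= \sum_i (c4 i * (1 + X))%:E)%E.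
  apply: lee_sum => i _; rewrite (EFinM (c4 i) (1 + X)).
  apply: lee_wpmul2l; first by rewrite lee_fin.
  rewrite /F4; case: i => -[|i] /= ij; last exact: fX.
  by rewrite leb_int0 lee_fin addr_ge0.
move=> h; have {h} : (\sum_i (c1 i)%:E + \sum_i (c2 i)%:E <=
    \sum_i (c3 i * z i)%:E + (\sum_i (c4 i * (1 + X))%:E + \sum_i (c5 i)%:E))%E.
  by apply: (le_trans h); rewrite leeD2l// leeD2r.
rewrite !sumEFin -!EFinD lee_fin.
have s1 : \sum_i c1 i = lam * delta * M%:R.
  rewrite -mulr_sumr.
  have -> : \sum_(j < M.+1) (M%:R - j%:R) * w j = M%:R - M%:R / 2.
    rewrite -[X in _ = _ - X]binw_mean -[X in _ = X - _]mulr1 -(binw_sum R M) mulr_sumr -sumrB.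
    by apply: eq_bigr => j _; rewrite mulrBl.
  by field.
have s245 : \sum_i c4 i * (1 + X) + \sum_i c5 i - \sum_i c2 i = lam ^+ 2 * B.
  have -> : B = M%:R ^+ 2 * (\sum_(j < M.+1) w j) - 4 * M%:R * (\sum_(j < M.+1) j%:R * w j)
     + (4 + X) * (\sum_(j < M.+1) j%:R ^+ 2 * w j).
    by rewrite binw_sum binw_mean binw_sqr /B; field.
  rewrite -big_split/= -sumrB !mulr_sumr -sumrB -big_split/= mulr_sumr.
  by apply: eq_bigr => j _; rewrite /c4 /c5 /c2; ring.
rewrite s1 -/B => h.
have {h} : lam * delta * M%:R - lam ^+ 2 * B <= \sum_i c3 i * z i by lra.
have -> : lam * delta * M%:R - lam ^+ 2 * B = (delta * M%:R / 2) ^+ 2 / B.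
  by rewrite /lam; field; rewrite gt_eqF.
by rewrite ler_pdivrMr.
Qed.

End VanTrees.

Section Likelihood.
Variable R : realType.
Local Notation leb := (@lebesgue_measure R).
Variable n : nat.
Implicit Types mu sg : 'I_n -> R.

Definition lik mu sg (y : n.-tuple R) : R :=
  \prod_(j < n) normal_pdf (mu j) (sg j) (tnth y j).

Lemma measurable_lik mu sg : measurable_fun setT (lik mu sg).
Proof.
exact: (@measurable_prod_tnth _ n (fun j => normal_pdf (mu j) (sg j))
  (fun j => measurable_normal_pdf _ _)).
Qed.

Lemma lik_gt0 mu sg y : (forall j, 0 < sg j) -> 0 < lik mu sg y.
Proof. by move=> s0; apply: prodr_gt0 => j _; exact: normal_pdf_gt0. Qed.

Lemma leb_int_lik mu sg : leb_int (fun y => (lik mu sg y)%:E) = 1%E.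
Proof.
rewrite (@leb_int_prod _ n (fun j => normal_pdf (mu j) (sg j))).
- by rewrite big1// => j _; exact: integral_normal_pdf.
- by move=> j; exact: measurable_normal_pdf.
- by move=> j t; exact: normal_pdf_ge0.
Qed.

Lemma iid_expect_lik mu sg (G : n.-tuple R -> R) : (forall j, 0 < sg j) ->
  measurable_fun setT G -> (forall y, 0 <= G y) ->
  iid_expect (normal_pdf 0 1) (fun xi => (G [tuple mu j + sg j * tnth xi j | j < n])%:E) =
  leb_int (fun y => (lik mu sg y * G y)%:E).
Proof.
move=> s0 mG G0.
rewrite (@iid_expect_affine R (normal_pdf 0 1) n mu sg (EFin \o G))//.
- congr leb_int; apply/funext => y; rewrite EFinM; congr (_%:E * _)%E.
  by apply: eq_bigr => j _; rewrite normal_pdf_affine.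
- exact: measurable_normal_pdf.
- by move=> t; exact: normal_pdf_ge0.
- exact/measurable_EFinP.
Qed.

Lemma measurable_normal_ratio (m1 s1 m0 s0 : R) : 0 < s0 -> 0 < s1 ->
  measurable_fun setT (fun x => normal_pdf m1 s1 x ^+ 2 / normal_pdf m0 s0 x).
Proof.
move=> s00 s10; apply: continuous_measurable_fun => x.
have c m s : s != 0 -> {for x, continuous (normal_pdf m s)} by move=> ?; exact: continuous_normal_pdf.
apply: cvgM; last first.
  by apply: cvgV; [rewrite gt_eqF// normal_pdf_gt0|apply: c; rewrite gt_eqF].
by under eq_fun do rewrite expr2; apply: cvgM; apply: c; rewrite gt_eqF.
Qed.

Lemma lik_ratioE mu1 sg1 mu0 sg0 y : lik mu1 sg1 y ^+ 2 / lik mu0 sg0 y =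
  \prod_(j < n) (normal_pdf (mu1 j) (sg1 j) (tnth y j) ^+ 2 /
                 normal_pdf (mu0 j) (sg0 j) (tnth y j)).
Proof. by rewrite /lik -prodrXl prodf_div. Qed.

Lemma measurable_lik_ratio mu1 sg1 mu0 sg0 : (forall j, 0 < sg0 j) -> (forall j, 0 < sg1 j) ->
  measurable_fun setT (fun y => lik mu1 sg1 y ^+ 2 / lik mu0 sg0 y).
Proof.
move=> s0 s1; under eq_fun do rewrite lik_ratioE.
apply: (@measurable_prod_tnth _ n (fun j x => normal_pdf (mu1 j) (sg1 j) x ^+ 2 /
                 normal_pdf (mu0 j) (sg0 j) x)) => j.
exact: measurable_normal_ratio.
Qed.

Lemma chi2_lik mu1 sg1 mu0 sg0 : (forall j, 0 < sg0 j) -> (forall j, 0 < sg1 j) ->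
  (forall j, 2 * ((sg1 j ^+ 2 - sg0 j ^+ 2) / sg0 j ^+ 2) ^+ 2 <= 1) ->
  (leb_int (fun y => (lik mu1 sg1 y ^+ 2 / lik mu0 sg0 y)%:E) <=
  (expR (\sum_(j < n) (((sg1 j ^+ 2 - sg0 j ^+ 2) / sg0 j ^+ 2) ^+ 2 +
     (mu1 j - mu0 j) ^+ 2 / (2 * sg0 j ^+ 2 - sg1 j ^+ 2))))%:E)%E.
Proof.
move=> s0 s1 a1.
under eq_fun do rewrite lik_ratioE.
rewrite (@leb_int_prod _ n (fun j x => normal_pdf (mu1 j) (sg1 j) x ^+ 2 /
                 normal_pdf (mu0 j) (sg0 j) x)); last 2 first.
- by move=> j; exact: measurable_normal_ratio.
- by move=> j t; rewrite divr_ge0 ?sqr_ge0 ?normal_pdf_ge0.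
rewrite expR_sum -prodEFin.
have pr (u v : 'I_n -> \bar R) : (forall j, 0 <= u j <= v j)%E ->
    (\prod_(j < n) u j <= \prod_(j < n) v j)%E.
  move=> uv; apply: (@proj2 (0 <= \prod_(j < n) u j)%E).
  elim/big_rec2 : _ => [|j x z _ [x0 xz]]; first by rewrite lexx lee01.
  have /andP[u0 uvj] := uv j.
  by split; [rewrite mule_ge0|apply: lee_pmul].
apply: pr => j; apply/andP; split; last exact: chi2_normal.
by apply: integral_ge0 => t _; rewrite lee_fin divr_ge0 ?sqr_ge0 ?normal_pdf_ge0.
Qed.

End Likelihood.

Section ProductPrior.
Variable R : realFieldType.
Variables (I T : finType) (w : T -> R).
Hypothesis w1 : \sum_t w t = 1.

Definition prodw (x : {ffun I -> T}) : R := \prod_i w (x i).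

Definition upd (x : {ffun I -> T}) (i : I) (t : T) : {ffun I -> T} :=
  [ffun k => if k == i then t else x k].

Lemma prodw_sum : \sum_x prodw x = 1.
Proof.
rewrite /prodw -(bigA_distr_bigA (fun (_ : I) t => w t)) big1// => i _.
Qed.

Lemma upd_same x i t : upd x i t i = t.
Proof. by rewrite ffunE eqxx. Qed.

Lemma upd_other x i t k : k != i -> upd x i t k = x k.
Proof. by move=> ki; rewrite ffunE (negbTE ki). Qed.

Lemma prodw_upd x i t : prodw (upd x i t) * w (x i) = prodw x * w t.
Proof.
rewrite /prodw (bigD1 i)//= [in RHS](bigD1 i)//= upd_same.
have -> : \prod_(k | k != i) w (upd x i t k) = \prod_(k | k != i) w (x k).
  by apply: eq_bigr => k ki; rewrite upd_other.
by ring.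
Qed.

Lemma prodw_resample (F : {ffun I -> T} -> R) i :
  \sum_x prodw x * F x = \sum_x prodw x * (\sum_t w t * F (upd x i t)).
Proof.
pose phi (z : {ffun I -> T} * T) := (upd z.1 i z.2, z.1 i).
have phiK : involutive phi.
  move=> [x t]; rewrite /phi/= upd_same; congr (_, _).
  by apply/ffunP => k; rewrite !ffunE; case: eqP => [->|].
transitivity (\sum_(z : {ffun I -> T} * T) prodw z.1 * w z.2 * F z.1).
  rewrite -(pair_bigA _ (fun x t => prodw x * w t * F x))/=; apply: eq_bigr => x _.
  by rewrite -mulr_suml -mulr_sumr w1 mulr1.
rewrite (reindex_inj (inv_inj phiK))/=.
transitivity (\sum_(z : {ffun I -> T} * T) prodw z.1 * (w z.2 * F (upd z.1 i z.2))).
  by apply: eq_bigr => -[x t] _ /=; rewrite prodw_upd mulrA.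
rewrite -(pair_bigA _ (fun x t => prodw x * (w t * F (upd x i t))))/=.
by apply: eq_bigr => x _; rewrite mulr_sumr.
Qed.

Lemma prodw_sqr (h : T -> R) (c : I -> R) : \sum_t w t * h t = 0 ->
  \sum_x prodw x * (\sum_i c i * h (x i)) ^+ 2 =
  (\sum_i c i ^+ 2) * (\sum_t w t * h t ^+ 2).
Proof.
move=> h0.
transitivity (\sum_i \sum_k c i * c k * (\sum_x prodw x * (h (x i) * h (x k)))).
  transitivity (\sum_x \sum_i \sum_k c i * c k * (prodw x * (h (x i) * h (x k)))).
    apply: eq_bigr => x _; rewrite expr2 mulr_suml mulr_sumr; apply: eq_bigr => i _.
    rewrite 2!mulr_sumr; apply: eq_bigr => k _; ring.
  rewrite exchange_big/=; apply: eq_bigr => i _; rewrite exchange_big/=.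
  by apply: eq_bigr => k _; rewrite mulr_sumr.
rewrite mulr_suml; apply: eq_bigr => i _.
rewrite (bigD1 i)//= [X in _ + X]big1 ?addr0 => [|k ki]; last first.
  rewrite (prodw_resample _ i) big1 ?mulr0// => x _.
  have -> : \sum_t w t * (h (upd x i t i) * h (upd x i t k)) = (\sum_t w t * h t) * h (x k).
    by rewrite mulr_suml; apply: eq_bigr => t _; rewrite upd_same upd_other// mulrA.
  by rewrite h0 mul0r mulr0.
rewrite (prodw_resample _ i) -expr2; congr (_ * _).
have -> : \sum_x prodw x * (\sum_t w t * (h (upd x i t i) * h (upd x i t i))) =
    \sum_x prodw x * (\sum_t w t * h t ^+ 2).
  by apply: eq_bigr => x _; congr (_ * _); apply: eq_bigr => t _; rewrite upd_same -expr2.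
by rewrite -mulr_suml prodw_sum mul1r.
Qed.

Hypothesis w0 : forall t, 0 <= w t.

Lemma prodw_ge0 x : 0 <= prodw x.
Proof. by apply: prodr_ge0 => i _; exact: w0. Qed.

Lemma prodw_chebyshev (q : T -> R) (c : I -> R) (B s : R) :
  (forall t, `|q t| <= B) -> 0 < s ->
  \sum_(x : {ffun I -> T} | s + (\sum_i c i) * (\sum_t w t * q t) <= \sum_i c i * q (x i)) prodw x <=
  B ^+ 2 * (\sum_i c i ^+ 2) / s ^+ 2.
Proof.
move=> qB s0; set qb := \sum_t w t * q t.
pose h t := q t - qb.
have h0 : \sum_t w t * h t = 0.
  under eq_bigr do rewrite /h mulrBr.
  by rewrite sumrB -mulr_suml w1 mul1r subrr.
have hB : \sum_t w t * h t ^+ 2 <= B ^+ 2.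
  have -> : \sum_t w t * h t ^+ 2 = \sum_t w t * q t ^+ 2 - qb ^+ 2.
    have gen v : \sum_t w t * (q t - v) ^+ 2 =
        \sum_t w t * q t ^+ 2 - 2 * v * (\sum_t w t * q t) + v ^+ 2 * (\sum_t w t).
      rewrite !mulr_sumr -sumrB -big_split/=; apply: eq_bigr => t _; ring.
    rewrite /h gen -/qb w1; ring.
  have : \sum_t w t * q t ^+ 2 <= \sum_t w t * B ^+ 2.
    apply: ler_sum => t _; apply: ler_wpM2l => //.
    by rewrite -(real_normK (num_real (q t))) ler_sqr ?nnegrE// (le_trans (normr_ge0 _) (qB t)).
  by rewrite -mulr_suml w1 mul1r; have := sqr_ge0 qb; lra.
rewrite ler_pdivlMr ?exprn_gt0// mulr_suml.
apply: (@le_trans _ _ (\sum_x prodw x * (\sum_i c i * h (x i)) ^+ 2)); last first.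
  rewrite (prodw_sqr c h0) mulrC ler_wpM2r// sumr_ge0// => i _; exact: sqr_ge0.
rewrite [leRHS](bigID (fun x : {ffun I -> T} => s + (\sum_i c i) * qb <= \sum_i c i * q (x i)))/=.
apply: ler_wpDr; first by apply: sumr_ge0 => x _; rewrite mulr_ge0 ?sqr_ge0 ?prodw_ge0.
apply: ler_sum => x hx; apply: ler_wpM2l; first exact: prodw_ge0.
have -> : \sum_i c i * h (x i) = \sum_i c i * q (x i) - (\sum_i c i) * qb.
  by rewrite mulr_suml -sumrB; apply: eq_bigr => i _; rewrite mulrBr.
rewrite ler_sqr ?nnegrE; [lra|lra|lra].
Qed.

End ProductPrior.

(** * Functions tiled from cells *)

Section Glue.
Variable R : realType.

Lemma is_derive_quot (f : R -> R) (a l : R) :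
  (h^-1 * (f (h + a) - f a) @[h --> 0^'] --> l) <-> is_derive a (1 : R) f l.
Proof.
have E : (fun h : R => h^-1 *: ((f \o shift a) (h *: (1 : R)) - f a)) =
    (fun h => h^-1 * (f (h + a) - f a)).
  by apply/funext => h; rewrite /GRing.scale/= mulr1.
split=> [fl|[df <-]].
  apply: DeriveDef; first by rewrite /derivable E; apply/cvg_ex; exists l.
  by rewrite /derive E; exact/cvg_lim.
by move: df; rewrite /derivable/derive E.
Qed.

Lemma der_glue (f g : R -> R) (a l : R) : f a = g a ->
  is_derive a (1 : R) f l -> is_derive a (1 : R) g l ->
  is_derive a (1 : R) (fun x => if x < a then f x else g x) l.
Proof.
move=> fg /is_derive_quot/cvgrPdist_lt fl /is_derive_quot/cvgrPdist_lt gl.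
apply/is_derive_quot/cvgrPdist_lt => e e0.
near=> h.
rewrite ltxx; case: (ltP (h + a) a) => _; rewrite -?fg.
  by near: h; exact: fl.
by rewrite fg; near: h; exact: gl.
Unshelve. all: by end_near. Qed.

End Glue.

Section Piecewise.
Variable R : realType.
Local Notation leb := (@lebesgue_measure R).
Implicit Types (F DF : int -> R -> R) (K t : R).

Definition tile K F t : R :=
  F (Num.floor (K * t)) (K * t - (Num.floor (K * t))%:~R).

Lemma tileE K F (z : int) t : z%:~R <= K * t < (z + 1)%:~R -> tile K F t = F z (K * t - z%:~R).
Proof. by move=> zt; rewrite /tile (floor_def zt). Qed.

Lemma tileE_closed K F (z : int) t : (forall z, F z 0 = 0) -> (forall z, F z 1 = 0) ->
  z%:~R <= K * t <= (z + 1)%:~R -> tile K F t = F z (K * t - z%:~R).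
Proof.
move=> F0 F1 /andP[z1]; rewrite le_eqVlt => /predU1P[E|z2]; last by apply: tileE; rewrite z1.
rewrite (@tileE K F (z + 1)) E ?lexx/=; last by rewrite ltr_int ltzD1.
by rewrite subrr F0 intrD addrAC subrr add0r F1.
Qed.

Lemma der_tile K F DF t : 0 < K ->
  (forall z x, is_derive x (1 : R) (F z) (DF z x)) ->
  (forall z, F z 0 = 0) -> (forall z, F z 1 = 0) ->
  (forall z, DF z 0 = 0) -> (forall z, DF z 1 = 0) ->
  is_derive t (1 : R) (tile K F) (K * tile K DF t).
Proof.
move=> K0 dF F0 F1 DF0 DF1.
have dFz z w x : is_derive x (1 : R) (fun s => F z (K * s - w)) (K * DF z (K * x - w)).
  have h : is_derive x (1 : R) (fun s => K * s - w) K.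
    by apply: (is_derive_eq (isd_add (isd_scale K (isd_id x)) (isd_cst (- w) x))); rewrite mulr1 addr0.
  have h2 := @isd_comp _ (F z) (fun s => K * s - w) x _ _ (dF z _) h.
  apply: (is_derive_eq h2).
  by rewrite mulrC.
pose z := Num.floor (K * t).
have /andP[zt tz] : z%:~R <= K * t < (z + 1)%:~R by exact: floor_itv.
have K0' : K != 0 by rewrite gt_eqF.
have tz1 : t < (z + 1)%:~R / K by rewrite ltr_pdivlMr// mulrC.
move: zt; rewrite le_eqVlt => /predU1P[zt|zt].
- have tE : t = z%:~R / K by rewrite zt mulrAC divff// mul1r.
  have zt1 : (z - 1)%:~R / K < t.
    by rewrite tE ltr_pM2r ?invr_gt0// ltr_int gtrBl.
  pose H s := if s < t then F (z - 1) (K * s - (z - 1)%:~R) else F z (K * s - z%:~R).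
  apply: (@near_eq_is_derive _ _ _ H).
    near=> s; rewrite /H; case: ltP => st; apply/esym/tileE.
      apply/andP; split.
        by rewrite (mulrC K) -ler_pdivrMr// ltW//; near: s; exact: lt_nbhsr.
      by rewrite subrK (mulrC K) -ltr_pdivlMr// -tE.
    apply/andP; split; first by rewrite zt ler_pM2l.
    by rewrite (mulrC K) -ltr_pdivlMr//; near: s; exact: lt_nbhsl.
  have -> : K * tile K DF t = K * DF z (K * t - z%:~R) by [].
  apply: der_glue.
  + by rewrite -zt subrr F0 rmorphB/= opprB addrCA subrr addr0 F1.
  + apply: (is_derive_eq (dFz _ _ _)).
    by rewrite -zt subrr DF0 rmorphB/= opprB addrCA subrr addr0 DF1.
- have zt1 : z%:~R / K < t by rewrite ltr_pdivrMr// mulrC.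
  have -> : K * tile K DF t = K * DF z (K * t - z%:~R) by [].
  apply: (near_eq_is_derive _ (dFz z z%:~R t)).
    near=> s; apply/esym/tileE; apply/andP; split.
      by rewrite (mulrC K) -ler_pdivrMr// ltW//; near: s; exact: lt_nbhsr.
    by rewrite (mulrC K) -ltr_pdivlMr//; near: s; exact: lt_nbhsl.
Unshelve. all: by end_near. Qed.

Lemma tile_periodic (K : nat) F t : (0 < K)%N -> (forall z, F (z + K%:Z) = F z) ->
  tile K%:R F (t + 1) = tile K%:R F t.
Proof.
move=> K0 FK; rewrite /tile mulrDr mulr1 floorDrz; last by rewrite natr_int.
rewrite (intrKfloor (Posz K) : Num.floor (K%:R : R) = K) FK intrD.
by congr F; rewrite opprD addrACA subrr addr0.
Qed.

Section Chain.
Variables (k : nat) (K : R) (F : nat -> int -> R -> R).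
Hypotheses (K0 : 0 < K)
  (dF : forall j z x, is_derive x (1 : R) (F j z) (F j.+1 z x))
  (F0 : forall j z, (j <= k)%N -> F j z 0 = 0)
  (F1 : forall j z, (j <= k)%N -> F j z 1 = 0).

Lemma der_tile_chain j t : (j < k)%N ->
  is_derive t (1 : R) (tile K (F j)) (K * tile K (F j.+1) t).
Proof.
by move=> jk; apply: der_tile => // z; rewrite ?F0 ?F1// ltnW.
Qed.

Lemma derive1n_tile j : (j <= k)%N ->
  derive1n j (tile K (F 0)) = (fun t => K ^+ j * tile K (F j) t).
Proof.
elim: j => [|j IH] jk; first by apply/funext => t; rewrite expr0 mul1r.
rewrite derive1nS IH ?(ltnW jk)//; apply/funext => t.
rewrite derive1E.
rewrite (@derive_val _ _ _ _ _ _ _ (isd_scale (K ^+ j) (der_tile_chain t jk))).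
by rewrite exprSr mulrA.
Qed.

Lemma derivable_tile j t : (j < k)%N -> derivable (derive1n j (tile K (F 0))) t 1.
Proof.
move=> jk; rewrite derive1n_tile ?(ltnW jk)//.
exact: (@ex_derive _ _ _ _ _ _ _ (isd_scale (K ^+ j) (der_tile_chain t jk))).
Qed.

End Chain.

Lemma integral_tile (u : R -> R) (K : nat) F : (0 < K)%N ->
  measurable_fun setT u -> (forall y, 0 <= u y) ->
  (forall z, F z 0 = 0) -> (forall z, F z 1 = 0) ->
  (forall z, measurable_fun setT (F z)) ->
  measurable_fun setT (tile K%:R F) ->
  (\int[leb]_(t in @I01 R) (u (tile K%:R F t))%:E =
   (K%:R^-1)%:E * \sum_(m < K) \int[leb]_(x in @I01 R) (u (F m x))%:E)%E.
Proof.
move=> K0 mu u0 F0 F1 mF mpw.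
have k0 : 0 < K%:R :> R by rewrite ltr0n.
have mup : measurable_fun setT (fun t => (u (tile K%:R F t))%:E).
  by apply/measurable_EFinP; exact: measurableT_comp.
have piece (m : nat) : (\int[leb]_(t in `[(m%:R / K%:R)%R, (m.+1%:R / K%:R)%R]) (u (tile K%:R F t))%:E =
    (K%:R^-1)%:E * \int[leb]_(x in @I01 R) (u (F m x))%:E)%E.
  pose G : R -> \bar R := (fun x => (u (F m x))%:E) \_ (@I01 R).
  have G0 y : (0 <= G y)%E by rewrite /G patchE; case: ifP => // _; rewrite lee_fin.
  have mG : measurable_fun setT G.
    apply/(measurable_restrictT _ _).1 => //; first exact: measurable_itv.
    apply/measurable_EFinP; apply: measurable_funTS; exact: measurableT_comp.
  rewrite [in RHS]integral_mkcond -/G (@integral_affine R (- m%:R) K%:R)//.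
  rewrite muleA -EFinM mulVf ?gt_eqF// mul1e integral_mkcond.
  apply: eq_integral => t _; rewrite /G !patchE /I01.
  have -> : (t \in [set` `[m%:R / K%:R, m.+1%:R / K%:R]]) = ((- m%:R + K%:R * t) \in [set` `[0, 1]]).
    have m1 : m.+1%:R = m%:R + 1 :> R by rewrite natr1.
    apply/idP/idP; rewrite !inE/= !in_itv/= ler_pdivrMr// ler_pdivlMr// m1 => /andP[h1 h2];
      apply/andP; split; lra.
  case: ifPn => // /set_mem/=; rewrite in_itv/= => /andP[h1 h2].
  rewrite (@tileE_closed _ _ m)//; first by rewrite addrC.
  rewrite intrD -!pmulrn; apply/andP; split; lra.
suff H (m : nat) : (m <= K)%N -> (\int[leb]_(t in `[0%R, (m%:R / K%:R)%R]) (u (tile K%:R F t))%:E =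
   (K%:R^-1)%:E * \sum_(i < m) \int[leb]_(x in @I01 R) (u (F i x))%:E)%E.
  by rewrite -H// divff ?gt_eqF.
elim: m => [_|m IH mK].
  by rewrite mul0r set_itv1 integral_set1 big_ord0 mule0.
have -> : [set` `[0%R : R, (m.+1%:R / K%:R)%R]] =
    [set` `[0%R : R, (m%:R / K%:R)%R]] `|` [set` `](m%:R / K%:R)%R : R, (m.+1%:R / K%:R)%R]].
  rewrite -itv_bndbnd_setU//= ?bnd_simp ?divr_ge0//.
  by rewrite ler_pM2r ?invr_gt0// ler_nat.
rewrite ge0_integral_setU//; last 3 first.
- exact: measurable_funTS.
- by move=> x _; rewrite lee_fin.
- apply/disj_setPS => x [] /=; rewrite !in_itv/= => /andP[_ h1] /andP[h2 _].
  by have := lt_le_trans h2 h1; rewrite ltxx.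
rewrite IH ?(ltnW mK)// big_ord_recr/= ge0_muleDr ?integral_ge0//; last 2 first.
- by apply: sume_ge0 => i _; apply: integral_ge0 => x _; rewrite lee_fin.
- by move=> x _; rewrite lee_fin.
congr (_ + _)%E; rewrite -piece integral_itv_obnd_cbnd//.
exact: measurable_funTS.
Qed.

End Piecewise.

(** * Energy of modulated sines *)

Section TrigPoly.
Variable R : realType.
Local Notation leb := (@lebesgue_measure R).
Implicit Types (om x : R) (pq : {poly R} * {poly R}).

Definition tp om pq x : R := pq.1.[x] * cos (om * x) + pq.2.[x] * sin (om * x).

Definition tpD om pq : {poly R} * {poly R} :=
  (pq.1^`() + om *: pq.2, pq.2^`() - om *: pq.1).

Definition tpn om pq j := iter j (tpD om) pq.

Definition tprot pq : {poly R} * {poly R} := (pq.2, - pq.1).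

Lemma is_derive_tp om pq x : is_derive x (1 : R) (tp om pq) (tp om (tpD om pq) x).
Proof.
have dl : is_derive x (1 : R) (fun t => om * t) (om * 1) by exact: isd_scale (isd_id x).
apply: (is_derive_eq (isd_add
  (isd_mul (is_derive_poly pq.1 x) (@isd_comp _ cos (fun t => om * t) x _ _ (is_derive_cos _) dl))
  (isd_mul (is_derive_poly pq.2 x) (@isd_comp _ sin (fun t => om * t) x _ _ (is_derive_sin _) dl)))).
rewrite /tp /tpD/= !hornerD hornerN !hornerZ mulr1.
set a := _^`().[x]; set b := _^`().[x]; set p := pq.1.[x]; set q := pq.2.[x].
ring.
Qed.

Lemma is_derive_tpn om pq j x :
  is_derive x (1 : R) (tp om (tpn om pq j)) (tp om (tpn om pq j.+1) x).
Proof. exact: is_derive_tp. Qed.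

Lemma continuous_tp om pq : continuous (tp om pq).
Proof. exact: der_continuous (is_derive_tp om pq). Qed.

Lemma measurable_tp om pq : measurable_fun setT (tp om pq).
Proof. by apply: continuous_measurable_fun => x; exact: continuous_tp. Qed.

Definition pvanish a (p : {poly R}) := exists u, p = ('X * (1 - 'X)) ^+ a * u.

Lemma pvanishD a p q : pvanish a p -> pvanish a q -> pvanish a (p + q).
Proof. by move=> [u ->] [v ->]; exists (u + v); rewrite -mulrDr. Qed.

Lemma pvanishZ a c p : pvanish a p -> pvanish a (c *: p).
Proof. by move=> [u ->]; exists (c *: u); rewrite scalerAr. Qed.

Lemma pvanish_weaken a p : pvanish a.+1 p -> pvanish a p.
Proof. by move=> [u ->]; exists ('X * (1 - 'X) * u); rewrite exprSr -mulrA. Qed.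

Lemma pvanish_deriv a p : pvanish a.+1 p -> pvanish a p^`().
Proof.
move=> [u ->]; set Q := 'X * (1 - 'X).
exists (a.+1%:R * Q^`() * u + Q * u^`()).
rewrite derivM deriv_exp/= -mulr_natl exprS; ring.
Qed.

Lemma pvanish_tpn om pq a j : (j <= a)%N -> pvanish a pq.1 -> pvanish a pq.2 ->
  pvanish (a - j) (tpn om pq j).1 /\ pvanish (a - j) (tpn om pq j).2.
Proof.
move=> + h1 h2; elim: j => [|j IH] ja; first by rewrite subn0.
have := IH (ltnW ja); rewrite (_ : a - j = (a - j.+1).+1)%N; last by rewrite -subSn.
move=> [v1 v2]; split; rewrite /tpn iterS -/(tpn om pq j)/=.
  by apply: pvanishD; [exact: pvanish_deriv|apply: pvanishZ; exact: pvanish_weaken].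
rewrite -scaleNr.
by apply: pvanishD; [exact: pvanish_deriv|apply: pvanishZ; exact: pvanish_weaken].
Qed.

Lemma pvanish_eval a p x : (0 < a)%N -> x = 0 \/ x = 1 -> pvanish a p -> p.[x] = 0.
Proof.
case: a => // a _ x01 [u ->]; rewrite exprS !hornerE.
by case: x01 => ->; rewrite ?subrr ?mul0r ?mulr0 ?mul0r.
Qed.

Lemma tpn_eval01 om pq a j x : (j < a)%N -> pvanish a pq.1 -> pvanish a pq.2 ->
  x = 0 \/ x = 1 -> tp om (tpn om pq j) x = 0.
Proof.
move=> ja h1 h2 x01; have [v1 v2] := pvanish_tpn om (ltnW ja) h1 h2.
rewrite /tp (pvanish_eval _ x01 v1) ?subn_gt0// (pvanish_eval _ x01 v2) ?subn_gt0//.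
by rewrite !mul0r addr0.
Qed.

Lemma horner_bound (p : {poly R}) : exists2 B : R, 0 <= B &
  forall x, 0 <= x <= 1 -> `|p.[x]| <= B.
Proof.
exists (\sum_(i < size p) `|p`_i|); first exact: sumr_ge0.
move=> x /andP[x0 x1]; rewrite horner_coef (le_trans (ler_norm_sum _ _ _))//.
apply: ler_sum => i _; rewrite normrM ler_piMr// normrX ger0_norm//.
exact: exprn_ile1.
Qed.

Lemma tp_bound pq : exists2 B : R, 0 <= B &
  forall om x, 0 <= x <= 1 -> `|tp om pq x| <= B.
Proof.
have [B1 B10 h1] := horner_bound pq.1; have [B2 B20 h2] := horner_bound pq.2.
exists (B1 + B2); first exact: addr_ge0.
move=> om x x01; rewrite /tp (le_trans (ler_normD _ _))// !normrM lerD//.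
  by rewrite (le_trans _ (h1 x x01))// ler_piMr// ler_norml cos_geN1 cos_le1.
by rewrite (le_trans _ (h2 x x01))// ler_piMr// ler_norml sin_geN1 sin_le1.
Qed.

Lemma tpn_linear om j pq pq' c x :
  tp om (tpn om (pq.1 + c *: pq'.1, pq.2 + c *: pq'.2) j) x =
  tp om (tpn om pq j) x + c * tp om (tpn om pq' j) x.
Proof.
have E : tpn om (pq.1 + c *: pq'.1, pq.2 + c *: pq'.2) j =
    ((tpn om pq j).1 + c *: (tpn om pq' j).1, (tpn om pq j).2 + c *: (tpn om pq' j).2).
  elim: j => [//|j IH]; rewrite /tpn !iterS -/(tpn _ _ _) IH /tpD/=.
  congr (_, _); rewrite !derivD !derivZ !scalerDr !scalerA (mulrC om c) -!scalerA.
    by rewrite addrACA.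
  by rewrite opprD scalerN addrACA.
by rewrite E /tp/= !hornerE; ring.
Qed.

Lemma tpn_leading j pq : exists2 C : R, 0 <= C & forall om x, 1 <= om -> 0 <= x <= 1 ->
  `|tp om (tpn om pq j) x - om ^+ j * tp om (iter j tprot pq) x| <= C * (om ^+ j / om).
Proof.
elim: j pq => [|j IH] pq.
  exists 0 => // om x om1 x01.
  by rewrite expr0 mul1r subrr normr0 mul0r.
have [C1 C10 h1] := IH (pq.1^`(), pq.2^`()).
have [C2 C20 h2] := IH (tprot pq).
have [B B0 hB] := tp_bound (iter j tprot (pq.1^`(), pq.2^`())).
exists (B + C1 + C2); first by rewrite !addr_ge0.
move=> om x om1 x01.
have om0 : 0 < om by lra.
have omj : 0 < om ^+ j by rewrite exprn_gt0.
have -> : tp om (tpn om pq j.+1) x = tp om (tpn om (pq.1^`(), pq.2^`()) j) x +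
    om * tp om (tpn om (tprot pq) j) x.
  rewrite -tpn_linear /tpn iterSr; congr (tp om (iter _ _ _) x).
  by rewrite /tpD/= scalerN.
rewrite iterSr exprS.
have := h1 om x om1 x01; have := h2 om x om1 x01; have := hB om x x01.
set t1 := tp om (tpn om (pq.1^`(), _) j) x; set t2 := tp om (tpn om (tprot pq) j) x.
set r1 := tp om (iter j tprot (pq.1^`(), _)) x; set r2 := tp om (iter j tprot (tprot pq)) x.
move=> k1 k2 k3.
have -> : t1 + om * t2 - om * om ^+ j * r2 =
   (t1 - om ^+ j * r1) + om ^+ j * r1 + om * (t2 - om ^+ j * r2) by ring.
have -> : (B + C1 + C2) * (om * om ^+ j / om) = C1 * om ^+ j + om ^+ j * B + C2 * om ^+ j.
  by field; rewrite gt_eqF.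
apply: (le_trans (ler_normD _ _)); apply: lerD; first apply: (le_trans (ler_normD _ _)); first apply: lerD.
- apply: (le_trans k3); rewrite ler_wpM2l// ler_pdivrMr// ler_peMr// ltW//.
- by rewrite normrM (gtr0_norm omj) ler_wpM2l// ltW.
- rewrite normrM (gtr0_norm om0) -ler_pdivlMl//.
  by apply: (le_trans k2); rewrite mulrA mulrC.
Qed.

Definition trig (j : nat) x : R := if odd j then cos x else sin x.

Lemma tprot_trig j (a : {poly R}) om x :
  (tp om (iter j tprot (0, a)) x) ^+ 2 = (a.[x] * trig j (om * x)) ^+ 2.
Proof.
have E : iter j tprot (0, a) = (if odd j then ((-1) ^+ j./2 *: a, 0) else (0, (-1) ^+ j./2 *: a)).
  elim: j => [|j IH]; first by rewrite /= expr0 scale1r.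
  rewrite iterS IH /= /tprot; case: (boolP (odd j)) => oj /=; rewrite ?oppr0.
    by rewrite uphalf_half oj /= exprS mulN1r scaleNr.
  by rewrite uphalf_half (negbTE oj).
rewrite E /trig; case: (odd j); rewrite /tp/= !hornerE ?add0r ?addr0.
  by rewrite !exprMn sqrr_sign mul1r.
by rewrite !exprMn sqrr_sign mul1r.
Qed.

Lemma sin_natpi (n : nat) : sin (n%:R * pi : R) = 0.
Proof. by elim: n => [|n IH]; rewrite ?mul0r ?sin0// -natr1 mulrDl mul1r sinDpi IH oppr0. Qed.

Lemma integral_trig_sqr j (i : nat) :
  (\int[leb]_(x in @I01 R) (2 * trig j (pi * i.+1%:R * x) ^+ 2)%:E = 1)%E.
Proof.
pose om : R := pi * i.+1%:R.
have om0 : om != 0 by rewrite mulf_neq0// ?gt_eqF ?pi_gt0.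
pose e : R := if odd j then 1 else -1.
have dl x : is_derive x (1 : R) (fun t => 2 * om * t) (2 * om * 1) by exact: isd_scale (isd_id x).
have tE x : 2 * trig j (om * x) ^+ 2 = 1 + e * cos (2 * om * x).
  have -> : 2 * om * x = om * x + om * x by ring.
  rewrite cosD /trig /e; have := cos2Dsin2 (om * x).
  by case: (odd j) => h; lra.
under eq_integral do rewrite tE.
pose f x := 1 + e * cos (2 * om * x).
pose F x := x + e / (2 * om) * sin (2 * om * x).
have dF x : is_derive x (1 : R) F (f x).
  apply: (is_derive_eq (isd_add (isd_id x) (isd_scale (e / (2 * om))
    (@isd_comp _ sin (fun t => 2 * om * t) x _ _ (is_derive_sin _) (dl x))))).
  by rewrite /f; field.
have cf : continuous f.
  apply: (@der_continuous _ _ (fun x => 0 + e * (- sin (2 * om * x) * (2 * om * 1)))) => x.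
rewrite (FTC_is_derive ltr01 cf dF) /F.
have -> : sin (2 * om * 1) = 0.
  rewrite (_ : 2 * om * 1 = (2 * i.+1)%:R * pi); last by rewrite natrM /om; ring.
  by rewrite sin_natpi.
by rewrite !mulr0 sin0 mulr0 !addr0 subr0.
Qed.

Lemma measurable_trig j om : measurable_fun setT (fun x : R => trig j (om * x)).
Proof.
rewrite /trig; case: (odd j); apply: continuous_measurable_fun.
  apply: (@der_continuous _ _ (fun x => - sin (om * x) * (om * 1))) => x.
apply: (@der_continuous _ _ (fun x => cos (om * x) * (om * 1))) => x.
Qed.

(* Differentiating the sine k times gives the leading term; every derivative that
   falls on the polynomial loses one power of [om]. *)
Lemma tp_energy k (a : {poly R}) :
  (forall x, 0 <= x <= 1 -> a.[x] ^+ 2 <= 2) ->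
  exists2 C : R, 0 <= C & forall (i : nat) om, om = pi * i.+1%:R ->
   (\int[leb]_(x in @I01 R) ((tp om (tpn om (0%R, a) k) x) ^+ 2)%:E <=
   (om ^+ (2 * k) + C * (om ^+ (2 * k) / om))%:E)%E.
Proof.
move=> a2; have [C C0 hC] := tpn_leading k (0, a).
exists (4 * C + C ^+ 2); first by rewrite addr_ge0 ?sqr_ge0 ?mulr_ge0.
move=> i om omE.
have om1 : 1 <= om.
  have := @pi_ge2 R; have : 1 <= i.+1%:R :> R by rewrite ler1n.
  rewrite omE; nra.
have om0 : 0 < om by lra.
have omk : 0 < om ^+ k by rewrite exprn_gt0.
have om2k : 0 < om ^+ (2 * k) by rewrite exprn_gt0.
have C' : 0 <= (4 * C + C ^+ 2) * (om ^+ (2 * k) / om).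
  by rewrite mulr_ge0 ?divr_ge0 ?(ltW om0) ?(ltW om2k)// addr_ge0 ?sqr_ge0 ?mulr_ge0.
pose h x : R := om ^+ (2 * k) * (2 * trig k (om * x) ^+ 2) + (4 * C + C ^+ 2) * (om ^+ (2 * k) / om).
have mt := measurable_trig k om.
have m2t : measurable_fun setT (fun x : R => 2 * trig k (om * x) ^+ 2).
  by apply: measurable_funM => //; exact: measurable_funX.
have mI : measurable (@I01 R) by exact: measurable_itv.
have mh : measurable_fun setT h.
  by apply: measurable_funD => //; exact: measurable_funM.
have -> : (om ^+ (2 * k) + (4 * C + C ^+ 2) * (om ^+ (2 * k) / om))%:E =
   (\int[leb]_(x in @I01 R) (h x)%:E)%E.
  under eq_integral do rewrite EFinD EFinM.
  rewrite ge0_integralD//=; last 2 first.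
  - by move=> x _; rewrite -EFinM lee_fin mulr_ge0 ?(ltW om2k)// mulr_ge0 ?sqr_ge0.
  - by apply/measurable_EFinP; apply: measurable_funTS; exact: measurable_funM.
  rewrite ge0_integralZl//=; last 3 first.
  - by apply/measurable_EFinP; exact: measurable_funTS.
  - by move=> x _; rewrite lee_fin mulr_ge0 ?sqr_ge0.
  - by rewrite lee_fin (ltW om2k).
  rewrite omE integral_trig_sqr -omE integral_cst//=.
  by rewrite lebesgue_measure_itv/= lte_fin ltr01 oppr0 adde0 !mule1.
apply: ge0_le_integral => //=.
- by move=> x _; rewrite lee_fin sqr_ge0.
- apply/measurable_EFinP; apply: measurable_funTS; apply: measurable_funX.
  exact: measurable_tp.
- by apply/measurable_EFinP; exact: measurable_funTS.
move=> x; rewrite /I01/= in_itv/= => x01; rewrite lee_fin /h.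
have := hC om x om1 x01; set t := tp om (tpn _ _ _) x; set rr := tp om _ x.
have rE : rr ^+ 2 = (a.[x] * trig k (om * x)) ^+ 2 by exact: tprot_trig.
have tr1 : trig k (om * x) ^+ 2 <= 1.
  have := cos2Dsin2 (om * x); rewrite /trig.
  have := sqr_ge0 (cos (om * x)); have := sqr_ge0 (sin (om * x)).
  by case: (odd k); lra.
have r2 : rr ^+ 2 <= 2 * trig k (om * x) ^+ 2.
  by rewrite rE exprMn ler_wpM2r ?sqr_ge0// a2.
have {rE}r4 : `|rr| <= 2.
  rewrite -[leRHS]ger0_norm// -ler_sqr ?nnegrE ?normr_ge0// !real_normK ?num_real//.
  by apply: (le_trans r2); rewrite expr2; lra.
set v := om ^+ k in omk *; have -> : om ^+ (2 * k) = v ^+ 2 by rewrite mulnC exprM.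
set s := t - v * rr => sC.
have -> : t = v * rr + s by rewrite /s; ring.
have so : `|s| <= C * v.
  by apply: (le_trans sC); rewrite ler_wpM2l// ler_pdivrMr// ler_peMr// ltW.
have s2 : s ^+ 2 <= C ^+ 2 * (v ^+ 2 / om).
  rewrite -(real_normK (num_real s)) expr2.
  have -> : C ^+ 2 * (v ^+ 2 / om) = (C * (v / om)) * (C * v) by ring.
  by apply: ler_pM => //; exact: normr_ge0.
have cr : v * rr * s <= 2 * C * (v ^+ 2 / om).
  apply: (le_trans (ler_norm _)); rewrite !normrM (gtr0_norm omk).
  have -> : 2 * C * (v ^+ 2 / om) = v * 2 * (C * (v / om)) by ring.
  by apply: ler_pM; rewrite ?mulr_ge0 ?normr_ge0 ?(ltW omk)// ler_wpM2l// ltW.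
have v2 : v ^+ 2 * rr ^+ 2 <= v ^+ 2 * (2 * trig k (om * x) ^+ 2).
  by rewrite ler_wpM2l ?sqr_ge0.
rewrite sqrrD exprMn mulrDl; lra.
Qed.

End TrigPoly.

(** * Riemann sums over the design points of a cell *)

Section Riemann.
Variable R : realType.

Definition cell (n K m l : nat) : bool := ((K * l.+1) %/ n == m)%N.

Definition upt (n K m l : nat) : R := K%:R * l.+1%:R / n%:R - m%:R.

Lemma cell_interval n K m : (0 < n)%N -> (0 < K)%N -> (K <= n)%N -> (m < K)%N ->
  exists a b : nat, [/\ (a <= b)%N, (b <= n)%N,
    forall l, cell n K m l = (a <= l < b)%N,
    0 <= upt n K m a <= K%:R / n%:R & 1 <= upt n K m b <= 1 + K%:R / n%:R].
Proof.
move=> n0 K0 Kn mK.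
have n0R : 0 < n%:R :> R by rewrite ltr0n.
have ex p : (p <= K)%N -> exists l, (p * n <= K * l.+1)%N.
  by move=> pK; exists n.-1; rewrite prednK// leq_mul2r pK orbT.
pose a := ex_minn (ex _ (ltnW mK)); pose b := ex_minn (ex _ mK).
have aP l : (m * n <= K * l.+1)%N = (a <= l)%N.
  rewrite /a; case: ex_minnP => a' h1 h2; apply/idP/idP => [/h2//|al].
  by rewrite (leq_trans h1)// leq_mul2l ltnS al orbT.
have bP l : (m.+1 * n <= K * l.+1)%N = (b <= l)%N.
  rewrite /b; case: ex_minnP => b' h1 h2; apply/idP/idP => [/h2//|bl].
  by rewrite (leq_trans h1)// leq_mul2l ltnS bl orbT.
have uptS p l : upt n K p l.+1 = upt n K p l + K%:R / n%:R.
  by rewrite /upt -[in LHS]natr1; field; rewrite gt_eqF.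
have uptE p l : (p%:R <= K%:R * l.+1%:R / n%:R :> R) = (p * n <= K * l.+1)%N.
  by rewrite ler_pdivlMr// -!natrM ler_nat.
exists a, b; split.
- by rewrite -aP (leq_trans _ (_ : m.+1 * n <= _)%N)// ?bP// leq_mul2r leqnSn orbT.
- have : (b <= n.-1)%N by rewrite -bP prednK// leq_mul2r mK orbT.
  by move=> /leq_trans; apply; rewrite leq_pred.
- move=> l; rewrite /cell -aP ltnNge -bP -ltnNge eqn_leq andbC.
  by rewrite -[X in _ && X]ltnS ltn_divLR// leq_divRL.
- apply/andP; split; first by rewrite /upt subr_ge0 uptE aP.
  case E : a => [|a'].
    by rewrite /upt mulr1 gerBl ler0n.
  rewrite uptS gerDr /upt subr_le0 leNgt; apply/negP => /ltW.
  by rewrite uptE aP E ltnn.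
- have uS l : upt n K m l = upt n K m.+1 l + 1 by rewrite /upt -(natr1 m); ring.
  rewrite uS lerDr (addrC 1) lerD2r; apply/andP; split; first by rewrite /upt subr_ge0 uptE bP.
  case E : b => [|b'].
    by rewrite /upt mulr1 gerBl ler0n.
  rewrite uptS gerDr /upt subr_le0 leNgt; apply/negP => /ltW.
  by rewrite uptE bP E ltnn.
Qed.

Lemma cell_sum n K m (h : nat -> R) a b : (b <= n)%N ->
  (forall l, cell n K m l = (a <= l < b)%N) ->
  \sum_(l < n | cell n K m l) h l = \sum_(a <= l < b) h l.
Proof.
move=> bn cP; rewrite -(big_mkord (cell n K m) h).
rewrite [RHS]big_nat_cond.
rewrite (eq_bigl (fun l => (a <= l < b)%N && true)); last by move=> l; rewrite cP andbT.
rewrite big_nat_cond [RHS]big_nat_cond.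
have [ab|ba] := leqP a b; last first.
  rewrite (big_geq (ltnW ba)) big1// => l /andP[_ /andP[/andP[h1 h2] _]].
  by have := leq_ltn_trans h1 h2; rewrite ltnNge (ltnW ba).
rewrite (big_cat_nat _ (n := a))//=; last exact: leq_trans ab bn.
rewrite big_nat_cond big1 ?add0r; last first.
  by move=> l /andP[/andP[_ la]] /andP[_] /andP[/andP[al _] _]; rewrite ltnNge al in la.
rewrite (big_cat_nat _ (n := b))//=.
rewrite [X in _ + X]big_nat_cond [X in _ + X]big1 ?addr0.
  by rewrite big_nat_cond [RHS]big_nat_cond; apply: eq_bigl => l; lia.
by move=> l /andP[/andP[bl _]] /andP[_] /andP[/andP[_ lb] _]; rewrite ltnNge bl in lb.
Qed.

Lemma upt_cell n K m l : (0 < n)%N -> cell n K m l ->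
  (m%:R <= K%:R * (l.+1%:R / n%:R) :> R) && (K%:R * (l.+1%:R / n%:R) < m.+1%:R :> R).
Proof.
move=> n0; have n0R : 0 < n%:R :> R by rewrite ltr0n.
rewrite /cell eqn_leq -[X in X && _]ltnS ltn_divLR// leq_divRL// => /andP[h1 h2].
by rewrite mulrA ler_pdivlMr// ltr_pdivrMr// -!natrM ler_nat ltr_nat h2 h1.
Qed.

Lemma upt01 n K m l : (0 < n)%N -> cell n K m l -> 0 <= upt n K m l < 1.
Proof.
move=> n0 /(upt_cell n0) /andP[h1 h2]; rewrite /upt -mulrA; apply/andP; split.
  by rewrite subr_ge0.
by rewrite ltrBlDr addrC natr1.
Qed.

Lemma cell_count n K m : (0 < n)%N -> (0 < K)%N -> (K <= n)%N -> (m < K)%N ->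
  K%:R / n%:R * (\sum_(l < n | cell n K m l) 1) <= 2 :> R.
Proof.
move=> n0 K0 Kn mK; have n0R : 0 < n%:R :> R by rewrite ltr0n.
have [a [b [ab bn cP /andP[ua0 _] /andP[_ ub]]]] := cell_interval n0 K0 Kn mK.
rewrite (cell_sum (fun=> 1) bn cP) sumr_const_nat -mulr_natr mul1r natrB//.
have -> : K%:R / n%:R * (b%:R - a%:R) = upt n K m b - upt n K m a.
  by rewrite /upt -!natr1; field; rewrite gt_eqF.
have : K%:R / n%:R <= 1 :> R by rewrite ler_pdivrMr// mul1r ler_nat.
lra.
Qed.

Lemma riemann_sum n K m (f df F : R -> R) (B B1 : R) :
  (0 < n)%N -> (0 < K)%N -> (K <= n)%N -> (m < K)%N ->
  (forall x, is_derive x (1 : R) F (f x)) -> (forall x, is_derive x (1 : R) f (df x)) ->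
  (forall x, 0 <= x <= 2 -> `|f x| <= B) -> (forall x, 0 <= x <= 2 -> `|df x| <= B1) ->
  `|K%:R / n%:R * (\sum_(l < n | cell n K m l) f (upt n K m l)) - (F 1 - F 0)| <=
  (2 * B1 + 2 * B) * (K%:R / n%:R).
Proof.
move=> n0 K0 Kn mK dF df_ fB dfB; have n0R : 0 < n%:R :> R by rewrite ltr0n.
have [a [b [ab bn cP /andP[ua0 ua1] /andP[ub0 ub1]]]] := cell_interval n0 K0 Kn mK.
rewrite (cell_sum (fun l => f (upt n K m l)) bn cP).
set t := K%:R / n%:R in ua1 ub1 *.
have t0 : 0 <= t by rewrite divr_ge0.
have t1 : t <= 1 by rewrite ler_pdivrMr// mul1r ler_nat.
have uptS l : upt n K m l.+1 = upt n K m l + t.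
  by rewrite /upt /t -[in LHS]natr1; field; rewrite gt_eqF.
have cF : continuous F := der_continuous dF.
have cf : continuous f := der_continuous df_.
have lipF x y : 0 <= x -> x <= y -> y <= 2 -> `|F y - F x| <= B * (y - x).
  move=> x0 xy y2; have [c] := MVT_segment xy (fun x _ => dF x) (continuous_subspaceT cF).
  rewrite in_itv/= => /andP[xc cy] ->; rewrite normrM (ger0_norm (_ : 0 <= y - x)) ?subr_ge0//.
  by rewrite ler_wpM2r ?subr_ge0// fB//; apply/andP; split; lra.
have lipf x y : 0 <= x -> x <= y -> y <= 2 -> `|f y - f x| <= B1 * (y - x).
  move=> x0 xy y2; have [c] := MVT_segment xy (fun x _ => df_ x) (continuous_subspaceT cf).
  rewrite in_itv/= => /andP[xc cy] ->; rewrite normrM (ger0_norm (_ : 0 <= y - x)) ?subr_ge0//.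
  by rewrite ler_wpM2r ?subr_ge0// dfB//; apply/andP; split; lra.
have o02 : 0 <= (0 : R) <= 2 by rewrite lexx ler0n.
have B10 : 0 <= B1 := le_trans (normr_ge0 (df 0)) (dfB _ o02).
have B0 : 0 <= B := le_trans (normr_ge0 (f 0)) (fB _ o02).
have step x : 0 <= x -> x + t <= 2 -> `|t * f x - (F (x + t) - F x)| <= B1 * t ^+ 2.
  move=> x0 xt; have xy : x <= x + t by rewrite lerDl.
  have [c] := MVT_segment xy (fun x _ => dF x) (continuous_subspaceT cF).
  rewrite in_itv/= => /andP[xc cy] ->.
  have -> : x + t - x = t by ring.
  have -> : t * f x - f c * t = - (t * (f c - f x)) by ring.
  rewrite normrN normrM (ger0_norm t0) expr2 mulrA [leRHS]mulrC.
  apply: ler_wpM2l => //.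
  have c2 : c <= 2 by lra.
  apply: (le_trans (lipf _ _ x0 xc c2)); apply: ler_wpM2l => //; lra.
have mono l : (a <= l <= b)%N -> 0 <= upt n K m l <= 2.
  move=> /andP[al lb].
  have mon i j : (i <= j)%N -> upt n K m i <= upt n K m j.
    by move=> ij; rewrite lerD2r ler_pM2r ?invr_gt0// ler_wpM2l// ler_nat ltnS.
  apply/andP; split; first exact: le_trans ua0 (mon _ _ al).
  apply: (le_trans (mon _ _ lb)); lra.
have tele : F (upt n K m b) - F (upt n K m a) =
    \sum_(a <= l < b) (F (upt n K m l + t) - F (upt n K m l)).
  by rewrite -(telescope_sumr (fun l => F (upt n K m l)) ab); apply: eq_bigr => l _; rewrite uptS.
have main : `|t * (\sum_(a <= l < b) f (upt n K m l)) - (F (upt n K m b) - F (upt n K m a))| <= 2 * B1 * t.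
  rewrite tele mulr_sumr -sumrB (le_trans (ler_norm_sum _ _ _))//.
  apply: (@le_trans _ _ (\sum_(a <= l < b) B1 * t ^+ 2)).
    rewrite big_nat [leRHS]big_nat; apply: ler_sum => l /andP[al lb].
    have /mono/andP[u0 _] : (a <= l <= b)%N by rewrite al ltnW.
    have /mono/andP[_ u2] : (a <= l.+1 <= b)%N by rewrite lb leqW.
    by apply: step => //; rewrite -uptS.
  rewrite sumr_const_nat -(mulr_natr (B1 * t ^+ 2)).
  have -> : B1 * t ^+ 2 * (b - a)%:R = B1 * t * (t * (b%:R - a%:R)) by rewrite natrB//; ring.
  have -> : t * (b%:R - a%:R) = upt n K m b - upt n K m a.
    by rewrite /upt /t -!natr1; field; rewrite gt_eqF.
  have bt : 0 <= B1 * t by rewrite mulr_ge0.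
  have : B1 * t * (upt n K m b - upt n K m a) <= B1 * t * 2 by rewrite ler_wpM2l//; lra.
  lra.
have e1 : `|F (upt n K m b) - F 1| <= B * t.
  apply: (@le_trans _ _ (B * (upt n K m b - 1))); first by apply: lipF; lra.
  by apply: ler_wpM2l => //; lra.
have e0 : `|F (upt n K m a) - F 0| <= B * t.
  apply: (@le_trans _ _ (B * (upt n K m a - 0))); first by apply: lipF; lra.
  by apply: ler_wpM2l => //; lra.
set S := t * _ in main *; set Fb := F (upt n K m b) in main e1; set Fa := F (upt n K m a) in main e0.
have -> : S - (F 1 - F 0) = (S - (Fb - Fa)) + ((Fb - F 1) - (Fa - F 0)) by ring.
apply: (le_trans (ler_normD _ _)); have := ler_normB (Fb - F 1) (Fa - F 0); lra.
Qed.

Lemma riemann_cos n K m z : (0 < n)%N -> (0 < K)%N -> (K <= n)%N -> (m < K)%N ->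
  `|K%:R / n%:R * (\sum_(l < n | cell n K m l) cos (pi * z%:R * upt n K m l)) - (z == 0%N)%:R| <=
  (2 * (pi * z%:R) + 2) * (K%:R / n%:R) :> R.
Proof.
move=> n0 K0 Kn mK; set om : R := pi * z%:R.
have om0 : 0 <= om by rewrite mulr_ge0 ?pi_ge0.
have dl x : is_derive x (1 : R) (fun t => om * t) om.
  by apply: (is_derive_eq (isd_scale om (isd_id x))); rewrite mulr1.
pose F x := if z == 0%N then x else om^-1 * sin (om * x).
have dF x : is_derive x (1 : R) F (cos (om * x)).
  rewrite /F; case: eqP => z0.
    by apply: (is_derive_eq (isd_id x)); rewrite /om z0 mulr0 mul0r cos0.
  apply: (is_derive_eq (isd_scale om^-1 (@isd_comp _ sin (fun t => om * t) x _ _ (is_derive_sin _) (dl x)))).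
  by field; rewrite /om mulf_neq0 ?gt_eqF ?pi_gt0// ltr0n lt0n; apply/eqP.
have df x : is_derive x (1 : R) (fun x => cos (om * x)) (- sin (om * x) * om).
  exact: (@isd_comp _ cos (fun t => om * t) x _ _ (is_derive_cos _) (dl x)).
have FE : F 1 - F 0 = (z == 0%N)%:R.
  rewrite /F; case: eqP => z0; first by rewrite subr0.
  have -> : om * 1 = z%:R * pi by rewrite mulr1 /om mulrC.
  by rewrite sin_natpi !mulr0 sin0 mulr0 subr0.
rewrite -FE -[X in _ <= (_ * _ + X) * _]mulr1.
apply: (riemann_sum n0 K0 Kn mK dF df).
  by move=> x _; rewrite ler_norml cos_geN1 cos_le1.
by move=> x _; rewrite normrM (ger0_norm om0) normrN ler_piMl// ler_norml sin_geN1 sin_le1.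
Qed.

Definition phi (i : nat) (x : R) : R := Num.sqrt 2 * sin (pi * i.+1%:R * x).

Lemma phi_mul i j x : (j <= i)%N ->
  phi i x * phi j x = cos (pi * (i - j)%:R * x) - cos (pi * (i + j).+2%:R * x).
Proof.
move=> ji; rewrite /phi.
have -> : pi * (i - j)%:R * x = pi * i.+1%:R * x - pi * j.+1%:R * x.
  by rewrite natrB// -!natr1; ring.
have -> : pi * (i + j).+2%:R * x = pi * i.+1%:R * x + pi * j.+1%:R * x.
  by rewrite -!natr1 natrD; ring.
rewrite cosB cosD; set a := pi * i.+1%:R * x; set b := pi * j.+1%:R * x.
have s2 : Num.sqrt 2 * Num.sqrt 2 = 2 :> R by rewrite -expr2 sqr_sqrtr.
have -> : Num.sqrt 2 * sin a * (Num.sqrt 2 * sin b) = Num.sqrt 2 * Num.sqrt 2 * (sin a * sin b) by ring.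
by rewrite s2; ring.
Qed.

Lemma phi_sqr_le i x : phi i x ^+ 2 <= 2.
Proof.
rewrite /phi exprMn sqr_sqrtr//.
have := cos2Dsin2 (pi * i.+1%:R * x); have := sqr_ge0 (cos (pi * i.+1%:R * x)); lra.
Qed.

Lemma phi_norm_le i x : `|phi i x| <= 2.
Proof.
rewrite -[leRHS]ger0_norm// -ler_sqr ?nnegrE ?normr_ge0// !real_normK ?num_real//.
by apply: (le_trans (phi_sqr_le i x)); rewrite expr2; lra.
Qed.

Lemma phi_gram n K m N i j : (0 < n)%N -> (0 < K)%N -> (K <= n)%N -> (m < K)%N ->
  (i < N)%N -> (j < N)%N ->
  `|K%:R / n%:R * (\sum_(l < n | cell n K m l) phi i (upt n K m l) * phi j (upt n K m l)) - (i == j)%:R| <=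
  (4 + 8 * pi * N%:R) * (K%:R / n%:R).
Proof.
move=> n0 K0 Kn mK; wlog ji : i j / (j <= i)%N => [hw|] iN jN.
  have [ji|/ltnW ij] := leqP j i; first exact: hw.
  rewrite eq_sym; under eq_bigr do rewrite mulrC.
  exact: hw.
have t0 : 0 <= K%:R / n%:R :> R by rewrite divr_ge0.
under eq_bigr do rewrite phi_mul//.
rewrite sumrB mulrBr.
have := riemann_cos (i - j) n0 K0 Kn mK; have := riemann_cos (i + j).+2 n0 K0 Kn mK.
rewrite subr0 (_ : (i - j == 0)%N = (i == j)); last by rewrite subn_eq0 eqn_leq ji andbT.
set S1 := K%:R / n%:R * _; set S2 := K%:R / n%:R * _ => h1 h2.
have -> : S2 - S1 - (i == j)%:R = (S2 - (i == j)%:R) - S1 by ring.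
apply: (le_trans (ler_normB _ _)); apply: (le_trans (lerD h2 h1)).
rewrite -mulrDl ler_wpM2r//.
have : pi * (i - j)%:R <= pi * N%:R :> R.
  by rewrite ler_wpM2l ?pi_ge0// ler_nat (leq_trans (leq_subr _ _))// ltnW.
have : pi * (i + j).+2%:R <= pi * (2 * N%:R) :> R.
  by rewrite ler_wpM2l ?pi_ge0// -natrM ler_nat; lia.
have : 0 <= pi * N%:R :> R by rewrite mulr_ge0 ?pi_ge0.
lra.
Qed.

Lemma approx_bessel (L : finType) (P : pred L) N (ph : 'I_N -> L -> R) (t e : R) (f : L -> R) :
  0 <= t -> 0 <= e ->
  (forall i j, `|t * (\sum_(l | P l) ph i l * ph j l) - (i == j)%:R| <= e) ->
  \sum_(i < N) (t * (\sum_(l | P l) f l * ph i l)) ^+ 2 <=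
  (1 + N%:R * e) * (t * (\sum_(l | P l) f l ^+ 2)).
Proof.
move=> t0 e0 gram; pose T i := t * (\sum_(l | P l) f l * ph i l).
pose c := 1 + N%:R * e.
have c0 : 0 < c by rewrite ltr_pwDl// mulr_ge0.
pose gg l := \sum_(i < N) T i * ph i l.
have S2E : \sum_(i < N) T i ^+ 2 = t * (\sum_(l | P l) f l * gg l).
  rewrite mulr_sumr.
  under [RHS]eq_bigr do rewrite /gg !mulr_sumr.
  rewrite exchange_big/=; apply: eq_bigr => i _.
  rewrite expr2 {2}/T mulr_sumr mulr_sumr; apply: eq_bigr => l _; ring.
have gE : t * (\sum_(l | P l) gg l ^+ 2) <= c * (\sum_(i < N) T i ^+ 2).
  have -> : t * (\sum_(l | P l) gg l ^+ 2) =
      \sum_(i < N) \sum_(j < N) T i * T j * (t * (\sum_(l | P l) ph i l * ph j l)).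
    transitivity (\sum_(l | P l) \sum_(i < N) \sum_(j < N) t * (T i * ph i l * (T j * ph j l))).
      rewrite mulr_sumr; apply: eq_bigr => l _; rewrite /gg expr2 mulr_suml mulr_sumr.
      by apply: eq_bigr => i _; rewrite mulr_sumr mulr_sumr.
    rewrite exchange_big/=; apply: eq_bigr => i _; rewrite exchange_big/=.
    by apply: eq_bigr => j _; rewrite !mulr_sumr; apply: eq_bigr => l _; ring.
  have -> : c * (\sum_(i < N) T i ^+ 2) = \sum_(i < N) (\sum_(j < N) T i * T j * (i == j)%:R) +
      \sum_(i < N) \sum_(j < N) e * ((T i ^+ 2 + T j ^+ 2) / 2).
    have -> : \sum_(i < N) (\sum_(j < N) T i * T j * (i == j)%:R) = \sum_(i < N) T i ^+ 2.
      apply: eq_bigr => i _; rewrite (bigD1 i)//= eqxx mulr1 big1 ?addr0// => j ji.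
      by rewrite eq_sym (negbTE ji) mulr0.
    have -> : \sum_(i < N) \sum_(j < N) e * ((T i ^+ 2 + T j ^+ 2) / 2) =
        e / 2 * (\sum_(i < N) \sum_(j < N) T i ^+ 2) + e / 2 * (\sum_(i < N) \sum_(j < N) T j ^+ 2).
      rewrite -mulrDr -big_split/= mulr_sumr; apply: eq_bigr => i _.
      by rewrite -big_split/= mulr_sumr; apply: eq_bigr => j _; field.
    have -> : \sum_(i < N) \sum_(j < N) T j ^+ 2 = N%:R * (\sum_(i < N) T i ^+ 2).
      by rewrite sumr_const card_ord mulr_natl.
    have -> : \sum_(i < N) \sum_(j < N) T i ^+ 2 = N%:R * (\sum_(i < N) T i ^+ 2).
      by rewrite mulr_sumr; apply: eq_bigr => i _; rewrite sumr_const card_ord mulr_natl.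
    by rewrite /c; field.
  rewrite -big_split/=; apply: ler_sum => i _; rewrite -big_split/=; apply: ler_sum => j _.
  rewrite -lerBlDl -mulrBr; apply: (le_trans (ler_norm _)); rewrite normrM mulrC.
  apply: ler_pM => //.
  rewrite normrM; have := sqr_ge0 (`|T i| - `|T j|); rewrite sqrrB !real_normK ?num_real//; lra.
have am : \sum_(i < N) T i ^+ 2 <= c / 2 * (t * (\sum_(l | P l) f l ^+ 2)) +
    (2 * c)^-1 * (t * (\sum_(l | P l) gg l ^+ 2)).
  rewrite S2E mulrCA (mulrCA (2 * c)^-1) -mulrDr; apply: ler_wpM2l => //.
  rewrite !mulr_sumr -big_split/=; apply: ler_sum => l _.
  have -> : c / 2 * f l ^+ 2 + (2 * c)^-1 * gg l ^+ 2 = f l * gg l + (2 * c)^-1 * (c * f l - gg l) ^+ 2.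
    by field; rewrite gt_eqF.
  by rewrite lerDl mulr_ge0 ?sqr_ge0// invr_ge0 mulr_ge0// (ltW c0).
have am2 : (2 * c)^-1 * (t * (\sum_(l | P l) gg l ^+ 2)) <= 2^-1 * (\sum_(i < N) T i ^+ 2).
  have : (2 * c)^-1 * (t * (\sum_(l | P l) gg l ^+ 2)) <= (2 * c)^-1 * (c * (\sum_(i < N) T i ^+ 2)).
    by rewrite ler_wpM2l// invr_ge0 mulr_ge0// (ltW c0).
  by move=> /le_trans; apply; rewrite le_eqVlt; apply/orP; left; apply/eqP; field; rewrite gt_eqF.
rewrite -/c (_ : \sum_(i < N) _ = \sum_(i < N) T i ^+ 2)//; move: am am2.
move: (\sum_(i < N) T i ^+ 2) (t * (\sum_(l | P l) f l ^+ 2)) ((2 * c)^-1 * _).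
move=> s v u am am2; lra.
Qed.

(* Vanishes to order k+1 at both ends of [0,1], so that tiling gives C^k functions,
   and tends to 1 inside as [q] grows. *)
Definition cutoff (q k : nat) (x : R) : R := (1 - (2 * x - 1) ^+ (2 * q)) ^+ k.+1.

Definition cutoff_poly (q k : nat) : {poly R} :=
  Num.sqrt 2 *: (1 - (2 *: 'X - 1) ^+ (2 * q)) ^+ k.+1.

Lemma cutoff_polyE q k x : (cutoff_poly q k).[x] = Num.sqrt 2 * cutoff q k x.
Proof. by rewrite /cutoff_poly /cutoff !hornerE. Qed.

Lemma cutoff_poly_vanish q k : pvanish k.+1 (cutoff_poly q k).
Proof.
apply: pvanishZ; pose u : {poly R} := 2 *: 'X - 1.
exists (4%:R ^+ k.+1 * (\sum_(i < q) (u ^+ 2) ^+ i) ^+ k.+1).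
rewrite -!exprMn; congr (_ ^+ _); rewrite -/u exprM.
have -> : 1 - (u ^+ 2) ^+ q = (1 - u ^+ 2) * (\sum_(i < q) (u ^+ 2) ^+ i).
  by rewrite -opprB subrX1 -mulNr opprB.
rewrite mulrA; congr (_ * _); rewrite /u -mul_polyC.
have -> : (2 : R)%:P = 2 :> {poly R} by rewrite -polyC_natr.
ring.
Qed.

Lemma cutoff_base q (x : R) : 0 <= x <= 1 -> 0 <= (2 * x - 1) ^+ (2 * q) <= 1.
Proof.
move=> /andP[x0 x1]; rewrite exprM exprn_ge0 ?sqr_ge0//= exprn_ile1 ?sqr_ge0//.
by rewrite expr2; nra.
Qed.

Lemma cutoff01 q k x : 0 <= x <= 1 -> 0 <= cutoff q k x <= 1.
Proof.
move=> /(cutoff_base q)/andP[h0 h1]; rewrite /cutoff exprn_ge0 ?exprn_ile1//; lra.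
Qed.

Lemma cutoff_ge q k x : 0 <= x <= 1 -> 1 - k.+1%:R * (2 * x - 1) ^+ (2 * q) <= cutoff q k x.
Proof.
move=> /(cutoff_base q)/andP[]; rewrite /cutoff; set y := _ ^+ _ => y0 y1.
elim: k.+1 => [|j IH]; first by rewrite mul0r subr0 expr0.
rewrite exprS; have yj : 0 <= (1 - y) * ((1 - y) ^+ j - (1 - j%:R * y)).
  by apply: mulr_ge0; lra.
have : 0 <= j%:R * (y * y) by rewrite !mulr_ge0.
rewrite -natr1; nra.
Qed.

Lemma riemann_power n K m q : (0 < n)%N -> (0 < K)%N -> (K <= n)%N -> (m < K)%N ->
  K%:R / n%:R * (\sum_(l < n | cell n K m l) (2 * upt n K m l - 1) ^+ (2 * q.+1)) <=
  (2 * q.+1 + 1)%:R^-1 + (2 * ((2 * q.+1)%:R * 3 ^+ (2 * q.+1) * 2) + 2 * 3 ^+ (2 * q.+1)) * (K%:R / n%:R) :> R.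
Proof.
move=> n0 K0 Kn mK.
have dl x : is_derive x (1 : R) (fun t => 2 * t - 1) 2.
  by apply: (is_derive_eq (isd_add (isd_scale 2 (isd_id x)) (isd_cst (- 1) x))); rewrite mulr1 addr0.
have e2 : (2 * q.+1 = (2 * q + 1).+1)%N by lia.
pose F x : R := (2 * (2 * q.+1).+1%:R)^-1 * (2 * x - 1) ^+ (2 * q.+1).+1.
have dF x : is_derive x (1 : R) F ((2 * x - 1) ^+ (2 * q.+1)).
  apply: (is_derive_eq (isd_scale _ (isd_exp _ (dl x)))).
  have alg (d y : R) : d != 0 -> (2 * d)^-1 * (d * y * 2) = y by move=> d0; field.
  by apply: alg; rewrite pnatr_eq0.
have df x : is_derive x (1 : R) (fun x => (2 * x - 1) ^+ (2 * q.+1))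
    ((2 * q.+1)%:R * (2 * x - 1) ^+ (2 * q + 1) * 2).
  by rewrite e2; exact: isd_exp (dl x).
have FE : F 1 - F 0 = (2 * q.+1 + 1)%:R^-1.
  rewrite /F mulr0 sub0r mulr1 (_ : 2 - 1 = 1 :> R); last by ring.
  rewrite expr1n exprS exprM sqrrN expr1n expr1n addn1.
  have alg (d : R) : d != 0 -> (2 * d)^-1 * 1 - (2 * d)^-1 * (- 1 * 1) = d^-1 by move=> d0; field.
  by apply: alg; rewrite pnatr_eq0.
have n3 x : 0 <= x <= 2 -> `|2 * x - 1| <= 3 :> R.
  by move=> /andP[x0 x2]; rewrite ler_norml; apply/andP; split; lra.
have := riemann_sum n0 K0 Kn mK dF df (B := 3 ^+ (2 * q.+1)) (B1 := (2 * q.+1)%:R * 3 ^+ (2 * q.+1) * 2).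
rewrite FE => /(_ _ _) h.
have := h _ _; rewrite ler_norml.
case/(_ _ _)/andP.
- move=> x /n3 x3; rewrite normrX; apply: lerXn2r; rewrite ?nnegrE//.
- move=> x /n3 x3; rewrite !normrM normrX !normr_nat ler_wpM2r// ler_wpM2l//.
  apply: (@le_trans _ _ (3 ^+ (2 * q + 1))); first by apply: lerXn2r; rewrite ?nnegrE.
  by apply: ler_weXn2l; [lra|lia].
by move=> _; rewrite lerBlDr addrC.
Qed.

End Riemann.

Lemma integral_I01_cst (R : realType) (c : R) :
  (\int[@lebesgue_measure R]_(x in @I01 R) (cst c%:E) x = c%:E)%E.
Proof.
rewrite integral_cst; last exact: measurable_itv.
rewrite -[RHS]mule1; congr (_ * _)%E.
by have := lebesgue_measure_itv `[0 : R, 1]; rewrite /= lte_fin ltr01 oppr0 adde0.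
Qed.

Section tiled.
Variable R : realType.
Local Notation leb := (@lebesgue_measure R).

Lemma isd_sum (I : Type) (s : seq I) (f : I -> R -> R) (df : I -> R) x :
  (forall i, is_derive x (1 : R) (f i) (df i)) ->
  is_derive x (1 : R) (fun t => \sum_(i <- s) f i t) (\sum_(i <- s) df i).
Proof.
move=> fd; elim: s => [|i s IH].
  by under eq_fun do rewrite big_nil; rewrite big_nil; exact: isd_cst.
under eq_fun do rewrite big_cons.
by rewrite big_cons; exact: (isd_add (fd i) IH).
Qed.

Variables (N k : nat) (G : 'I_N -> nat -> R -> R).
Hypothesis dG : forall i j x, is_derive x (1 : R) (G i j) (G i j.+1 x).
Hypothesis G0 : forall i j, (j <= k.+1)%N -> G i j 0 = 0.
Hypothesis G1 : forall i j, (j <= k.+1)%N -> G i j 1 = 0.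
Implicit Types (K : nat) (th : nat -> 'I_N -> R).

Definition zm K (z : int) : nat := absz (z %% K)%Z.

Lemma zm_nat K (m : nat) : (m < K)%N -> zm K m = m.
Proof. by move=> mK; rewrite /zm modz_nat modn_small. Qed.

Lemma zm_shift K (z : int) : zm K (z + K%:Z) = zm K z.
Proof. by rewrite /zm modzDr. Qed.

Lemma zm_lt K (z : int) : (0 < K)%N -> (zm K z < K)%N.
Proof.
by move=> K0; rewrite /zm -ltz_nat gez0_abs ?modz_ge0 ?ltz_pmod// -lt0n.
Qed.

Definition cellfun K th j (z : int) x : R := \sum_(i < N) th (zm K z) i * G i j x.

Definition tiled K th : R -> R := tile K%:R (cellfun K th 0).

Lemma is_derive_cellfun K th j z x :
  is_derive x (1 : R) (cellfun K th j z) (cellfun K th j.+1 z x).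
Proof. by apply: isd_sum => i; exact: isd_scale (dG _ _ _). Qed.

Lemma cellfun0 K th j z : (j <= k.+1)%N -> cellfun K th j z 0 = 0.
Proof. by move=> jk; rewrite /cellfun big1// => i _; rewrite G0// mulr0. Qed.

Lemma cellfun1 K th j z : (j <= k.+1)%N -> cellfun K th j z 1 = 0.
Proof. by move=> jk; rewrite /cellfun big1// => i _; rewrite G1// mulr0. Qed.

Lemma continuous_cellfun K th j z : continuous (cellfun K th j z).
Proof. exact: der_continuous (is_derive_cellfun K th j z). Qed.

Lemma measurable_cellfun K th j z : measurable_fun setT (cellfun K th j z).
Proof. by apply: continuous_measurable_fun => x; exact: continuous_cellfun. Qed.

Lemma der_tile_cellfun K th j t : (0 < K)%N -> (j <= k)%N ->
  is_derive t (1 : R) (tile K%:R (cellfun K th j)) (K%:R * tile K%:R (cellfun K th j.+1) t).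
Proof.
move=> K0 jk; apply: (@der_tile_chain _ k.+1 K%:R (cellfun K th)) => //.
- by rewrite ltr0n.
- exact: is_derive_cellfun.
- exact: cellfun0.
- exact: cellfun1.
Qed.

Lemma continuous_tile_cellfun K th j : (0 < K)%N -> (j <= k)%N ->
  continuous (tile K%:R (cellfun K th j)).
Proof. by move=> K0 jk; apply: der_continuous => t; exact: der_tile_cellfun. Qed.

Lemma continuous_tiled K th : (0 < K)%N -> continuous (tiled K th).
Proof. by move=> K0; exact: continuous_tile_cellfun. Qed.

Lemma C01_tiled K th : (0 < K)%N -> C01 (tiled K th).
Proof. by move=> K0; apply: continuous_subspaceT; exact: continuous_tiled. Qed.

Lemma integral_cellfun (u : R -> R) K th j : (0 < K)%N -> (j <= k)%N ->
  measurable_fun setT u -> (forall y, (0 <= u y)%R) ->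
  (\int[leb]_(t in @I01 R) (u (tile K%:R (cellfun K th j) t))%:E =
   (K%:R^-1)%:E * \sum_(m < K) \int[leb]_(x in @I01 R) (u (\sum_(i < N) th m i * G i j x)%R)%:E)%E.
Proof.
move=> K0 jk mu u0; rewrite integral_tile//.
- congr (_ * _)%E; apply: eq_bigr => m _; apply: eq_integral => x _.
  by rewrite /cellfun zm_nat.
- by move=> z; rewrite cellfun0// leqW.
- by move=> z; rewrite cellfun1// leqW.
- by move=> z; exact: measurable_cellfun.
- apply: continuous_measurable_fun; exact: continuous_tile_cellfun.
Qed.

Lemma derive1n_tiled K th j : (0 < K)%N -> (j <= k)%N ->
  derive1n j (tiled K th) = (fun t => K%:R ^+ j * tile K%:R (cellfun K th j) t).
Proof.
move=> K0 jk; apply: (@derive1n_tile _ k.+1 K%:R (cellfun K th)) => //; last exact: leqW.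
- by rewrite ltr0n.
- exact: is_derive_cellfun.
- exact: cellfun0.
- exact: cellfun1.
Qed.

Lemma tiled_Wkr K th (r : R) : (0 < K)%N ->
  (\sum_(j < k.+1) ((K%:R ^+ (2 * j) / K%:R)%:E * \sum_(m < K)
     \int[leb]_(x in @I01 R) ((\sum_(i < N) th m i * G i j x) ^+ 2)%:E) <= r%:E)%E ->
  Wkr k r (tiled K th).
Proof.
move=> K0 h; split; last split.
- move=> t; apply: tile_periodic => // z; apply/funext => x.
  by rewrite /cellfun zm_shift.
- move=> j jk t; apply: (@derivable_tile _ k.+1 K%:R (cellfun K th)) => //; last exact: leqW.
  + by rewrite ltr0n.
  + exact: is_derive_cellfun.
  + exact: cellfun0.
  + exact: cellfun1.
- move: h; congr (_ <= _)%E; apply: eq_bigr => j _.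
  have jk : (j <= k)%N by rewrite -ltnS.
  rewrite derive1n_tiled//; under [RHS]eq_integral do rewrite exprMn EFinM -exprM mulnC.
  have mI : measurable (@I01 R) by exact: measurable_itv.
  have mF : measurable_fun (@I01 R) (fun t => (tile K%:R (cellfun K th j) t ^+ 2)%:E).
    apply/measurable_EFinP; apply: measurable_funTS; apply: measurable_funX.
    apply: continuous_measurable_fun; exact: continuous_tile_cellfun.
  have F0 t : I01 t -> (0 <= (tile K%:R (cellfun K th j) t ^+ 2)%:E)%E.
    by move=> _; rewrite lee_fin sqr_ge0.
  rewrite ge0_integralZl_EFin ?exprn_ge0//.
  have := @integral_cellfun (fun y => y ^+ 2) K th j K0 jk (measurable_funX _ (@measurable_id _ _ _)) (@sqr_ge0 _).
  by move=> ->; rewrite muleA -EFinM.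
Qed.

Lemma tiled_bound K th (B c : R) t : (0 < K)%N -> 0 <= B ->
  (forall i x, 0 <= x <= 1 -> `|G i 0 x| <= B) ->
  (forall m i, (m < K)%N -> `|th m i| <= c) -> `|tiled K th t| <= N%:R * (c * B).
Proof.
move=> K0 B0 GB thc; rewrite /tiled /tile /cellfun (le_trans (ler_norm_sum _ _ _))//.
have -> : N%:R * (c * B) = \sum_(i < N) c * B by rewrite sumr_const card_ord mulr_natl.
apply: ler_sum => i _; rewrite normrM; apply: ler_pM => //.
  by apply: thc; exact: zm_lt.
apply: GB; have /andP[h1 h2] := floor_itv (K%:R * t); rewrite subr_ge0 h1 lerBlDl.
by rewrite ltW// -[X in _ + X]/(1%:~R) -intrD.
Qed.

Lemma tiled_cell n K th m l : (0 < n)%N -> (m < K)%N -> cell n K m l ->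
  tiled K th (l.+1%:R / n%:R) = \sum_(i < N) th m i * G i 0 (upt R n K m l).
Proof.
move=> n0 mK /(upt_cell R n0) /andP[h1 h2].
rewrite /tiled (@tileE _ _ _ m); last by rewrite intrD -!pmulrn natr1 h1.
by rewrite /cellfun zm_nat// -pmulrn /upt mulrA.
Qed.

Lemma tiled_add K th th' c t :
  tiled K (fun m i => th m i + c * th' m i) t = tiled K th t + c * tiled K th' t.
Proof.
rewrite /tiled /tile /cellfun mulr_sumr -big_split/=; apply: eq_bigr => i _.
by rewrite mulrDl mulrA.
Qed.

Definition bumpf (m0 : nat) (i0 : 'I_N) (m : nat) (i : 'I_N) : R :=
  ((m == m0) && (i == i0))%:R.

Lemma bump_sum m0 i0 m (h : 'I_N -> R) :
  \sum_(i < N) bumpf m0 i0 m i * h i = (m == m0)%:R * h i0.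
Proof.
rewrite (bigD1 i0)//= big1 ?addr0 => [|i ii]; last by rewrite /bumpf (negbTE ii) andbF mul0r.
by rewrite /bumpf eqxx andbT.
Qed.

Lemma integral_bump (u : R -> R) (C : R) K m0 i0 : (m0 < K)%N -> continuous u ->
  (forall y, (0 <= u y)%R) -> u 0 = 0 ->
  (forall x, (0 <= x <= 1)%R -> (u (G i0 0 x) <= C)%R) ->
  (\int[leb]_(t in @I01 R) (u (tiled K (bumpf m0 i0) t))%:E <= (C / K%:R)%:E)%E.
Proof.
move=> mK cu u0 u00 uC; have K0 : (0 < K)%N by rewrite (leq_ltn_trans _ mK).
have mu : measurable_fun setT u by exact: continuous_measurable_fun.
rewrite /tiled integral_cellfun//.
rewrite (bigD1 (Ordinal mK))//= big1 ?adde0; last first.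
  move=> m mm; under eq_integral => x _.
    rewrite bump_sum (_ : (m == m0 :> nat) = false) ?mul0r ?u00; last first.
      by apply/negP => /eqP E; move/eqP: mm; apply; exact: val_inj.
    over.
  by rewrite integral0.
under eq_integral do rewrite bump_sum eqxx mul1r.
rewrite mulrC EFinM; apply: lee_pmul => //.
  by apply: integral_ge0 => x _; rewrite lee_fin.
have -> : C%:E = (\int[leb]_(x in @I01 R) (cst C%:E) x)%E.
  by rewrite integral_I01_cst.
have mI : measurable (@I01 R) by exact: measurable_itv.
apply: ge0_le_integral => //.
- by move=> x _; rewrite lee_fin.
- apply/measurable_EFinP; apply: measurable_funTS; apply: measurableT_comp => //.
  by apply: continuous_measurable_fun; exact: der_continuous (dG i0 0).
Qed.

Lemma L1norm_bump (B : R) K m0 i0 : (m0 < K)%N ->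
  (forall x, 0 <= x <= 1 -> `|G i0 0 x| <= B) ->
  L1norm (tiled K (bumpf m0 i0)) <= B / K%:R.
Proof.
move=> mK GB; rewrite /L1norm.
have h := @integral_bump (@Num.norm R R) B K m0 i0 mK (@norm_continuous _ _) (@normr_ge0 _ _) (normr0 _) GB.
have h0 : (0 <= \int[leb]_(t in @I01 R) (`|tiled K (bumpf m0 i0) t|)%:E)%E.
  by apply: integral_ge0 => x _; rewrite lee_fin.
by rewrite -lee_fin fineK// ge0_fin_numE// (le_lt_trans h)// ltry.
Qed.

Lemma L2norm_bump (B : R) K m0 i0 : (m0 < K)%N -> 0 <= B ->
  (forall x, 0 <= x <= 1 -> `|G i0 0 x| <= B) ->
  L2norm (tiled K (bumpf m0 i0)) ^+ 2 <= B ^+ 2 / K%:R.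
Proof.
move=> mK B0 GB; rewrite /L2norm.
have h := @integral_bump (fun y => y ^+ 2) (B ^+ 2) K m0 i0 mK (@exprn_continuous _ 2) (@sqr_ge0 _).
have {}h : (\int[leb]_(t in @I01 R) ((tiled K (bumpf m0 i0) t) ^+ 2)%:E <= (B ^+ 2 / K%:R)%:E)%E.
  apply: h; first by rewrite expr0n.
  move=> x /GB xB; rewrite -(real_normK (num_real (G i0 0 x))).
  by apply: lerXn2r; rewrite ?nnegrE.
have h0 : (0 <= \int[leb]_(t in @I01 R) ((tiled K (bumpf m0 i0) t) ^+ 2)%:E)%E.
  by apply: integral_ge0 => x _; rewrite lee_fin sqr_ge0.
rewrite sqr_sqrtr ?fine_ge0//.
by rewrite -lee_fin fineK// ge0_fin_numE// (le_lt_trans h)// ltry.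
Qed.

End tiled.

Section NormBounds.
Variable R : realType.
Local Notation leb := (@lebesgue_measure R).

Lemma C01_measurable (f : R -> R) : C01 f -> measurable_fun (@I01 R) f.
Proof. by move=> cf; apply: subspace_continuous_measurable_fun => //; exact: measurable_itv. Qed.

Lemma L2norm_le (f : R -> R) (rho : R) : C01 f -> 0 <= rho ->
  (forall t, t \in @I01 R -> `|f t| <= rho) -> L2norm f <= rho.
Proof.
move=> cf rho0 frho; rewrite /L2norm -[leRHS]ger0_norm// -sqrtr_sqr ler_sqrt ?sqr_ge0//.
have h : (\int[leb]_(t in @I01 R) ((f t) ^+ 2)%:E <= (rho ^+ 2)%:E)%E.
  have -> : (rho ^+ 2)%:E = (\int[leb]_(x in @I01 R) (cst (rho ^+ 2)%:E) x)%E.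
    by rewrite integral_I01_cst.
  apply: ge0_le_integral => //.
  - exact: measurable_itv.
  - by move=> x _; rewrite lee_fin sqr_ge0.
  - by apply/measurable_EFinP; apply: measurable_funX; exact: C01_measurable.
  - move=> x /mem_set xI; rewrite lee_fin -(real_normK (num_real (f x))).
    by apply: lerXn2r; rewrite ?nnegrE// frho.
have h0 : (0 <= \int[leb]_(t in @I01 R) ((f t) ^+ 2)%:E)%E.
  by apply: integral_ge0 => x _; rewrite lee_fin sqr_ge0.
by rewrite -lee_fin fineK// ge0_fin_numE// (le_lt_trans h)// ltry.
Qed.

Lemma C01_L1fun (f : R -> R) : C01 f -> L1fun f.
Proof.
move=> cf; apply: continuous_compact_integrable => //; exact: segment_compact.
Qed.

End NormBounds.

(** * Lipschitz bound for the variance along segments *)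

Section GLip.
Variable R : realType.
Local Notation leb := (@lebesgue_measure R).

Lemma supnorm_scale_le (D : R -> R) (B a : R) :
  (forall y, I01 y -> `|D y| <= B) -> supnorm (fun y => a * D y) <= `|a| * B.
Proof.
move=> DB; apply: ge_sup.
  by exists `|a * D 0|; exists 0 => //; rewrite /I01/= in_itv/= lexx ler01.
by move=> _ [y yI <-]; rewrite normrM ler_wpM2l// DB.
Qed.

Lemma C01_lin (S D : R -> R) (a : R) : C01 S -> C01 D -> C01 (fun y => S y + a * D y).
Proof.
move=> cS cD x; apply: cvgD; first exact: cS.
by apply: cvgM; [exact: cvg_cst|exact: cD].
Qed.

Lemma C01_cst (c : R) : C01 (fun=> c).
Proof. by move=> x; exact: cvg_cst. Qed.

Variables (g : R -> (R -> R) -> R) (L : R -> (R -> R) -> (R -> R) -> R).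
Hypothesis h2 : H2 g L.

Lemma is_derive_segment (S D : R -> R) x (B : R) t :
  C01 S -> C01 D -> x \in @I01 R -> (forall y, I01 y -> `|D y| <= B) ->
  is_derive t (1 : R) (fun t => g x (fun y => S y + t * D y) ^+ 2)
    (L x (fun y => S y + t * D y) D).
Proof.
move=> cS cD xI DB; set f0 := fun y => S y + t * D y.
have cf0 : C01 f0 by exact: C01_lin.
have [lin [_ fre]] := h2 xI cf0.
have L0 : L x f0 (fun=> 0) = 0.
  have := lin 1 _ _ (@C01_cst 0) (@C01_cst 0).
  rewrite (_ : (fun=> 1 * 0 + 0) = (fun=> 0)); last by apply/funext => y; rewrite mulr0 addr0.
  by rewrite mul1r => /eqP; rewrite addrC -subr_eq subrr eq_sym => /eqP.
have LZ a : L x f0 (fun y => a * D y) = a * L x f0 D.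
  have := lin a _ _ cD (@C01_cst 0); rewrite L0 addr0 => <-; congr (L x f0 _).
  by apply/funext => y; rewrite addr0.
have B0 : 0 <= B by apply: le_trans (DB 0 _) => //; rewrite /I01/= in_itv/= lexx ler01.
set F := fun t => g x (fun y => S y + t * D y) ^+ 2.
suff cv : h^-1 *: (F (h *: (1 : R) + t) - F t) @[h --> (0:R)^'] --> L x f0 D.
  by split; [apply/cvg_ex; exists (L x f0 D)|exact/cvg_lim].
apply/cvgrPdist_le => e e0.
have e10 : 0 < e / (B + 1) by rewrite divr_gt0// ltr_wpDl.
have [d [d0 fd]] := fre _ e10.
have d10 : 0 < d / (B + 1) by rewrite divr_gt0// ltr_wpDl.
exists (d / (B + 1)) => //= h /=; rewrite sub0r normrN => hd h0.
have B1 : 0 < B + 1 by rewrite ltr_wpDl.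
have dE : (fun y => (S y + (h + t) * D y) - f0 y) = (fun y => h * D y).
  by apply/funext => y; rewrite /f0; ring.
have sn : supnorm (fun y => h * D y) <= `|h| * (B + 1).
  by rewrite (le_trans (supnorm_scale_le _ DB))// ler_wpM2l// lerDl.
have := fd (fun y => S y + (h + t) * D y) (@C01_lin S D (h + t) cS cD).
rewrite dE => /(_ (le_lt_trans sn _)); rewrite -ltr_pdivlMr// => /(_ hd).
rewrite LZ => fdh.
have -> : L x f0 D - h^-1 *: (F (h *: (1 : R) + t) - F t) =
  - h^-1 * (F (h + t) - F t - h * L x f0 D).
  by rewrite /GRing.scale/= mulr1; field.
rewrite normrM normrN normfV ler_pdivrMl ?normr_gt0//.
apply: (le_trans fdh); rewrite -(@ler_pM2l _ (B + 1)^-1) ?invr_gt0//.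
apply: (@le_trans _ _ ((B + 1)^-1 * (e / (B + 1) * (`|h| * (B + 1))))).
  by rewrite ler_wpM2l ?invr_ge0 ?(ltW B1)// ler_wpM2l// (ltW e10).
by rewrite le_eqVlt; apply/orP; left; apply/eqP; field; rewrite gt_eqF.
Qed.

Lemma g_lip (Cs : R) (S D : R -> R) x (B rho Delta : R) :
  (forall S f x, C01 S -> C01 f -> x \in @I01 R ->
      `|L x S f| <= Cs * (`|S x * f x| + L1norm f + L2norm S * L2norm f)) ->
  0 < Cs -> C01 S -> C01 D -> x \in @I01 R -> (forall y, I01 y -> `|D y| <= B) ->
  0 <= rho ->
  (forall t y, `|t| <= `|Delta| -> I01 y -> `|S y + t * D y| <= rho) ->
  `|g x (fun y => S y + Delta * D y) ^+ 2 - g x S ^+ 2| <=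
    `|Delta| * (Cs * (rho * `|D x| + L1norm D + rho * L2norm D)).
Proof.
move=> h3 Cs0 cS cD xI DB rho0 Srho.
set F := fun t => g x (fun y => S y + t * D y) ^+ 2.
have dF t : is_derive t (1 : R) F (L x (fun y => S y + t * D y) D).
  exact: is_derive_segment DB.
have F0 : F 0 = g x S ^+ 2.
  by rewrite /F; congr (g x _ ^+ 2); apply/funext => y; rewrite mul0r addr0.
rewrite -F0 -[X in `|X - _|]/(F Delta).
have bd t : `|t| <= `|Delta| -> `|L x (fun y => S y + t * D y) D| <=
   Cs * (rho * `|D x| + L1norm D + rho * L2norm D).
  move=> tD; apply: (le_trans (h3 _ _ _ (@C01_lin S D t cS cD) cD xI)).
  rewrite ler_wpM2l ?(ltW Cs0)// lerD// ?lerD2r.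
    by rewrite normrM ler_wpM2r// Srho//; exact/set_mem.
  rewrite ler_wpM2r ?sqrtr_ge0//; apply: L2norm_le => //; first exact: C01_lin.
  by move=> y /set_mem yI; exact: Srho.
have [D0|D0|->] := ltgtP Delta 0; last by rewrite subrr normr0 mul0r.
- have [c] := @MVT _ F _ _ _ D0 (fun t _ => dF t) (continuous_subspaceT (der_continuous dF)).
  rewrite in_itv/= => /andP[c1 c2]; rewrite distrC => ->.
  rewrite sub0r normrM normrN mulrC ler_wpM2l// bd//.
  by rewrite !ltr0_norm// lerN2 ltW.
- have [c] := @MVT _ F _ _ _ D0 (fun t _ => dF t) (continuous_subspaceT (der_continuous dF)).
  rewrite in_itv/= => /andP[c1 c2] ->.
  rewrite subr0 normrM mulrC ler_wpM2l// bd//.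
  by rewrite !gtr0_norm// ltW.
Qed.

End GLip.

(** * Pinsker weights *)

Section PinskerSums.
Variable R : realType.

Lemma powS_diff (k N : nat) :
  (k.+1%:R * N%:R ^+ k <= N.+1%:R ^+ k.+1 - N%:R ^+ k.+1 :> R) &&
  (N.+1%:R ^+ k.+1 - N%:R ^+ k.+1 <= k.+1%:R * N.+1%:R ^+ k :> R).
Proof.
have N1 : N%:R <= N.+1%:R :> R by rewrite ler_nat.
rewrite subrXX -natrB// subSnn mul1r.
have E (c : R) : k.+1%:R * c = \sum_(i < k.+1) c by rewrite sumr_const card_ord mulr_natl.
rewrite !E; apply/andP; split; apply: ler_sum => i _.
  rewrite -[in leLHS](subnK (_ : (i <= k)%N)) -1?ltnS// exprD /=.
  by rewrite ler_wpM2r ?exprn_ge0// lerXn2r ?nnegrE.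
rewrite -[in leRHS](subnK (_ : (i <= k)%N)) -1?ltnS// exprD /=.
by rewrite ler_wpM2l ?exprn_ge0// lerXn2r ?nnegrE.
Qed.

Lemma power_sum_ge (k N : nat) :
  N%:R ^+ k.+1 / k.+1%:R <= \sum_(i < N) i.+1%:R ^+ k :> R.
Proof.
elim: N => [|N IH]; first by rewrite big_ord0 expr0n mul0r.
have /andP[_ h] := powS_diff k N.
rewrite big_ord_recr/= -lerBlDr (le_trans _ IH)// lerBlDr.
by rewrite ler_pdivrMr ?ltr0n// mulrDl divfK ?pnatr_eq0// -lerBlDl (le_trans h)// mulrC.
Qed.

Lemma power_sum_le (k N : nat) :
  \sum_(i < N) i.+1%:R ^+ k <= N%:R ^+ k.+1 / k.+1%:R + N%:R ^+ k :> R.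
Proof.
elim: N => [|N IH]; first by rewrite big_ord0 expr0n mul0r add0r exprn_ge0.
have /andP[h _] := powS_diff k N.
rewrite big_ord_recr/= lerD2r (le_trans IH)// -(@ler_pM2r _ k.+1%:R) ?ltr0n//.
by rewrite mulrDl !divfK ?pnatr_eq0// -lerBrDl mulrC.
Qed.

Lemma pinsker_numeric (p : nat) (a b e eta : R) : 0 < eta -> eta < 1 ->
  0 <= e -> e <= eta / 2 -> a = b -> 0 <= b ->
  (1 - eta) ^+ p.+1 * (a * (1 + e)) <= b * (1 - eta / 2) ^+ p.+1.
Proof.
move=> e0 e1 h0 h1 -> b0; rewrite mulrCA ler_wpM2l//.
have x0 : 0 <= 1 - eta / 2 by lra.
have x1 : 1 - eta / 2 <= 1 by lra.
apply: (@le_trans _ _ ((1 - eta / 2) ^+ p.+1 * ((1 - eta / 2) ^+ p.+1 * (1 + e)))).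
  rewrite mulrA -exprMn ler_wpM2r//; first lra.
  rewrite lerXn2r ?nnegrE//; [lra|nra|nra].
rewrite ler_piMr ?exprn_ge0//.
apply: (@le_trans _ _ ((1 - eta / 2) * (1 + e))); last nra.
rewrite ler_wpM2r//; first lra.
by rewrite exprS ler_piMr// exprn_ile1.
Qed.

Definition pinsker_u (k N i : nat) : R := (N%:R / i.+1%:R) ^+ k - 1.

Lemma pinsker_u_ge0 k N i : (i < N)%N -> 0 <= pinsker_u k N i.
Proof.
move=> iN; rewrite subr_ge0; apply: exprn_ege1.
by rewrite ler_pdivlMr ?ltr0n// mul1r ler_nat.
Qed.

Lemma pinsker_A k N : (0 < N)%N ->
  \sum_(i < N) (pinsker_u k N i / (1 + pinsker_u k N i)) >=
  N%:R * (k%:R / k.+1%:R) - 1 :> R.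
Proof.
move=> N0; have N0' : N%:R != 0 :> R by rewrite pnatr_eq0 -lt0n.
have E (i : 'I_N) : pinsker_u k N i / (1 + pinsker_u k N i) = 1 - i.+1%:R ^+ k / N%:R ^+ k.
  rewrite /pinsker_u [1 + _]addrC subrK expr_div_n.
  have := expf_neq0 k N0'; have : i.+1%:R ^+ k != 0 :> R by rewrite expf_neq0// pnatr_eq0.
  by move: (N%:R ^+ k) (i.+1%:R ^+ k) => a b b0 a0; field; rewrite a0 b0.
under eq_bigr do rewrite E.
rewrite sumrB sumr_const card_ord -mulr_suml.
have := power_sum_le k N; rewrite -(@ler_pM2r _ (N%:R ^+ k)^-1); last first.
  by rewrite invr_gt0 exprn_gt0// ltr0n.
rewrite mulrDl divff ?expf_neq0// exprS [_ * _^-1 / _]mulrAC mulfK ?expf_neq0// => h.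
apply: le_trans (lerB (lexx _) h).
have -> : N%:R * (k%:R / k.+1%:R) = N%:R - N%:R / k.+1%:R :> R.
  by rewrite -natr1; field; rewrite natr1 pnatr_eq0.
by rewrite opprD addrA.
Qed.

Lemma pinsker_B k N (C : R) : (0 < k)%N -> (0 < N)%N -> 0 <= C ->
  \sum_(i < N) pinsker_u k N i * ((pi * i.+1%:R) ^+ (2 * k) + C * ((pi * i.+1%:R) ^+ (2 * k) / (pi * i.+1%:R)))
  <= pi ^+ (2 * k) * (N%:R ^+ (2 * k).+1 * (k%:R / (k.+1%:R * (2 * k).+1%:R)) + N%:R ^+ (2 * k) * (1 + C / pi)) :> R.
Proof.
move=> k0 N0 C0.
have p0 : 0 < pi :> R := pi_gt0 R.
apply: (@le_trans _ _ (pi ^+ (2 * k) * (\sum_(i < N) (N%:R ^+ k * i.+1%:R ^+ k - i.+1%:R ^+ (2 * k) + C / pi * (N%:R ^+ (2 * k) / N%:R))))).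
  rewrite mulr_sumr; apply: ler_sum => i _.
  have i0 : i.+1%:R != 0 :> R by rewrite pnatr_eq0.
  have E : pinsker_u k N i * i.+1%:R ^+ (2 * k) = N%:R ^+ k * i.+1%:R ^+ k - i.+1%:R ^+ (2 * k) :> R.
    rewrite /pinsker_u mulrBl mul1r expr_div_n mul2n -addnn exprD.
    have : i.+1%:R ^+ k != 0 :> R by rewrite expf_neq0.
    by move: (N%:R ^+ k) (i.+1%:R ^+ k) => a b b0; field.
  have -> : pinsker_u k N i * ((pi * i.+1%:R) ^+ (2 * k) + C * ((pi * i.+1%:R) ^+ (2 * k) / (pi * i.+1%:R))) =
    pi ^+ (2 * k) * (pinsker_u k N i * i.+1%:R ^+ (2 * k) + C / pi * (pinsker_u k N i * i.+1%:R ^+ (2 * k) / i.+1%:R)) :> R.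
    rewrite exprMn; move: (i.+1%:R ^+ (2 * k)) (pi ^+ (2 * k)) (pinsker_u k N i) => a b c.
    move: (i.+1%:R : R) i0 => x x0.
    have pn : pi != 0 :> R by rewrite gt_eqF.
    by move: (pi : R) pn => P P0; field; rewrite x0 P0.
  rewrite E ler_wpM2l ?exprn_ge0 ?(ltW p0)// lerD2l.
  rewrite ler_wpM2l ?divr_ge0 ?(ltW p0)//.
  have iN : i.+1%:R <= N%:R :> R by rewrite ler_nat.
  apply: (@le_trans _ _ (N%:R ^+ k * i.+1%:R ^+ k / i.+1%:R)).
    by rewrite ler_wpM2r ?invr_ge0// gerBl exprn_ge0.
  move: k0; case: (k) => // k' _.
  rewrite mul2n -addnn exprD -!mulrA ler_wpM2l ?exprn_ge0// !exprS.
  rewrite ![_ * _ ^+ k']mulrC !mulfK ?pnatr_eq0 -?lt0n//.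
  by rewrite lerXn2r ?nnegrE.
rewrite ler_wpM2l ?exprn_ge0 ?(ltW p0)// big_split sumrB/= -mulr_sumr.
rewrite sumr_const card_ord.
have -> : (C / pi * (N%:R ^+ (2 * k) / N%:R)) *+ N = C / pi * N%:R ^+ (2 * k) :> R.
  have N0' : N%:R != 0 :> R by rewrite pnatr_eq0 -lt0n.
  have pn : pi != 0 :> R by rewrite gt_eqF.
  rewrite -mulr_natr; move: (N%:R ^+ (2 * k)) (pi : R) pn => a P P0; field.
  by rewrite P0.
have h1 : N%:R ^+ k * (\sum_(i < N) i.+1%:R ^+ k) <= N%:R ^+ k * (N%:R ^+ k.+1 / k.+1%:R + N%:R ^+ k) :> R.
  by rewrite ler_wpM2l ?exprn_ge0// power_sum_le.
have h2 := power_sum_ge (2 * k) N.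
apply: (le_trans (lerD (lerB h1 h2) (lexx _))).
rewrite le_eqVlt; apply/orP; left; apply/eqP.
rewrite !exprS mul2n -addnn exprD; move: (N%:R ^+ k) => a.
rewrite -!natr1 natrD.
have pn : pi != 0 :> R by rewrite gt_eqF.
move: (pi : R) pn => P P0; have kR : 0 <= k%:R :> R by [].
field; rewrite P0/=.
by rewrite !gt_eqF//; lra.
Qed.

Lemma pinsker_choice k (C eta : R) : (0 < k)%N -> 0 <= C -> 0 < eta -> eta < 1 ->
  exists N : nat, let A := \sum_(i < N) (pinsker_u k N i / (1 + pinsker_u k N i)) in
  [/\ (1 < N)%N, 0 < A :> R &
  (1 - eta) ^+ (2 * k).+1 * ((2 * k).+1%:R * (k%:R / (pi * k.+1%:R)) ^+ (2 * k) *
   (\sum_(i < N) pinsker_u k N i * ((pi * i.+1%:R) ^+ (2 * k) + C * ((pi * i.+1%:R) ^+ (2 * k) / (pi * i.+1%:R)))))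
  <= A ^+ (2 * k).+1].
Proof.
move=> k0 C0 e0 e1.
have p0 : 0 < pi :> R := pi_gt0 R.
have kR : 0 < k%:R :> R by rewrite ltr0n.
set C3 : R := (1 + C / pi) * (k.+1%:R * (2 * k).+1%:R / k%:R).
have C30 : 0 <= C3 by rewrite !mulr_ge0// addr_ge0// divr_ge0// ltW.
set N := (Num.truncn ((C3 + 4) / (eta / 2))).+2; exists N => /=.
have eN : C3 + 4 <= eta / 2 * N%:R.
  rewrite mulrC -ler_pdivrMr; last lra.
  by rewrite (le_trans (ltW (truncnS_gt _)))// ler_nat.
have N0 : (0 < N)%N by [].
have NR : 0 < N%:R :> R by rewrite ltr0n.
have A1 := pinsker_A k N0; have B1 := pinsker_B k0 N0 C0.
set A := \sum_(i < N) _ in A1 |- *.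
have kk : k%:R / k.+1%:R >= 1 / 2 :> R.
  rewrite ler_pdivlMr ?ltr0n// mul1r ler_pdivrMl// -natr1.
  have : 1 <= k%:R :> R by rewrite ler1n.
  by lra.
have A2 : N%:R * (k%:R / k.+1%:R) * (1 - eta / 2) <= A.
  apply: le_trans A1; rewrite mulrBr mulr1 lerD2l lerN2.
  apply: (@le_trans _ _ (1 / 2 * 4)); first lra.
  rewrite [leRHS](_ : _ = k%:R / k.+1%:R * (eta / 2 * N%:R)); last by ring.
  by apply: ler_pM => //; lra.
have A0 : 0 < A.
  apply: lt_le_trans A2; rewrite !mulr_gt0//; lra.
split => //.
have A3 : (N%:R * (k%:R / k.+1%:R) * (1 - eta / 2)) ^+ (2 * k).+1 <= A ^+ (2 * k).+1.
  rewrite lerXn2r ?nnegrE ?(ltW A0)// !mulr_ge0//; lra.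
apply: le_trans A3; rewrite [leRHS]exprMn.
set B := \sum_(i < N) _ in B1 |- *.
have c0 : 0 <= (2 * k).+1%:R * (k%:R / (pi * k.+1%:R)) ^+ (2 * k) :> R.
  by rewrite mulr_ge0// exprn_ge0// divr_ge0// mulr_ge0// ltW.
set b := (N%:R * (k%:R / k.+1%:R)) ^+ (2 * k).+1.
have b0 : 0 <= b by rewrite exprn_ge0// mulr_ge0.
apply: le_trans (@pinsker_numeric (2 * k) b b (C3 / N%:R) eta e0 e1 _ _ erefl b0); last 2 first.
- by rewrite divr_ge0.
- by rewrite ler_pdivrMr//; lra.
rewrite ler_wpM2l ?exprn_ge0//; first lra.
apply: (le_trans (ler_wpM2l c0 B1)).
rewrite le_eqVlt; apply/orP; left; apply/eqP.
rewrite /b /C3 ![_ ^+ (2 * k).+1]exprS !exprMn !exprVn ?exprMn.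
have : pi ^+ (2 * k) != 0 :> R by rewrite expf_neq0// gt_eqF.
have : k.+1%:R ^+ (2 * k) != 0 :> R by rewrite expf_neq0// pnatr_eq0.
move: (pi ^+ (2 * k)) (k.+1%:R ^+ (2 * k)) (k%:R ^+ (2 * k)) (N%:R ^+ (2 * k)) => a1 a2 a3 a4 h1 h2.
have pn : pi != 0 :> R by rewrite gt_eqF.
move: (pi : R) pn => P P0; field.
rewrite h1 h2 P0 (gt_eqF NR) (gt_eqF kR) /= andbT.
by rewrite !gt_eqF//; lra.
Qed.

End PinskerSums.

(** * The prior *)

Section Prior.
Variable R : realType.
Local Notation leb := (@lebesgue_measure R).
Variables (k q N M : nat).
Hypothesis M0 : (0 < M)%N.

Definition freq (i : nat) : R := pi * i.+1%:R.

Definition atom (i : 'I_N) (j : nat) : R -> R :=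
  tp (freq i) (tpn (freq i) (0, cutoff_poly R q k.+1) j).

Lemma datom i j x : is_derive x (1 : R) (atom i j) (atom i j.+1 x).
Proof. exact: is_derive_tpn. Qed.

Lemma pvanish0 a : pvanish a (0 : {poly R}).
Proof. by exists 0; rewrite mulr0. Qed.

Lemma atom0 i j : (j <= k.+1)%N -> atom i j 0 = 0.
Proof.
move=> jk; apply: (@tpn_eval01 _ _ _ k.+2) => //; [exact: pvanish0| |by left].
exact: cutoff_poly_vanish.
Qed.

Lemma atom1 i j : (j <= k.+1)%N -> atom i j 1 = 0.
Proof.
move=> jk; apply: (@tpn_eval01 _ _ _ k.+2) => //; [exact: pvanish0| |by right].
exact: cutoff_poly_vanish.
Qed.

Lemma atom_cutoff i x : atom i 0 x = cutoff q k.+1 x * phi i x.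
Proof.
by rewrite /atom /tp/= horner0 mul0r add0r cutoff_polyE /phi /freq; ring.
Qed.

Lemma atom_sqr_le i x : 0 <= x <= 1 -> atom i 0 x ^+ 2 <= phi i x ^+ 2.
Proof.
move=> /(cutoff01 q k.+1) /andP[h0 h1].
by rewrite atom_cutoff exprMn ler_piMl ?sqr_ge0// exprn_ile1.
Qed.

Lemma atom_le2 i x : 0 <= x <= 1 -> `|atom i 0 x| <= 2.
Proof.
move=> /(cutoff01 q k.+1) /andP[h0 h1].
rewrite atom_cutoff normrM ger0_norm// (le_trans _ (phi_norm_le i x))//.
by rewrite ler_piMl.
Qed.

Lemma continuous_atom i j : continuous (atom i j).
Proof. exact: der_continuous (datom i j). Qed.

(* A discrete substitute for a standard Gaussian variable. *)
Definition std_binom (j : nat) : R := (2 * j%:R - M%:R) / Num.sqrt M%:R.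

Lemma std_binom_mean : \sum_(j < M.+1) binw R M j * std_binom j = 0.
Proof.
have -> : \sum_(j < M.+1) binw R M j * std_binom j =
   (2 * (\sum_(j < M.+1) j%:R * binw R M j) - M%:R * (\sum_(j < M.+1) binw R M j)) / Num.sqrt M%:R.
  rewrite !mulr_sumr -sumrB mulr_suml; apply: eq_bigr => j _.
  by rewrite /std_binom; ring.
rewrite binw_mean binw_sum (_ : _ - _ = 0) ?mul0r//; lra.
Qed.

Lemma std_binom_sqr : \sum_(j < M.+1) binw R M j * std_binom j ^+ 2 = 1.
Proof.
have s2 : Num.sqrt (M%:R : R) ^+ 2 = M%:R by rewrite sqr_sqrtr.
have M1 : M%:R != 0 :> R by rewrite pnatr_eq0 -lt0n.
have -> : \sum_(j < M.+1) binw R M j * std_binom j ^+ 2 =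
   (4 * (\sum_(j < M.+1) j%:R ^+ 2 * binw R M j) - 4 * M%:R * (\sum_(j < M.+1) j%:R * binw R M j)
    + M%:R ^+ 2 * (\sum_(j < M.+1) binw R M j)) / M%:R.
  rewrite !mulr_sumr -sumrB -big_split/= mulr_suml; apply: eq_bigr => j _.
  by rewrite /std_binom expr_div_n s2; ring.
by rewrite binw_mean binw_sum binw_sqr; field.
Qed.

Lemma std_binom_step (j : nat) : std_binom j = std_binom 0 + j%:R * (2 / Num.sqrt M%:R).
Proof. by rewrite /std_binom; ring. Qed.

Variable u : 'I_N -> R.
Hypothesis u0 : forall i, 0 <= u i.

Definition block_coef (t : {ffun 'I_N -> 'I_M.+1}) i : R := Num.sqrt (u i) * std_binom (t i).

Definition coord_weight (j : 'I_M.+1) : R := binw R M j.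
Definition block_weight (t : {ffun 'I_N -> 'I_M.+1}) : R := prodw coord_weight t.

Lemma coord_weight_ge0 j : 0 <= coord_weight j. Proof. exact: binw_ge0. Qed.
Lemma coord_weight_sum : \sum_j coord_weight j = 1. Proof. exact: binw_sum. Qed.
Lemma block_weight_ge0 t : 0 <= block_weight t.
Proof. by apply: prodw_ge0; exact: coord_weight_ge0. Qed.
Lemma block_weight_sum : \sum_t block_weight t = 1.
Proof. by apply: prodw_sum; exact: coord_weight_sum. Qed.

Definition energy j (c : 'I_N -> R) : R :=
  fine (\int[leb]_(x in @I01 R) ((\sum_i c i * atom i j x) ^+ 2)%:E)%E.

Lemma measurable_energy j (c : 'I_N -> R) :
  measurable_fun (@I01 R) (fun x => ((\sum_i c i * atom i j x) ^+ 2)%:E).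
Proof.
apply/measurable_EFinP; apply: measurable_funTS; apply: measurable_funX.
apply: measurable_sum => i; apply: measurable_funM => //.
by apply: continuous_measurable_fun; exact: continuous_atom.
Qed.

Lemma continuous_sumG j (c : 'I_N -> R) : continuous (fun x => \sum_i c i * atom i j x).
Proof.
apply: (@der_continuous _ _ (fun x => \sum_i c i * atom i j.+1 x)) => x.
by apply: isd_sum => i; exact: isd_scale (datom _ _ _).
Qed.

Lemma energyE j (c : 'I_N -> R) :
  (\int[leb]_(x in @I01 R) ((\sum_i c i * atom i j x) ^+ 2)%:E = (energy j c)%:E)%E.
Proof.
rewrite /energy fineK//.
have mI : measurable (@I01 R) by exact: measurable_itv.
have : leb.-integrable (@I01 R) (EFin \o (fun x => (\sum_i c i * atom i j x) ^+ 2)).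
  apply: continuous_compact_integrable; first exact: segment_compact.
  apply: continuous_subspaceT => x.
  have h := @continuous_sumG j c x.
  by rewrite /= (_ : (fun x => _ ^+ 2) = (fun x => (\sum_i c i * atom i j x) * (\sum_i c i * atom i j x)))//; exact: cvgM.
exact: integrable_fin_num.
Qed.

Lemma energy_ge0 j c : 0 <= energy j c.
Proof. by rewrite fine_ge0//; apply: integral_ge0 => x _; rewrite lee_fin sqr_ge0. Qed.

Lemma energyZ j (a : R) c :
  (\int[leb]_(x in @I01 R) ((\sum_i (a * c i) * atom i j x) ^+ 2)%:E = (a ^+ 2 * energy j c)%:E)%E.
Proof.
have mI : measurable (@I01 R) by exact: measurable_itv.
rewrite EFinM -energyE -ge0_integralZl_EFin ?sqr_ge0//; last 2 first.
- by move=> x _; rewrite lee_fin sqr_ge0.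
- exact: measurable_energy.
apply: eq_integral => x _; rewrite -EFinM -exprMn mulr_sumr; congr ((_ ^+ 2)%:E).
by apply: eq_bigr => i _; rewrite mulrA.
Qed.

Lemma energy_mean j :
  \sum_t block_weight t * energy j (block_coef t) = \sum_i u i * energy j (fun i' => (i' == i)%:R).
Proof.
have mI : measurable (@I01 R) by exact: measurable_itv.
apply: EFin_inj; rewrite -!sumEFin.
under eq_bigr => t _.
  rewrite EFinM -energyE -ge0_integralZl_EFin ?block_weight_ge0//; last 2 first.
  - by move=> x _; rewrite lee_fin sqr_ge0.
  - exact: measurable_energy.
  over.
under [RHS]eq_bigr => i _.
  rewrite EFinM -energyE -ge0_integralZl_EFin//; last 2 first.
  - by move=> x _; rewrite lee_fin sqr_ge0.
  - exact: measurable_energy.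
  over.
rewrite -ge0_integral_sum//; last 2 first.
- by move=> t; apply: measurable_funeM; exact: measurable_energy.
- by move=> t x _; rewrite -EFinM lee_fin mulr_ge0 ?block_weight_ge0 ?sqr_ge0.
rewrite -ge0_integral_sum//; last 2 first.
- by move=> t; apply: measurable_funeM; exact: measurable_energy.
- by move=> t x _; rewrite -EFinM lee_fin mulr_ge0 ?sqr_ge0.
apply: eq_integral => x _.
under eq_bigr do rewrite -EFinM.
under [RHS]eq_bigr do rewrite -EFinM.
rewrite !sumEFin; congr EFin.
have := @prodw_sqr R _ _ coord_weight coord_weight_sum (fun j => std_binom j) (fun i => Num.sqrt (u i) * atom i j x) std_binom_mean.
rewrite std_binom_sqr mulr1 => h.
transitivity (\sum_i (Num.sqrt (u i) * atom i j x) ^+ 2).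
  rewrite -h; apply: eq_bigr => t _; congr (_ * _ ^+ 2).
  by apply: eq_bigr => i _; rewrite /block_coef mulrAC.
apply: eq_bigr => i _; rewrite exprMn sqr_sqrtr//; congr (_ * _ ^+ 2).
rewrite (bigD1 i)//= big1 ?addr0 ?eqxx ?mul1r// => i' /negbTE ->.
by rewrite mul0r.
Qed.

End Prior.

Lemma sumr_cst_ord (R : pzRingType) n (c : R) : \sum_(i < n) c = c * n%:R.
Proof. by rewrite sumr_const card_ord mulr_natr. Qed.

Section PriorFunctions.
Variable R : realType.
Local Notation leb := (@lebesgue_measure R).
Variables (k q N M : nat) (u : 'I_N -> R) (v : R -> R).
Hypothesis M0 : (0 < M)%N.
Hypothesis u0 : forall i, 0 <= u i.
Local Notation blkT := {ffun 'I_N -> 'I_M.+1}.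
Local Notation G := (@atom R k q N).

Definition noise_scale (K n m : nat) : R := Num.sqrt (v (m%:R / K%:R) * (K%:R / n%:R)).

Definition prior_coef (K n : nat) (om : {ffun 'I_K -> blkT}) (m : nat) (i : 'I_N) : R :=
  if insub m is Some m' then noise_scale K n m * block_coef u (om m') i else 0.

Definition prior_fun (K n : nat) (om : {ffun 'I_K -> blkT}) : R -> R := tiled G K (prior_coef n om).

Definition bump_fun (K m0 : nat) (i0 : 'I_N) : R -> R := tiled G K (bumpf R m0 i0).

Definition step (K n m0 : nat) (i0 : 'I_N) : R :=
  noise_scale K n m0 * (Num.sqrt (u i0) * (2 / Num.sqrt M%:R)).

Lemma prior_coef_ord K n (om : {ffun 'I_K -> blkT}) (m : 'I_K) i :
  prior_coef n om m i = noise_scale K n m * block_coef u (om m) i.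
Proof. by rewrite /prior_coef valK. Qed.

Lemma prior_coef_path K n (om : {ffun 'I_K -> blkT}) (m0 : 'I_K) i0 (j : 'I_M.+1) m i :
  prior_coef n (upd om m0 (upd (om m0) i0 j)) m i =
  prior_coef n (upd om m0 (upd (om m0) i0 ord0)) m i + (j%:R * step K n m0 i0) * bumpf R m0 i0 m i.
Proof.
rewrite /prior_coef /bumpf; case: insubP => [m' mK mE|mK]; last first.
  rewrite (_ : (m == m0) = false) ?mulr0 ?addr0//.
  by apply/negP => /eqP E; rewrite E ltn_ord in mK.
rewrite -mE; have [E|mm] := eqVneq m' m0; last first.
  rewrite (_ : (m' == m0 :> nat) = false) ?mulr0 ?addr0 ?upd_other//.
  by apply/negP => /eqP E; rewrite (val_inj E) eqxx in mm.
rewrite E !upd_same eqxx/= /block_coef.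
have [->|ii] := eqVneq i i0; last by rewrite !upd_other// mulr0 addr0.
by rewrite !upd_same (std_binom_step _ _ j) /step mulr1; ring.
Qed.

Lemma prior_fun_path K n (om : {ffun 'I_K -> blkT}) (m0 : 'I_K) i0 (j : 'I_M.+1) :
  prior_fun n (upd om m0 (upd (om m0) i0 j)) =
  (fun t => prior_fun n (upd om m0 (upd (om m0) i0 ord0)) t + (j%:R * step K n m0 i0) * bump_fun K m0 i0 t).
Proof.
rewrite /prior_fun /bump_fun; apply/funext => t; rewrite -tiled_add; congr (tiled _ _ _ _).
by apply/funext => m; apply/funext => i; exact: prior_coef_path.
Qed.

Lemma prior_fun_bound K n (om : {ffun 'I_K -> blkT}) (smax C0 : R) t : (0 < K)%N ->
  (forall m, (m < K)%N -> noise_scale K n m <= smax) ->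
  (forall (b : blkT) i, `|block_coef u b i| <= C0) ->
  `|prior_fun n om t| <= N%:R * ((smax * C0) * 2).
Proof.
move=> K0 hs hC; apply: (tiled_bound (G := G)) => //.
- by move=> i x; exact: atom_le2.
- move=> m i mK; rewrite -[m]/(val (Ordinal mK)) prior_coef_ord normrM.
  by apply: ler_pM => //; rewrite ger0_norm ?sqrtr_ge0// hs.
Qed.

Lemma C01_prior_fun K n (om : {ffun 'I_K -> blkT}) : (0 < K)%N -> C01 (prior_fun n om).
Proof.
by move=> K0; apply: (@C01_tiled _ _ k G _ (@atom0 _ _ _ _) (@atom1 _ _ _ _)) => //; exact: datom.
Qed.

Lemma C01_bump_fun K m0 i0 : (0 < K)%N -> C01 (bump_fun K m0 i0).
Proof.
by move=> K0; apply: (@C01_tiled _ _ k G _ (@atom0 _ _ _ _) (@atom1 _ _ _ _)) => //; exact: datom.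
Qed.

Lemma prior_fun_Wkr K n (om : {ffun 'I_K -> blkT}) r : (0 < K)%N ->
  \sum_(j < k.+1) (K%:R ^+ (2 * j) / K%:R *
     \sum_(m < K) noise_scale K n m ^+ 2 * energy k q j (block_coef u (om m))) <= r ->
  Wkr k r (prior_fun n om).
Proof.
move=> K0 h; apply: (@tiled_Wkr _ _ k G (@datom _ _ _ _) (@atom0 _ _ _ _) (@atom1 _ _ _ _)) => //.
move: h; rewrite -lee_fin; congr (_ <= _)%E; rewrite -sumEFin.
apply: eq_bigr => j _; rewrite EFinM -sumEFin; congr (_ * _)%E.
apply: eq_bigr => m _; rewrite -energyZ; apply: eq_integral => x _.
by congr ((_ ^+ 2)%:E); apply: eq_bigr => i _; rewrite prior_coef_ord.
Qed.

Lemma prob_notWkr (alpha vmax eta r : R) : 0 <= alpha -> 0 <= vmax -> 0 < eta -> 0 < r ->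
  exists2 C : R, 0 <= C & forall K n : nat, (0 < K)%N -> (0 < n)%N ->
    K%:R ^+ (2 * k).+1 <= alpha * n%:R ->
    (forall m, (m < K)%N -> 0 <= v (m%:R / K%:R) <= vmax) ->
    alpha * ((\sum_(m < K) v (m%:R / K%:R)) / K%:R) *
      (\sum_i u i * energy k q k (fun i' => (i' == i)%:R)) <= (1 - eta) * r ->
    C <= K%:R ->
    \sum_(om : {ffun 'I_K -> blkT} | ~~ `[< Wkr k r (prior_fun n om) >]) prodw (@block_weight R N M) om <= C / K%:R.
Proof.
move=> a0 vm0 e0 r0.
set Eb : R := \sum_(j < k.+1) \sum_(t : blkT) energy k q j (block_coef u t).
have EbP j (t : blkT) : (j <= k)%N -> 0 <= energy k q j (block_coef u t) <= Eb.
  move=> jk; rewrite energy_ge0/= /Eb (bigD1 (inord j))//= inordK//.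
  rewrite (bigD1 t)//= -addrA lerDl addr_ge0// sumr_ge0// => *; rewrite ?energy_ge0//.
  by rewrite sumr_ge0// => *; rewrite energy_ge0.
have Eb0 : 0 <= Eb by do 2!(apply: sumr_ge0 => ? _); exact: energy_ge0.
set s := eta * r / 2.
have s0 : 0 < s by rewrite divr_gt0// mulr_gt0.
set C1 := k%:R * (alpha * vmax * Eb) / s.
set C2 := Eb ^+ 2 * (alpha * vmax) ^+ 2 / s ^+ 2.
have C10 : 0 <= C1 by rewrite divr_ge0 ?(ltW s0)// !mulr_ge0.
have C20 : 0 <= C2 by apply: divr_ge0; [apply: mulr_ge0; exact: sqr_ge0|exact: sqr_ge0].
exists (C1 + C2); first exact: addr_ge0.
move=> K n K0 n0 Kn hv hmean CK.
have KR : 0 < K%:R :> R by rewrite ltr0n.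
have nR : 0 < n%:R :> R by rewrite ltr0n.
have K1 : 1 <= K%:R :> R by rewrite ler1n.
have seE (m : 'I_K) : noise_scale K n m ^+ 2 = v (m%:R / K%:R) * (K%:R / n%:R).
  rewrite sqr_sqrtr// mulr_ge0 ?divr_ge0//.
  by have /andP[] := hv m (ltn_ord m).
pose c (m : 'I_K) : R := K%:R ^+ (2 * k) / K%:R * noise_scale K n m ^+ 2.
have c0 m : 0 <= c m by rewrite /c mulr_ge0 ?sqr_ge0// divr_ge0// exprn_ge0.
have Kn' : K%:R ^+ (2 * k) / n%:R <= alpha / K%:R.
  by rewrite ler_pdivlMr// mulrAC ler_pdivrMr// -exprSr.
have c1 m : c m <= alpha * vmax / K%:R.
  have -> : c m = v (m%:R / K%:R) * (K%:R ^+ (2 * k) / n%:R).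
    by rewrite /c seE; field; rewrite !gt_eqF.
  have /andP[h1 h2] := hv m (ltn_ord m).
  rewrite [leRHS](_ : _ = vmax * (alpha / K%:R)); last by ring.
  by apply: ler_pM => //; rewrite divr_ge0// exprn_ge0.
set mean := \sum_i u i * energy k q k (fun i' => (i' == i)%:R) in hmean.
have low (om : {ffun 'I_K -> blkT}) : \sum_(j < k) (K%:R ^+ (2 * j) / K%:R *
     \sum_(m < K) noise_scale K n m ^+ 2 * energy k q j (block_coef u (om m))) <= s.
  apply: (@le_trans _ _ (\sum_(j < k) (alpha * vmax * Eb / K%:R))).
    apply: ler_sum => j _; rewrite mulr_sumr.
    apply: (@le_trans _ _ (\sum_(m < K) (alpha * vmax * Eb / K%:R / K%:R))).
      apply: ler_sum => m _; rewrite seE.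
      have /andP[h1 h2] := hv m (ltn_ord m).
      have /andP[h3 h4] := EbP j (om m) (ltnW (ltn_ord j)).
      rewrite [leLHS](_ : _ = K%:R ^+ (2 * j) / n%:R * (v (m%:R / K%:R) * energy k q j (block_coef u (om m)))); last first.
        by field; rewrite !gt_eqF.
      rewrite [leRHS](_ : _ = (alpha / K%:R / K%:R) * (vmax * Eb)); last by ring.
      apply: ler_pM; rewrite ?mulr_ge0 ?divr_ge0 ?exprn_ge0//; last exact: ler_pM.
      apply: (@le_trans _ _ (K%:R ^+ (2 * k) / n%:R / K%:R)); last first.
        by rewrite ler_wpM2r// invr_ge0.
      rewrite mulrAC ler_wpM2r ?invr_ge0//.
      rewrite ler_pdivlMr// -exprSr ler_weXn2l//.
      by rewrite ltn_mul2l ltn_ord.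
    by rewrite sumr_cst_ord divfK ?gt_eqF.
  rewrite sumr_cst_ord mulrC mulrA ler_pdivrMr// [leRHS]mulrC.
  have : C1 <= K%:R by rewrite (le_trans _ CK)// lerDl.
  by rewrite /C1 ler_pdivrMr.
have := @prodw_chebyshev R 'I_K blkT (@block_weight R N M) (@block_weight_sum R N M) (@block_weight_ge0 R N M)
  (fun t => energy k q k (block_coef u t)) c Eb s.
have hE (t : blkT) : `|energy k q k (block_coef u t)| <= Eb.
  by have /andP[h1 h2] := EbP k t (leqnn k); rewrite ger0_norm.
move=> /(_ hE s0) cheb.
have : Eb ^+ 2 * (\sum_i c i ^+ 2) / s ^+ 2 <= (C1 + C2) / K%:R.
  apply: (@le_trans _ _ (C2 / K%:R)); last by rewrite ler_wpM2r ?invr_ge0// lerDr.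
  rewrite /C2 [leRHS]mulrAC ler_wpM2r ?invr_ge0 ?exprn_ge0 ?(ltW s0)//.
  rewrite -[leRHS]mulrA ler_wpM2l ?sqr_ge0//.
  apply: (@le_trans _ _ (\sum_(i < K) (alpha * vmax / K%:R) ^+ 2)).
    by apply: ler_sum => m _; rewrite lerXn2r ?nnegrE// divr_ge0// mulr_ge0.
  rewrite sumr_cst_ord le_eqVlt; apply/orP; left; apply/eqP.
  by field; rewrite gt_eqF.
apply: le_trans; apply: le_trans cheb.
rewrite [leLHS]big_mkcond [leRHS]big_mkcond/=; apply: ler_sum => om _.
have Pge0 : 0 <= prodw (@block_weight R N M) om by apply: prodw_ge0; exact: block_weight_ge0.
case: ifPn => [nW|_]; last by case: ifP.
rewrite ifT//; apply: contraR nW; rewrite -ltNge => hlt.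
apply/asboolP; apply: prior_fun_Wkr => //; rewrite big_ord_recr/=.
have -> : K%:R ^+ (2 * k) / K%:R * (\sum_(m < K) noise_scale K n m ^+ 2 * energy k q k (block_coef u (om m))) =
   \sum_m c m * energy k q k (block_coef u (om m)).
  by rewrite mulr_sumr; apply: eq_bigr => m _; rewrite /c mulrA.
rewrite energy_mean// -/mean in hlt.
have hc : (\sum_i c i) * mean <= (1 - eta) * r.
  apply: le_trans hmean; rewrite ler_wpM2r//.
    by rewrite sumr_ge0// => i _; rewrite mulr_ge0 ?energy_ge0.
  have -> : \sum_i c i = K%:R ^+ (2 * k) / n%:R * (\sum_(m < K) v (m%:R / K%:R)).
    by rewrite mulr_sumr; apply: eq_bigr => m _; rewrite /c seE; field; rewrite !gt_eqF.
  rewrite mulrA [leRHS]mulrAC ler_wpM2r//.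
  by rewrite sumr_ge0// => m _; have /andP[] := hv m (ltn_ord m).
apply: (le_trans (lerD (low om) (ltW hlt))).
by rewrite /s; lra.
Qed.

End PriorFunctions.

(** * Chi-square distance between neighbouring parameters *)

Section Neighbours.
Variable R : realType.
Local Notation leb := (@lebesgue_measure R).
Variables (k q N : nat).
Local Notation G := (@atom R k q N).
Local Notation bump_fun := (@bump_fun R k q N).

Lemma bump_fun_design n K (m0 : nat) i0 (l : 'I_n) : (0 < K)%N -> (m0 < K)%N ->
  bump_fun K m0 i0 (design R l) = if cell n K m0 l then G i0 0 (upt R n K m0 l) else 0.
Proof.
move=> K0 mK; have n0 : (0 < n)%N by exact: leq_ltn_trans (ltn_ord l).
rewrite /bump_fun /design; set m := ((K * l.+1) %/ n)%N.
have mc : cell n K m l by rewrite /cell.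
have [mlt|mge] := ltnP m K.
  rewrite (tiled_cell G (bumpf R m0 i0) n0 mlt mc) bump_sum.
  have [<-|mm] := eqVneq m m0; first by rewrite mc mul1r.
  by rewrite mul0r /cell -/m (negbTE mm).
have lE : l.+1 = n.
  apply/eqP; rewrite eqn_leq ltn_ord/=.
  by rewrite -(leq_pmul2l K0) -leq_divRL// -/m.
have -> : cell n K m0 l = false.
  apply/negP; rewrite /cell -/m => /eqP E; rewrite E in mge.
  by rewrite leqNgt mK in mge.
rewrite lE divff ?pnatr_eq0 -?lt0n// /tiled (@tileE _ _ _ K).
  rewrite mulr1 -pmulrn subrr /cellfun big1// => i _.
  by rewrite (@atom0 R k q N i 0)// mulr0.
by rewrite mulr1 intrD -!pmulrn lexx ltrDl ltr01.
Qed.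

Lemma L1norm_bump_fun K m0 i0 : (m0 < K)%N -> L1norm (bump_fun K m0 i0) <= 2 / K%:R.
Proof.
move=> mK; apply: (@L1norm_bump _ _ k G (@datom _ _ _ _) (@atom0 _ _ _ _) (@atom1 _ _ _ _)) => // x.
exact: atom_le2.
Qed.

Lemma L2norm_bump_fun K m0 i0 : (m0 < K)%N -> L2norm (bump_fun K m0 i0) ^+ 2 <= 2 ^+ 2 / K%:R.
Proof.
move=> mK; apply: (@L2norm_bump _ _ k G (@datom _ _ _ _) (@atom0 _ _ _ _) (@atom1 _ _ _ _)) => // x.
exact: atom_le2.
Qed.

Lemma bump_fun_bound K m0 i0 t : (m0 < K)%N -> `|bump_fun K m0 i0 t| <= N%:R * 2.
Proof.
move=> mK; rewrite -[2]mul1r; apply: (tiled_bound (G := G)) => //; first exact: leq_ltn_trans mK.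
- by move=> i x; exact: atom_le2.
- by move=> m i _; rewrite /bumpf; case: (_ && _); rewrite ?normr1 ?normr0.
Qed.

Lemma design01 n (l : 'I_n) : design R l \in @I01 R.
Proof.
rewrite inE /I01/= in_itv/= /design divr_ge0//=.
by rewrite ler_pdivrMr ?mul1r ?ler_nat// ltr0n (leq_ltn_trans _ (ltn_ord l)).
Qed.

Variables (g : R -> (R -> R) -> R) (L : R -> (R -> R) -> (R -> R) -> R) (Cs : R).
Hypothesis h2 : H2 g L.
Hypothesis Cs0 : 0 < Cs.
Hypothesis h3 : forall S f x, C01 S -> C01 f -> x \in @I01 R ->
      `|L x S f| <= Cs * (`|S x * f x| + L1norm f + L2norm S * L2norm f).

Lemma variation_bound n K (m0 : nat) i0 (S0 : R -> R) (Delta rho vmin : R) (l : 'I_n) :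
  (m0 < K)%N -> C01 S0 -> 0 <= rho ->
  (forall t y, `|t| <= `|Delta| -> I01 y -> `|S0 y + t * bump_fun K m0 i0 y| <= rho) ->
  0 < vmin -> vmin <= g (design R l) S0 ^+ 2 ->
  ((g (design R l) (fun t => S0 t + Delta * bump_fun K m0 i0 t) ^+ 2 - g (design R l) S0 ^+ 2)
    / g (design R l) S0 ^+ 2) ^+ 2 <=
  12 * (Delta * Cs / vmin) ^+ 2 * (rho ^+ 2 * (cell n K m0 l)%:R + K%:R^-1 ^+ 2 + rho ^+ 2 / K%:R).
Proof.
move=> mK cS rho0 Srho vm0 vg.
have K0 : (0 < K)%N by exact: leq_ltn_trans mK.
have Db y : I01 y -> `|bump_fun K m0 i0 y| <= N%:R * 2 by move=> _; exact: bump_fun_bound.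
have h := g_lip h2 h3 Cs0 cS (@C01_bump_fun R k q N K m0 i0 K0) (design01 l) Db rho0 Srho.
rewrite -[X in X <= _](real_normK (num_real _)) normrM normfV.
set w := _ + _ + _ in h.
have w0 : 0 <= w.
  by rewrite /w !addr_ge0 ?mulr_ge0 ?sqrtr_ge0// fine_ge0// integral_ge0// => x _; rewrite lee_fin.
apply: (@le_trans _ _ ((`|Delta| * (Cs * w) / vmin) ^+ 2)).
  rewrite lerXn2r ?nnegrE ?divr_ge0 ?mulr_ge0 ?(ltW Cs0) ?(ltW vm0)//.
  apply: ler_pM => //.
  by rewrite lef_pV2 ?posrE ?normr_gt0 ?gt_eqF ?(lt_le_trans vm0)// ger0_norm// (le_trans (ltW vm0)).
have -> : (`|Delta| * (Cs * w) / vmin) ^+ 2 = (Delta * Cs / vmin) ^+ 2 * w ^+ 2.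
  by rewrite mulrA mulrAC !exprMn (real_normK (num_real _)).
rewrite -[leRHS]mulrA [leRHS]mulrCA ler_wpM2l ?sqr_ge0//.
have D2 : `|bump_fun K m0 i0 (design R l)| ^+ 2 <= 4 * (cell n K m0 l)%:R.
  rewrite bump_fun_design//; case: ifPn => c; last by rewrite normr0 expr0n mulr0.
  rewrite mulr1 (_ : 4 = 2 ^+ 2 :> R); last by rewrite -natrX.
  rewrite lerXn2r ?nnegrE// atom_le2//.
  have n0 : (0 < n)%N by exact: leq_ltn_trans (ltn_ord l).
  by have /andP[-> /ltW ->] := upt01 R n0 c.
have L1 := @L1norm_bump_fun K m0 i0 mK; have L2 := @L2norm_bump_fun K m0 i0 mK.
have L10 : 0 <= L1norm (bump_fun K m0 i0).
  by rewrite fine_ge0// integral_ge0// => x _; rewrite lee_fin.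
have L12 : L1norm (bump_fun K m0 i0) ^+ 2 <= 4 * K%:R^-1 ^+ 2.
  rewrite (_ : 4 = 2 ^+ 2 :> R); last by rewrite -natrX.
  by rewrite -exprMn lerXn2r ?nnegrE// divr_ge0.
apply: (@le_trans _ _ (3 * ((rho * `|bump_fun K m0 i0 (design R l)|) ^+ 2 + L1norm (bump_fun K m0 i0) ^+ 2
   + (rho * L2norm (bump_fun K m0 i0)) ^+ 2))).
  rewrite /w; move: (rho * _) (L1norm _) (rho * L2norm _) => a b c.
  rewrite -subr_ge0 (_ : _ - _ = (a - b) ^+ 2 + (b - c) ^+ 2 + (a - c) ^+ 2); last by ring.
  by rewrite !addr_ge0 ?sqr_ge0.
rewrite !exprMn [12](_ : _ = 3 * 4); last by rewrite -natrM.
rewrite -[leRHS]mulrA ler_wpM2l// ![4 * _]mulrDr; apply: lerD; first apply: lerD => //.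
  by rewrite [leRHS]mulrCA ler_wpM2l ?sqr_ge0.
rewrite [leRHS]mulrCA ler_wpM2l ?sqr_ge0// (le_trans L2)// -natrX//.
Qed.

Lemma chi_exponent n K (m0 : nat) i0 (S0 S1 : R -> R) (Delta rho vmin vm eta : R) :
  (0 < n)%N -> (K <= n)%N -> (m0 < K)%N -> 0 < eta -> eta < 1 -> C01 S0 ->
  S1 = (fun t => S0 t + Delta * bump_fun K m0 i0 t) ->
  0 <= rho -> rho <= 1 ->
  (forall t y, `|t| <= `|Delta| -> I01 y -> `|S0 y + t * bump_fun K m0 i0 y| <= rho) ->
  0 < vmin -> (forall x, x \in @I01 R -> vmin <= g x S0 ^+ 2) ->
  0 < vm -> (forall l : 'I_n, cell n K m0 l ->
    (1 - eta) * vm <= 2 * g (design R l) S0 ^+ 2 - g (design R l) S1 ^+ 2) ->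
  72 * (Delta * Cs / vmin) ^+ 2 <= 1 ->
  let a l := (g (design R l) S1 ^+ 2 - g (design R l) S0 ^+ 2) / g (design R l) S0 ^+ 2 in
  (forall l : 'I_n, 2 * a l ^+ 2 <= 1) /\
  \sum_(l < n) (a l ^+ 2 + (S1 (design R l) - S0 (design R l)) ^+ 2 /
     (2 * g (design R l) S0 ^+ 2 - g (design R l) S1 ^+ 2)) <=
  Delta ^+ 2 * (n%:R / K%:R) * (12 * (Cs / vmin) ^+ 2 * (3 * rho ^+ 2 + K%:R^-1) +
    (1 + (4 + 8 * pi * N%:R) * (K%:R / n%:R)) / ((1 - eta) * vm)).
Proof.
move=> n0 Kn mK e0 e1 cS S1E rho0 rho1 Srho vmin0 vg vm0 vden hD a.
have K0 : (0 < K)%N by exact: leq_ltn_trans mK.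
have KR : 0 < K%:R :> R by rewrite ltr0n.
have nR : 0 < n%:R :> R by rewrite ltr0n.
have Ki1 : K%:R^-1 <= 1 :> R by rewrite invf_le1// ler1n.
have rho21 : rho ^+ 2 <= 1 by rewrite exprn_ile1.
have al l := @variation_bound n K m0 i0 S0 Delta rho vmin l mK cS rho0 Srho vmin0 (vg _ (design01 l)).
rewrite -S1E in al.
set W := (Delta * Cs / vmin) ^+ 2 in hD al.
have W0 : 0 <= 12 * W by rewrite pmulr_rge0 ?sqr_ge0.
split=> [l|].
  apply: (@le_trans _ _ (2 * (12 * W * 3))); last by move: hD; lra.
  rewrite ler_wpM2l// (le_trans (al l))// ler_wpM2l//.
  have i0' : 0 <= K%:R^-1 :> R by rewrite invr_ge0.
  have c1 : (0 <= (cell n K m0 l)%:R :> R) && ((cell n K m0 l)%:R <= 1 :> R).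
    by case: (cell _ _ _ _); rewrite ?lexx ?ler01.
  move/andP: c1 => [c0 c1].
  rewrite (_ : 3 = 1 + 1 + 1); last by ring.
  by rewrite !lerD// ?exprn_ile1// mulr_ile1// sqr_ge0.
rewrite big_split/=.
rewrite [leRHS]mulrDr lerD//.
  apply: (@le_trans _ _ (\sum_(l < n) 12 * W * (rho ^+ 2 * (cell n K m0 l)%:R + K%:R^-1 ^+ 2 + rho ^+ 2 / K%:R))).
    by apply: ler_sum => l _; exact: al.
  rewrite -mulr_sumr !big_split/= -mulr_sumr !sumr_cst_ord.
  have -> : \sum_(l < n) (cell n K m0 l)%:R = \sum_(l < n | cell n K m0 l) 1 :> R.
    by rewrite [RHS]big_mkcond; apply: eq_bigr => l _; case: cell.
  have cc := @cell_count R n K m0 n0 K0 Kn mK.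
  have {}cc : \sum_(l < n | cell n K m0 l) 1 <= 2 * (n%:R / K%:R) :> R.
    by rewrite -ler_pdivrMr ?divr_gt0// invf_div mulrC.
  have -> : Delta ^+ 2 * (n%:R / K%:R) * (12 * (Cs / vmin) ^+ 2 * (3 * rho ^+ 2 + K%:R^-1)) =
    12 * W * (rho ^+ 2 * (2 * (n%:R / K%:R)) + K%:R^-1 ^+ 2 * n%:R + rho ^+ 2 / K%:R * n%:R).
    by rewrite /W; field; rewrite !gt_eqF.
  by rewrite ler_wpM2l// !lerD2r ler_wpM2l ?sqr_ge0.
have gram := @phi_gram R n K m0 N i0 i0 n0 K0 Kn mK (ltn_ord i0) (ltn_ord i0).
rewrite eqxx in gram.
have {}gram : \sum_(l < n | cell n K m0 l) phi i0 (upt R n K m0 l) ^+ 2 <=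
   n%:R / K%:R * (1 + (4 + 8 * pi * N%:R) * (K%:R / n%:R)).
  rewrite -ler_pdivrMl ?divr_gt0// invf_div.
  rewrite -lerBlDl; exact: le_trans (ler_norm _) gram.
apply: (@le_trans _ _ (\sum_(l < n | cell n K m0 l) Delta ^+ 2 / ((1 - eta) * vm) * phi i0 (upt R n K m0 l) ^+ 2)).
  rewrite [leRHS]big_mkcond; apply: ler_sum => l _.
  rewrite S1E addrAC subrr add0r bump_fun_design// -S1E; case: ifPn => c; last by rewrite mulr0 expr0n mul0r.
  rewrite exprMn mulrAC; apply: ler_pM; rewrite ?sqr_ge0//.
  - rewrite divr_ge0 ?sqr_ge0// (le_trans _ (vden _ c))// mulr_ge0// ?(ltW vm0)//; lra.
  - rewrite ler_wpM2l ?sqr_ge0// lef_pV2 ?posrE ?vden//; last first.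
      by rewrite mulr_gt0//; lra.
    by rewrite (lt_le_trans _ (vden _ c))// mulr_gt0//; lra.
  - by apply: atom_sqr_le; have /andP[-> /ltW ->] := upt01 R n0 c.
rewrite -mulr_sumr.
apply: (le_trans (ler_wpM2l _ gram)).
  by rewrite divr_ge0 ?sqr_ge0// mulr_ge0// ?(ltW vm0)//; lra.
rewrite le_eqVlt; apply/orP; left; apply/eqP.
by ring.
Qed.

End Neighbours.

(** * Bayes risk of one coordinate *)

Section Bayes.
Variable R : realType.
Local Notation leb := (@lebesgue_measure R).
Variables (g : R -> (R -> R) -> R).

Definition reg_lik n (S : R -> R) : n.-tuple R -> R :=
  lik (fun l : 'I_n => S (design R l)) (fun l : 'I_n => g (design R l) S).

Lemma reg_lik_ge0 n S (y : n.-tuple R) : 0 <= reg_lik S y.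
Proof. by apply: prodr_ge0 => l _; exact: normal_pdf_ge0. Qed.

Lemma path_van_trees n M (S : nat -> R -> R) (T : n.-tuple R -> R) (tau0 delta kap : R) (z : nat -> R) :
  (0 < M)%N -> 0 <= kap ->
  (forall j (l : 'I_n), (j <= M)%N -> 0 < g (design R l) (S j)) ->
  (forall j, (j < M)%N ->
    let a (l : 'I_n) := (g (design R l) (S j) ^+ 2 - g (design R l) (S j.+1) ^+ 2) / g (design R l) (S j.+1) ^+ 2 in
    (forall l, 2 * a l ^+ 2 <= 1) /\
    \sum_(l < n) (a l ^+ 2 + (S j (design R l) - S j.+1 (design R l)) ^+ 2 /
     (2 * g (design R l) (S j.+1) ^+ 2 - g (design R l) (S j) ^+ 2)) <= kap) ->
  measurable_fun setT T ->
  (forall j, (j <= M)%N ->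
    leb_int (fun y => (reg_lik (S j) y * (T y - (tau0 + j%:R * delta)) ^+ 2)%:E) = (z j)%:E) ->
  (delta * M%:R / 2) ^+ 2 <=
  (\sum_(j < M.+1) binw R M j * z j) * (M%:R + (expR kap - 1) * ((M%:R ^+ 2 + M%:R) / 4)).
Proof.
move=> M0 kap0 g0 hchi mT hz.
apply: (@discrete_van_trees R n M (fun j => reg_lik (S j)) T tau0) => //.
- by rewrite subr_ge0 -expR0 ler_expR.
- by move=> j _; exact: measurable_lik.
- by move=> j y jM; apply: lik_gt0 => l; exact: g0.
- by move=> j _; exact: leb_int_lik.
- by move=> j jM; apply: measurable_lik_ratio => l; apply: g0 => //; exact: ltnW.
- move=> j jM; have [h1 h2] := hchi j jM.
  have := @chi2_lik R n (fun l => S j (design R l)) (fun l => g (design R l) (S j))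
    (fun l => S j.+1 (design R l)) (fun l => g (design R l) (S j.+1))
    (fun l => g0 _ l jM) (fun l => g0 _ l (ltnW jM)) h1.
  move/le_trans; apply.
  by rewrite lee_fin addrC subrK ler_expR.
Qed.

Definition coord_mean n K (S : R -> R) (m i : nat) : R :=
  K%:R / n%:R * (\sum_(l < n | cell n K m l) S (design R l) * phi i (upt R n K m l)).

(* Clipping the estimated coordinates keeps the loss bounded on the event that the
   random function leaves the Sobolev ball. *)
Definition clip (b x : R) : R := Num.max (- b) (Num.min x b).

Lemma clip_bound b x : 0 <= b -> `|clip b x| <= b.
Proof.
move=> b0; rewrite ler_norml /clip le_max lexx/= ge_max ge_min lexx orbT andbT.
by rewrite (le_trans _ b0)// oppr_le0.
Qed.

Lemma clip_sqr b x y : 0 <= b -> `|y| <= b -> (clip b x - y) ^+ 2 <= (x - y) ^+ 2.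
Proof.
move=> b0; rewrite ler_norml => /andP[y1 y2]; rewrite /clip.
have [xb|bx] := leP x b; have [h|h] := leP (- b) _ => //.
- rewrite -subr_ge0; nra.
- rewrite -subr_ge0; nra.
- rewrite -subr_ge0; nra.
Qed.

Definition coord_est n K (Sh : n.-tuple R -> R -> R) b m i (y : n.-tuple R) : R :=
  clip b (coord_mean n K (Sh y) m i).

Lemma measurable_coord_est n K Sh b m i : @estimator R n Sh ->
  measurable_fun setT (coord_est K Sh b m i).
Proof.
move=> mSh; apply: measurable_maxr => //; apply: measurable_minr => //.
apply: measurable_funM => //; rewrite /=.
under eq_fun do rewrite big_mkcond/=.
apply: measurable_sum => l; case: cell => //.
apply: measurable_funM => //; exact: mSh.
Qed.

Definition coord_risk n K (Sh : n.-tuple R -> R -> R) b m i (S : R -> R) : R :=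
  fine (leb_int (fun y => (reg_lik S y * (coord_est K Sh b m i y - coord_mean n K S m i) ^+ 2)%:E)).

Lemma measurable_coord_risk n K Sh b m i S : @estimator R n Sh ->
  measurable_fun setT (fun y => (reg_lik S y * (coord_est K Sh b m i y - coord_mean n K S m i) ^+ 2)%:E).
Proof.
move=> mSh; apply/measurable_EFinP; apply: measurable_funM; first exact: measurable_lik.
by apply: measurable_funX; apply: measurable_funB => //; exact: measurable_coord_est.
Qed.

Lemma leb_int_const n S (c : R) : 0 <= c ->
  leb_int (fun y : n.-tuple R => (reg_lik S y * c)%:E) = c%:E.
Proof.
move=> c0; under eq_fun do rewrite mulrC EFinM.
rewrite leb_intZl//; first by rewrite leb_int_lik mule1.
- by apply/measurable_EFinP; exact: measurable_lik.
- by move=> y; rewrite lee_fin reg_lik_ge0.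
Qed.

Lemma coord_risk_le n K Sh b m i S : @estimator R n Sh -> 0 <= b -> `|coord_mean n K S m i| <= b ->
  (leb_int (fun y => (reg_lik S y * (coord_est K Sh b m i y - coord_mean n K S m i) ^+ 2)%:E) <= (4 * b ^+ 2)%:E)%E.
Proof.
move=> mSh b0 tb; rewrite -(@leb_int_const n S); last by rewrite mulr_ge0 ?sqr_ge0.
apply: le_leb_int.
- exact: measurable_coord_risk.
- apply/measurable_EFinP; apply: measurable_funM => //; exact: measurable_lik.
- by move=> y; rewrite lee_fin mulr_ge0 ?reg_lik_ge0 ?sqr_ge0.
move=> y; rewrite lee_fin ler_wpM2l ?reg_lik_ge0//.
have Tb : `|coord_est K Sh b m i y| <= b by exact: clip_bound.
have h : `|coord_est K Sh b m i y - coord_mean n K S m i| <= 2 * b.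
  by rewrite (le_trans (ler_normB _ _))// mulr_natl mulr2n lerD.
rewrite -(real_normK (num_real _)) (_ : 4 * b ^+ 2 = (2 * b) ^+ 2); last by ring.
by rewrite lerXn2r ?nnegrE// mulr_ge0.
Qed.

Lemma coord_risk_ge0 n K Sh b m i S : 0 <= @coord_risk n K Sh b m i S.
Proof.
by rewrite fine_ge0// leb_int_ge0// => y; rewrite lee_fin mulr_ge0 ?reg_lik_ge0 ?sqr_ge0.
Qed.

Lemma coord_riskE n K Sh b m i S : @estimator R n Sh -> 0 <= b -> `|coord_mean n K S m i| <= b ->
  leb_int (fun y => (reg_lik S y * (coord_est K Sh b m i y - coord_mean n K S m i) ^+ 2)%:E) = (coord_risk K Sh b m i S)%:E.
Proof.
move=> mSh b0 tb; rewrite fineK// ge0_fin_numE.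
  by rewrite (le_lt_trans (coord_risk_le mSh b0 tb))// ltry.
by rewrite leb_int_ge0// => y; rewrite lee_fin mulr_ge0 ?reg_lik_ge0 ?sqr_ge0.
Qed.

Lemma coord_risk_bound n K Sh b m i S : @estimator R n Sh -> 0 <= b -> `|coord_mean n K S m i| <= b ->
  coord_risk K Sh b m i S <= 4 * b ^+ 2.
Proof. by move=> mSh b0 tb; rewrite -lee_fin -coord_riskE// coord_risk_le. Qed.

Lemma coord_mean_lin n K (S D : R -> R) c m i :
  coord_mean n K (fun t => S t + c * D t) m i = coord_mean n K S m i + c * coord_mean n K D m i.
Proof.
rewrite /coord_mean mulrCA -mulrDr; congr (_ * _); rewrite mulr_sumr -big_split/=.
by apply: eq_bigr => l _; rewrite mulrDl !mulrA.
Qed.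

Lemma coord_mean_bound n K S (rho : R) m i : (0 < n)%N -> (0 < K)%N -> (K <= n)%N -> (m < K)%N ->
  0 <= rho -> (forall t, `|S t| <= rho) -> `|coord_mean n K S m i| <= 4 * rho.
Proof.
move=> n0 K0 Kn mK rho0 Srho; rewrite /coord_mean normrM ger0_norm ?divr_ge0//.
have cc := @cell_count R n K m n0 K0 Kn mK.
apply: (@le_trans _ _ (K%:R / n%:R * (\sum_(l < n | cell n K m l) rho * 2))).
  rewrite ler_wpM2l ?divr_ge0// (le_trans (ler_norm_sum _ _ _))//.
  by apply: ler_sum => l _; rewrite normrM ler_pM// phi_norm_le.
have -> : \sum_(l < n | cell n K m l) rho * 2 = (rho * 2) * (\sum_(l < n | cell n K m l) 1).
  by rewrite mulr_sumr; apply: eq_bigr => l _; rewrite mulr1.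
rewrite mulrCA [leRHS](_ : _ = (rho * 2) * 2); last by ring.
by rewrite ler_wpM2l// mulr_ge0.
Qed.

Variables (k q N M : nat) (u : 'I_N -> R) (v : R -> R).
Hypothesis M0 : (0 < M)%N.
Hypothesis u0 : forall i, 0 <= u i.
Local Notation blkT := {ffun 'I_N -> 'I_M.+1}.

Lemma bayes_coordinate n K (Sh : n.-tuple R -> R -> R) (m0 : 'I_K) (i0 : 'I_N) (b kap : R) :
  @estimator R n Sh -> 0 <= b -> 0 <= kap ->
  0 <= v (m0%:R / K%:R) ->
  (forall om : {ffun 'I_K -> blkT}, `|coord_mean n K (prior_fun k q u v n om) m0 i0| <= b) ->
  (forall (om : {ffun 'I_K -> blkT}) (l : 'I_n), 0 < g (design R l) (prior_fun k q u v n om)) ->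
  (forall (om om' : {ffun 'I_K -> blkT}),
    let S1 := prior_fun k q u v n om in let S0 := prior_fun k q u v n om' in
    S1 = (fun t => S0 t + (- step M u v K n m0 i0) * bump_fun k q K m0 i0 t) ->
    let a (l : 'I_n) := (g (design R l) S1 ^+ 2 - g (design R l) S0 ^+ 2) / g (design R l) S0 ^+ 2 in
    (forall l, 2 * a l ^+ 2 <= 1) /\
    \sum_(l < n) (a l ^+ 2 + (S1 (design R l) - S0 (design R l)) ^+ 2 /
     (2 * g (design R l) S0 ^+ 2 - g (design R l) S1 ^+ 2)) <= kap) ->
  v (m0%:R / K%:R) * (K%:R / n%:R) * u i0 * coord_mean n K (bump_fun k q K m0 i0) m0 i0 ^+ 2 <=
  (\sum_(om : {ffun 'I_K -> blkT}) prodw (@block_weight R N M) om * coord_risk K Sh b m0 i0 (prior_fun k q u v n om)) *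
   (1 + (expR kap - 1) * ((M%:R + 1) / 4)).
Proof.
move=> mSh b0 kap0 v0 taub gpos hchi.
have MR : 0 < M%:R :> R by rewrite ltr0n.
have X0 : 0 <= expR kap - 1 by rewrite subr_ge0 -expR0 ler_expR.
set X := expR kap - 1 in X0 *.
have Q0 : 0 < 1 + X * ((M%:R + 1) / 4) by rewrite ltr_pwDl// mulr_ge0// divr_ge0// addr_ge0.
rewrite -ler_pdivrMr//; set B := (X in X <= _).
pose path (om : {ffun 'I_K -> blkT}) (j : nat) := upd om m0 (upd (om m0) i0 (inord j)).
have key (om : {ffun 'I_K -> blkT}) : B <= \sum_j coord_weight R j * coord_risk K Sh b m0 i0 (prior_fun k q u v n (upd om m0 (upd (om m0) i0 j))).
  have pathE j : (j <= M)%N -> prior_fun k q u v n (path om j) =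
      fun t => prior_fun k q u v n (path om 0%N) t + (j%:R * step M u v K n m0 i0) * bump_fun k q K m0 i0 t.
    move=> jM; rewrite /path.
    have jE : nat_of_ord (inord j : 'I_M.+1) = j by exact: inordK.
    have -> : (inord 0 : 'I_M.+1) = ord0 by apply: val_inj; rewrite /= inordK.
    by rewrite prior_fun_path jE.
  have pathS j : (j < M)%N -> prior_fun k q u v n (path om j) =
      fun t => prior_fun k q u v n (path om j.+1) t + (- step M u v K n m0 i0) * bump_fun k q K m0 i0 t.
    move=> jM; rewrite pathE ?(ltnW jM)// (pathE j.+1)//; apply/funext => t.
    by rewrite -natr1; ring.
  have := @path_van_trees n M (fun j => prior_fun k q u v n (path om j)) (coord_est K Sh b m0 i0)
    (coord_mean n K (prior_fun k q u v n (path om 0%N)) m0 i0)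
    (step M u v K n m0 i0 * coord_mean n K (bump_fun k q K m0 i0) m0 i0) kap
    (fun j => coord_risk K Sh b m0 i0 (prior_fun k q u v n (path om j))) M0 kap0.
  move=> /(_ (fun j l _ => gpos _ l)).
  move=> /(_ (fun j jM => hchi (path om j) (path om j.+1) (pathS j jM))).
  move=> /(_ (measurable_coord_est _ _ _ _ mSh)).
  rewrite -/X => vt.
  rewrite /B ler_pdivrMr//.
  have -> : \sum_j coord_weight R j * coord_risk K Sh b m0 i0 (prior_fun k q u v n (upd om m0 (upd (om m0) i0 j))) =
     \sum_(j < M.+1) binw R M j * coord_risk K Sh b m0 i0 (prior_fun k q u v n (path om j)).
    by apply: eq_bigr => j _; rewrite /path inord_val.
  rewrite -(@ler_pM2r _ M%:R)//.
  have -> : v (m0%:R / K%:R) * (K%:R / n%:R) * u i0 * coord_mean n K (bump_fun k q K m0 i0) m0 i0 ^+ 2 * M%:R =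
     (step M u v K n m0 i0 * coord_mean n K (bump_fun k q K m0 i0) m0 i0 * M%:R / 2) ^+ 2.
    move: (coord_mean _ _ _ _ _) => t0.
    have H (a c s : R) : s != 0 ->
      (a * (c * (2 / s)) * t0 * M%:R / 2) ^+ 2 = a ^+ 2 * c ^+ 2 * t0 ^+ 2 * M%:R ^+ 2 / s ^+ 2.
      by move=> s0; field.
    rewrite /step /noise_scale H ?gt_eqF ?sqrtr_gt0// !sqr_sqrtr// ?mulr_ge0 ?divr_ge0//.
    have Mn : M%:R != 0 :> R by rewrite gt_eqF.
    by move: (K%:R / n%:R) => w; field.
  rewrite -[leRHS]mulrA (_ : (1 + _) * _ = M%:R + X * ((M%:R ^+ 2 + M%:R) / 4)); last by field.
  apply: vt => j jM; rewrite -(@coord_riskE n K Sh b m0 i0 _ mSh b0 (taub (path om j))).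
  apply: congr1; apply/funext => y; congr ((_ * (_ - _) ^+ 2)%:E).
  by rewrite (pathE j)// coord_mean_lin mulrA.
rewrite (@prodw_resample R 'I_K blkT (@block_weight R N M) (@block_weight_sum R N M) _ m0).
have PB : B = \sum_(om : {ffun 'I_K -> blkT}) prodw (@block_weight R N M) om * B.
  by rewrite -mulr_suml (@prodw_sum R 'I_K blkT _ (@block_weight_sum R N M)) mul1r.
rewrite {1}PB; apply: ler_sum => om _; rewrite ler_wpM2l//; first by apply: prodw_ge0; exact: block_weight_ge0.
rewrite (@prodw_resample R 'I_N 'I_M.+1 (@coord_weight R M) (@coord_weight_sum R M) _ i0).
have -> : B = \sum_(t : blkT) prodw (@coord_weight R M) t * B.
  by rewrite -mulr_suml (@prodw_sum R 'I_N 'I_M.+1 _ (@coord_weight_sum R M)) mul1r.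
apply: ler_sum => t _; rewrite ler_wpM2l//; first by apply: prodw_ge0; exact: coord_weight_ge0.
apply: (le_trans (key (upd om m0 t))); rewrite le_eqVlt; apply/orP; left; apply/eqP.
apply: eq_bigr => j _; congr (_ * coord_risk _ _ _ _ _ (prior_fun _ _ _ _ _ _)).
by apply/ffunP => m; rewrite !ffunE eqxx; case: eqP.
Qed.

End Bayes.

(** * From the loss to the coordinates *)

Section Total.
Variable R : realType.
Local Notation leb := (@lebesgue_measure R).

Lemma kappa_bound (u Lam M kap kmax : R) : 0 <= u -> 1 <= Lam -> 0 < M -> kmax < 1 ->
  kap = 4 * u / M * Lam -> kap <= kmax ->
  1 + (expR kap - 1) * ((M + 1) / 4) <= (1 + u) * (Lam * (1 + M^-1) / (1 - kmax)).
Proof.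
move=> u0 L1 M0 k1 kE kk.
have kap0 : 0 <= kap by rewrite kE mulr_ge0 ?divr_ge0 ?mulr_ge0 ?(ltW M0)//; lra.
have Mi : 0 < M^-1 by rewrite invr_gt0.
have h1 : expR kap - 1 <= kap / (1 - kmax).
  have h := expR_ge1Dx (- kap); rewrite expRN in h.
  have e0 := expR_gt0 kap.
  rewrite ler_pdivlMr; last lra.
  have h2 : (1 - kap) * expR kap <= 1.
    by rewrite -ler_pdivlMr// div1r.
  apply: (@le_trans _ _ ((expR kap - 1) * (1 - kap))); last nra.
  rewrite ler_wpM2l//; last lra.
  by rewrite subr_ge0 -expR0 ler_expR.
have h2 : (expR kap - 1) * ((M + 1) / 4) <= u * (Lam * (1 + M^-1) / (1 - kmax)).
  apply: (le_trans (ler_wpM2r _ h1)); first by rewrite divr_ge0// addr_ge0// ltW.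
  rewrite le_eqVlt; apply/orP; left; apply/eqP; rewrite kE.
  by field; rewrite !gt_eqF//; lra.
rewrite [leRHS]mulrDl [X in _ <= X + _]mul1r lerD//.
rewrite ler_pdivlMr; last lra.
rewrite mul1r; apply: (@le_trans _ _ (1 * 1)); first by have := le_trans kap0 kk; lra.
by apply: ler_pM => //; lra.
Qed.

Lemma coord_mean_bump_fun_ge (k q N K n m : nat) (i : 'I_N) :
  (0 < n)%N -> (K <= n)%N -> (m < K)%N ->
  1 - (4 + 8 * pi * N%:R) * (K%:R / n%:R) - 2 * k.+2%:R * ((2 * q.+1 + 1)%:R^-1 +
    (2 * ((2 * q.+1)%:R * 3 ^+ (2 * q.+1) * 2) + 2 * 3 ^+ (2 * q.+1)) * (K%:R / n%:R))
  <= coord_mean n K (bump_fun k q.+1 K m i) m i :> R.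
Proof.
move=> n0 Kn mK; have K0 : (0 < K)%N by exact: leq_ltn_trans mK.
have gram := @phi_gram R n K m N i i n0 K0 Kn mK (ltn_ord i) (ltn_ord i).
rewrite eqxx ler_norml in gram; case/andP: gram => [gram _].
have rp := @riemann_power R n K m q n0 K0 Kn mK.
set t : R := K%:R / n%:R in gram rp *.
have t0 : 0 <= t by rewrite divr_ge0.
have -> : coord_mean n K (bump_fun k q.+1 K m i) m i =
    t * (\sum_(l < n | cell n K m l) cutoff q.+1 k.+1 (upt R n K m l) * phi i (upt R n K m l) ^+ 2).
  rewrite /coord_mean; congr (_ * _); apply: eq_bigr => l c.
  by rewrite bump_fun_design// c atom_cutoff expr2 mulrA.
apply: (@le_trans _ _ (t * (\sum_(l < n | cell n K m l)
    (phi i (upt R n K m l) * phi i (upt R n K m l) - 2 * k.+2%:R * (2 * upt R n K m l - 1) ^+ (2 * q.+1))))).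
  rewrite sumrB -mulr_sumr mulrBr lerB//; first by move: gram; rewrite lerBrDr addrC.
  by rewrite mulrCA ler_wpM2l.
rewrite ler_wpM2l//; apply: ler_sum => l c.
have /andP[x0 /ltW x1] := upt01 R n0 c.
have x01 : 0 <= upt R n K m l <= 1 by rewrite x0.
have h1 := cutoff_ge q.+1 k.+1 x01; have h2 := phi_sqr_le i (upt R n K m l).
have /andP[h3 _] := cutoff_base q.+1 x01.
rewrite -expr2; set c' := cutoff _ _ _ in h1 *; set f := phi _ _ ^+ 2 in h2 *.
set w := (_ ^+ (2 * q.+1)) in h1 h3 *.
have f0 : 0 <= f by exact: sqr_ge0.
apply: (@le_trans _ _ ((1 - k.+2%:R * w) * f)); last by rewrite ler_wpM2r.
rewrite mulrBl mul1r lerD2l lerN2 [leRHS](_ : _ = k.+2%:R * w * 2); last by ring.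
by rewrite ler_wpM2l// mulr_ge0.
Qed.

Lemma coord_meanB n K (S1 S2 : R -> R) m i :
  coord_mean n K S1 m i - coord_mean n K S2 m i =
  K%:R / n%:R * (\sum_(l < n | cell n K m l) (S1 (design R l) - S2 (design R l)) * phi i (upt R n K m l)).
Proof.
rewrite /coord_mean -mulrBr -sumrB; congr (_ * _); apply: eq_bigr => l _.
by rewrite mulrBl.
Qed.

Lemma loss_lower (N K n : nat) (S1 S2 : R -> R) : (0 < n)%N -> (0 < K)%N -> (K <= n)%N ->
  \sum_(m < K) \sum_(i < N) (coord_mean n K S1 m i - coord_mean n K S2 m i) ^+ 2 <=
  (1 + N%:R * ((4 + 8 * pi * N%:R) * (K%:R / n%:R))) * (K%:R * empnorm2 n (fun t => S1 t - S2 t)).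
Proof.
move=> n0 K0 Kn.
set e : R := (4 + 8 * pi * N%:R) * (K%:R / n%:R).
have e0 : 0 <= e by rewrite mulr_ge0 ?divr_ge0// addr_ge0// mulr_ge0// mulr_ge0// ltW// pi_gt0.
set t : R := K%:R / n%:R; have t0 : 0 <= t by rewrite divr_ge0.
apply: (@le_trans _ _ (\sum_(m < K) (1 + N%:R * e) * (t * (\sum_(l < n | cell n K m l) (S1 (design R l) - S2 (design R l)) ^+ 2)))).
  apply: ler_sum => m _; under eq_bigr do rewrite coord_meanB.
  apply: (@approx_bessel R _ (fun l : 'I_n => cell n K m l) N (fun i l => phi i (upt R n K m l))) => // i j.
  exact: (@phi_gram R n K m N i j n0 K0 Kn (ltn_ord m) (ltn_ord i) (ltn_ord j)).
have c0 : 0 <= 1 + N%:R * e by apply: addr_ge0 => //; exact: mulr_ge0.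
rewrite -mulr_sumr ler_wpM2l// -mulr_sumr.
rewrite /empnorm2 mulrA ler_wpM2l//.
under eq_bigr do rewrite big_mkcond/=.
rewrite exchange_big/=; apply: ler_sum => l _.
rewrite -big_mkcond/= sumr_const -[leRHS]mulr1n ler_wpMn2l ?sqr_ge0//.
apply/card_le1_eqP => m m' /eqP h1 /eqP h2.
by apply: val_inj; rewrite /= -h1 -h2.
Qed.

Variables (g : R -> (R -> R) -> R) (xistar : R).
Hypothesis xi3 : 3 <= xistar.

Lemma coord_risk_sum_le_risk (N K n : nat) (Sh : n.-tuple R -> R -> R) b S (Rr : R) :
  (0 < n)%N -> (0 < K)%N -> (K <= n)%N -> @estimator R n Sh -> 0 <= b ->
  (forall m i : nat, (m < K)%N -> `|coord_mean n K S m i| <= b) ->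
  (forall l : 'I_n, 0 < g (design R l) S) ->
  (risk xistar g Sh S <= Rr%:E)%E ->
  \sum_(m < K) \sum_(i < N) coord_risk g K Sh b m i S <=
  (1 + N%:R * ((4 + 8 * pi * N%:R) * (K%:R / n%:R))) * (K%:R * Rr).
Proof.
move=> n0 K0 Kn mSh b0 tb g0 hr.
set c : R := 1 + _.
have c0 : 0 <= c.
  by rewrite addr_ge0// mulr_ge0// mulr_ge0 ?divr_ge0// addr_ge0// mulr_ge0// mulr_ge0// ltW// pi_gt0.
pose E (y : n.-tuple R) := empnorm2 n (fun t => Sh y t - S t).
have mE : measurable_fun setT E.
  apply: measurable_funM => //; apply: measurable_sum => l.
  by apply: measurable_funX; apply: measurable_funB => //; exact: mSh.
have E0 y : 0 <= E y.
  by rewrite /E /empnorm2 mulr_ge0 ?invr_ge0// sumr_ge0// => l _; exact: sqr_ge0.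
have hE : (leb_int (fun y => (reg_lik g S y * E y)%:E) <= Rr%:E)%E.
  apply: le_trans hr; rewrite /reg_lik -iid_expect_lik//.
  apply: ereal_sup_ubound; exists (normal_pdf 0 1) => //.
  exact: std_normal_noise.
rewrite -lee_fin -sumEFin.
under eq_bigr => m _.
  rewrite -sumEFin; under eq_bigr => i _ do rewrite -(coord_riskE g mSh b0 (tb m i (ltn_ord m))).
  rewrite -leb_int_sum; last 2 first.
  - by move=> i; exact: measurable_coord_risk.
  - by move=> i y; rewrite lee_fin mulr_ge0 ?reg_lik_ge0 ?sqr_ge0.
  over.
rewrite -leb_int_sum; last 2 first.
- by move=> m; apply: emeasurable_sum => i; exact: measurable_coord_risk.
- by move=> m y; apply: sume_ge0 => i _; rewrite lee_fin mulr_ge0 ?reg_lik_ge0 ?sqr_ge0.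
apply: (@le_trans _ _ (leb_int (fun y => (c * K%:R)%:E * (reg_lik g S y * E y)%:E)%E)); last first.
  have cK0 : 0 <= c * K%:R by exact: mulr_ge0.
  rewrite (leb_intZl cK0).
  - have -> : (c * (K%:R * Rr))%:E = ((c * K%:R)%:E * Rr%:E)%E by rewrite -EFinM mulrA.
    exact: lee_wpmul2l.
  - by apply/measurable_EFinP; apply: measurable_funM => //; exact: measurable_lik.
  - by move=> y; rewrite lee_fin mulr_ge0 ?reg_lik_ge0.
apply: le_leb_int.
- apply: emeasurable_sum => m; apply: emeasurable_sum => i; exact: measurable_coord_risk.
- apply: measurable_funeM; apply/measurable_EFinP; apply: measurable_funM => //; exact: measurable_lik.
- move=> y; apply: sume_ge0 => m _; apply: sume_ge0 => i _.
  by rewrite lee_fin mulr_ge0 ?reg_lik_ge0 ?sqr_ge0.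
move=> y; under eq_bigr do rewrite sumEFin; rewrite sumEFin -EFinM lee_fin.
apply: (@le_trans _ _ (reg_lik g S y * \sum_(m < K) \sum_(i < N) (coord_mean n K (Sh y) m i - coord_mean n K S m i) ^+ 2)).
  rewrite mulr_sumr; apply: ler_sum => m _; rewrite mulr_sumr; apply: ler_sum => i _.
  by rewrite ler_wpM2l ?reg_lik_ge0// clip_sqr// tb.
rewrite mulrCA ler_wpM2l ?reg_lik_ge0// -mulrA.
exact: (@loss_lower N K n (Sh y) S n0 K0 Kn).
Qed.

End Total.

(** * Continuity of the variance at zero and Riemann sums *)

Lemma bayes_total (R : realFieldType) (K N : nat) (Om : finType) (P : Om -> R)
    (F : 'I_K -> 'I_N -> Om -> R) (B : 'I_K -> 'I_N -> R) (W : pred Om) (C1 C2 pw : R) :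
  (forall om, 0 <= P om) -> \sum_om P om = 1 -> 0 <= C1 -> 0 <= C2 ->
  (forall om, W om -> \sum_m \sum_i F m i om <= C1) ->
  (forall m i om, F m i om <= C2) ->
  \sum_(om | ~~ W om) P om <= pw ->
  (forall m i, B m i <= \sum_om P om * F m i om) ->
  \sum_m \sum_i B m i <= C1 + pw * (K%:R * N%:R * C2).
Proof.
move=> P0 P1 C10 C20 hW hF hpw hB.
have KN : forall om, \sum_m \sum_i F m i om <= K%:R * N%:R * C2.
  move=> om; apply: (@le_trans _ _ (\sum_(m < K) \sum_(i < N) C2)).
    by apply: ler_sum => m _; apply: ler_sum => i _.
  by rewrite !sumr_cst_ord le_eqVlt; apply/orP; left; apply/eqP; ring.
apply: (@le_trans _ _ (\sum_om P om * (\sum_m \sum_i F m i om))).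
  apply: (@le_trans _ _ (\sum_m \sum_i \sum_om P om * F m i om)).
    by apply: ler_sum => m _; apply: ler_sum => i _.
  under eq_bigr do rewrite exchange_big/=.
  rewrite exchange_big/=; apply: ler_sum => om _.
  by rewrite mulr_sumr; apply: ler_sum => m _; rewrite mulr_sumr.
rewrite (bigID W)/=; apply: lerD.
  apply: (@le_trans _ _ (\sum_(om | W om) P om * C1)).
    by apply: ler_sum => om Wom; rewrite ler_wpM2l// hW.
  rewrite -mulr_suml ler_piMl// -P1 [leRHS](bigID W)/= lerDl.
  by apply: sumr_ge0.
apply: (@le_trans _ _ (\sum_(om | ~~ W om) P om * (K%:R * N%:R * C2))).
  by apply: ler_sum => om _; rewrite ler_wpM2l.
by rewrite -mulr_suml ler_wpM2r// !mulr_ge0.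
Qed.

Section Variance.
Variable R : realType.
Local Notation leb := (@lebesgue_measure R).
Variable v : R -> R.
Hypothesis cv : {within @I01 R, continuous v}.

Lemma I01_0 : @I01 R 0. Proof. by rewrite /I01/= in_itv/= lexx ler01. Qed.

Lemma within01_lbound : (forall x, I01 x -> 0 < v x) ->
  exists2 vmin : R, 0 < vmin & forall x, I01 x -> vmin <= v x.
Proof.
move=> v0; have [c cI hc] := EVT_min ler01 cv.
by exists (v c) => [|x xI]; [exact: v0|exact: hc].
Qed.

Lemma within01_ubound : exists vmax : R, forall x, I01 x -> v x <= vmax.
Proof.
by have [c cI hc] := EVT_max ler01 cv; exists (v c) => x xI; exact: hc.
Qed.

Lemma within01_unif (e : R) : 0 < e ->
  exists2 d : R, 0 < d & forall x y, I01 x -> I01 y -> `|x - y| < d -> `|v x - v y| <= e.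
Proof.
move=> e0; have e20 : 0 < e / 2 by rewrite divr_gt0.
have := (compact_near_coveringP (@I01 R)).1 (@segment_compact R 0 1).
move=> /(_ R (0^'+) (fun d x => I01 x -> forall y, I01 y -> `|x - y| < d -> `|v x - v y| <= e) _).
case.
  move=> x xI.
  have /cvgrPdist_le /(_ _ e20) hx := (subspace_continuousP _ _).1 cv x xI.
  have [d /= d0 hd] : \forall y \near x, I01 y -> `|v x - v y| <= e / 2.
    by move: hx; rewrite near_withinE.
  exists (ball x (d / 2), [set t | t < d / 2]) => /=.
    split; first by apply: nbhsx_ballx; rewrite divr_gt0.
    by apply: nbhs_right_lt; rewrite divr_gt0.
  move=> [x' t] /= [xx' td] x'I y yI xy.
  have h1 : `|v x - v x'| <= e / 2.
    apply: hd => //=; apply: lt_trans xx' _; lra.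
  have h2 : `|v x - v y| <= e / 2.
    apply: hd => //=.
    rewrite (le_lt_trans (ler_distD x' _ _))// [d](splitr d) ltrD//.
    exact: lt_trans td.
  rewrite (le_trans (ler_distD (v x) _ _))// [e](splitr e) lerD// distrC//.
move=> d /= d0 hd.
exists (d / 2); first by rewrite divr_gt0.
move=> x y xI yI xy; apply: (hd (d / 2)) => //=; last by rewrite divr_gt0.
by rewrite sub0r normrN gtr0_norm ?divr_gt0//; lra.
Qed.

Lemma riemann_integral (K : nat) (e : R) : (0 < K)%N -> 0 <= e ->
  (forall x, I01 x -> e <= v x) ->
  (forall x y, I01 x -> I01 y -> `|x - y| <= K%:R^-1 -> `|v x - v y| <= e) ->
  `|(\sum_(m < K) v (m%:R / K%:R)) / K%:R - fine (\int[leb]_(x in @I01 R) (v x)%:E)%E| <= e.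
Proof.
move=> K0 e0 ve vu.
have KR : 0 < K%:R :> R by rewrite ltr0n.
have mI : measurable (@I01 R) by exact: measurable_itv.
have mv : measurable_fun (@I01 R) v by exact: C01_measurable.
have sub a b : (0 <= a)%R -> (b <= 1)%R -> `]a, b] `<=` @I01 R.
  move=> a0 b1 x /=; rewrite /I01/= !in_itv/= => /andP[/ltW h1 h2].
  by rewrite (le_trans a0 h1) (le_trans h2 b1).
have piece (m : nat) : (m < K)%N ->
   (((v (m%:R / K%:R) - e) / K%:R)%:E <= \int[leb]_(x in `](m%:R / K%:R)%R, (m.+1%:R / K%:R)%R]) (v x)%:E <=
    ((v (m%:R / K%:R) + e) / K%:R)%:E)%E.
  move=> mK.
  have a0 : 0 <= m%:R / K%:R :> R by rewrite divr_ge0.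
  have b1 : m.+1%:R / K%:R <= 1 :> R by rewrite ler_pdivrMr// mul1r ler_nat.
  have ab : m%:R / K%:R < m.+1%:R / K%:R :> R by rewrite ltr_pM2r ?invr_gt0// ltr_nat.
  have aI : I01 (m%:R / K%:R : R).
    by rewrite /I01/= in_itv/= a0/= (le_trans (ltW ab)).
  have cE (c : R) : (\int[leb]_(x in `](m%:R / K%:R)%R, (m.+1%:R / K%:R)%R]) (cst c%:E) x = (c / K%:R)%:E)%E.
    rewrite integral_cst; last exact: measurable_itv.
    transitivity (c%:E * (K%:R^-1)%:E)%E => //; congr (_ * _)%E.
    have := lebesgue_measure_itv `](m%:R / K%:R : R), (m.+1%:R / K%:R)].
    rewrite /= lte_fin ab => ->; rewrite -EFinB; congr EFin.
    by rewrite -mulrBl -natr1 addrAC subrr add0r mul1r.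
  have mi : measurable [set` `](m%:R / K%:R)%R : R, (m.+1%:R / K%:R)%R]] by exact: measurable_itv.
  have hx x : [set` `](m%:R / K%:R)%R : R, (m.+1%:R / K%:R)%R]] x ->
     I01 x /\ `|v x - v (m%:R / K%:R)| <= e.
    move=> xi; have xI := sub _ _ a0 b1 _ xi; split => //; apply: vu => //.
    move: xi; rewrite /= in_itv/= => /andP[h1 h2].
    rewrite gtr0_norm ?subr_gt0// lerBlDr (le_trans h2)// -natr1 mulrDl mul1r addrC//.
  have mvi : measurable_fun [set` `](m%:R / K%:R)%R : R, (m.+1%:R / K%:R)%R]] (fun x => (v x)%:E).
    apply/measurable_EFinP; exact: (measurable_funS mI (fun x xi => (hx x xi).1) mv).
  apply/andP; split; rewrite -cE; apply: ge0_le_integral => //.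
  - by move=> x _; rewrite lee_fin subr_ge0 ve.
  - by move=> x /hx[_]; rewrite lee_fin ler_norml => /andP[h1 h2]; rewrite /cst; lra.
  - by move=> x /hx[xI _]; rewrite lee_fin (le_trans e0)// ve.
  - by move=> x /hx[_]; rewrite /cst lee_fin ler_norml => /andP[h1 h2]; lra.
have H (m : nat) : (m <= K)%N ->
   ((\sum_(i < m) (v (i%:R / K%:R) - e) / K%:R)%:E <= \int[leb]_(x in `[0%R, (m%:R / K%:R)%R]) (v x)%:E <=
    (\sum_(i < m) (v (i%:R / K%:R) + e) / K%:R)%:E)%E.
  elim: m => [_|m IH mK].
    by rewrite mul0r set_itv1 integral_set1 !big_ord0 lexx.
  have -> : [set` `[0%R : R, (m.+1%:R / K%:R)%R]] =
      [set` `[0%R : R, (m%:R / K%:R)%R]] `|` [set` `](m%:R / K%:R)%R : R, (m.+1%:R / K%:R)%R]].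
    rewrite -itv_bndbnd_setU//= ?bnd_simp ?divr_ge0//.
    by rewrite ler_pM2r ?invr_gt0// ler_nat.
  have /andP[l1 l2] := IH (ltnW mK); have /andP[l3 l4] := piece m mK.
  have b1 : m.+1%:R / K%:R <= 1 :> R by rewrite ler_pdivrMr// mul1r ler_nat.
  have UI : [set` `[0%R : R, (m%:R / K%:R)%R]] `|` [set` `](m%:R / K%:R)%R : R, (m.+1%:R / K%:R)%R]] `<=` @I01 R.
    move=> x [|]; last by apply: sub => //; rewrite divr_ge0.
    rewrite /I01/= !in_itv/= => /andP[-> h]/=.
    by rewrite (le_trans h)// ler_pdivrMr// mul1r ler_nat ltnW.
  rewrite ge0_integral_setU//; last 3 first.
  - by apply/measurable_EFinP; exact: (measurable_funS mI UI mv).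
  - by move=> x /UI xI; rewrite lee_fin (le_trans e0)// ve.
  - apply/disj_setPS => x [] /=; rewrite !in_itv/= => /andP[_ h1] /andP[h2 _].
    by have := lt_le_trans h2 h1; rewrite ltxx.
  by rewrite !big_ord_recr/= !EFinD !leeD.
have /andP[] := H K (leqnn K).
rewrite divff ?gt_eqF// -/(@I01 R) => h1 h2.
have fin : (\int[leb]_(x in @I01 R) (v x)%:E)%E \is a fin_num.
  rewrite fin_numElt (lt_le_trans (ltNyr _) h1)/=.
  by rewrite (le_lt_trans h2)// ltry.
rewrite -(fineK fin) !lee_fin in h1 h2.
have S1 : \sum_(i < K) (v (i%:R / K%:R) - e) / K%:R = (\sum_(i < K) v (i%:R / K%:R)) / K%:R - e.
  by rewrite -mulr_suml sumrB sumr_cst_ord mulrBl mulfK ?gt_eqF.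
have S2 : \sum_(i < K) (v (i%:R / K%:R) + e) / K%:R = (\sum_(i < K) v (i%:R / K%:R)) / K%:R + e.
  by rewrite -mulr_suml big_split/= sumr_cst_ord mulrDl mulfK ?gt_eqF.
rewrite S1 in h1; rewrite S2 in h2.
by rewrite ler_norml; apply/andP; split; lra.
Qed.

End Variance.

Section Gamma.
Variable R : realType.
Local Notation leb := (@lebesgue_measure R).
Variable g : R -> (R -> R) -> R.
Hypothesis adm : g_admissible g.

Lemma measurable_g2 S : L1fun S -> measurable_fun (@I01 R) (fun x => (g x S ^+ 2)%:E).
Proof.
by move=> hS; apply/measurable_EFinP; apply: measurable_funX; exact: (adm.2.2 S hS).1.
Qed.

Lemma varsigmaE S : L1fun S ->
  (\int[leb]_(x in @I01 R) (g x S ^+ 2)%:E = (varsigma g S)%:E)%E.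
Proof.
move=> hS; rewrite /varsigma fineK// ge0_fin_numE; first exact: (adm.2.2 S hS).2.
by apply: integral_ge0 => x _; rewrite lee_fin sqr_ge0.
Qed.

Lemma varsigma_ge S c : L1fun S -> 0 <= c -> (forall x, I01 x -> c <= g x S ^+ 2) -> c <= varsigma g S.
Proof.
move=> hS c0 h; rewrite -lee_fin -varsigmaE// -(integral_I01_cst c).
have mI : measurable (@I01 R) by exact: measurable_itv.
apply: ge0_le_integral => //.
exact: measurable_g2.
Qed.

Lemma varsigma_le S S' c : L1fun S -> L1fun S' -> 0 <= c ->
  (forall x, I01 x -> g x S ^+ 2 <= g x S' ^+ 2 + c) -> varsigma g S <= varsigma g S' + c.
Proof.
move=> hS hS' c0 h; rewrite -lee_fin EFinD -!varsigmaE// -(integral_I01_cst c).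
have mI : measurable (@I01 R) by exact: measurable_itv.
have mg := measurable_g2 hS'.
have g0 x : (0 <= (g x S' ^+ 2)%:E)%E by rewrite lee_fin sqr_ge0.
rewrite -ge0_integralD//.
apply: ge0_le_integral => //.
- by move=> x _; rewrite lee_fin sqr_ge0.
- exact: measurable_g2.
- by apply: emeasurable_funD.
Qed.

Variables (k : nat) (r : R).
Hypothesis r0 : 0 < r.

Lemma powR_inv_exp (x : R) p : (0 < p)%N -> 0 <= x -> (x `^ (1 / p%:R)) ^+ p = x.
Proof.
move=> p0 x0; rewrite -powR_mulrn ?powR_ge0// -powRrM mul1r mulVf ?powRr1//.
by rewrite pnatr_eq0 -lt0n.
Qed.

Lemma powR_frac_exp (x : R) p m : (0 < p)%N -> 0 <= x -> (x `^ (m%:R / p%:R)) ^+ p = x ^+ m.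
Proof.
move=> p0 x0; rewrite -powR_mulrn ?powR_ge0// -powRrM divfK ?powR_mulrn//.
by rewrite pnatr_eq0 -lt0n.
Qed.

Lemma two_k1 : 2 * k%:R + 1 = (2 * k).+1%:R :> R.
Proof. by rewrite -[RHS]natr1 natrM. Qed.

Lemma gammak_exp S : 0 <= varsigma g S -> gammak k r g S ^+ (2 * k).+1 =
  (2 * k).+1%:R * (k%:R / (pi * k.+1%:R)) ^+ (2 * k) * r * varsigma g S ^+ (2 * k).
Proof.
move=> s0; rewrite /gammak /Gammastar two_k1 -natrM (natr1 k).
have : (0 < (2 * k).+1)%N by [].
move: (2 * k).+1 (2 * k)%N => p m p0.
rewrite exprMn [X in X * _]exprMn [X in X * _ * _]exprMn.
have q0 : 0 <= k%:R / (pi * k.+1%:R) :> R by rewrite divr_ge0// mulr_ge0// ltW// pi_gt0.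
congr (_ * _ * _ * _).
- exact: powR_inv_exp.
- exact: powR_frac_exp.
- exact: powR_inv_exp p0 (ltW r0).
- exact: powR_frac_exp.
Qed.

Lemma gammak_gt0 S : (0 < k)%N -> 0 < varsigma g S -> 0 < gammak k r g S.
Proof.
move=> k0 s0; rewrite /gammak /Gammastar !mulr_gt0// powR_gt0//.
- by rewrite divr_gt0 ?ltr0n// mulr_gt0 ?pi_gt0// natr1.
Qed.

Lemma gammak_le S S' c : 1 <= c -> 0 <= varsigma g S -> 0 <= varsigma g S' ->
  varsigma g S <= c * varsigma g S' -> gammak k r g S <= c * gammak k r g S'.
Proof.
move=> c1 s0 s0' h; rewrite /gammak mulrCA ler_wpM2l ?mulr_ge0 ?powR_ge0//.
have c0 : 0 <= c by rewrite (le_trans ler01).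
set a := 2 * k%:R / _.
have a0 : 0 <= a by rewrite /a two_k1 divr_ge0// mulr_ge0.
have a1 : a <= 1 by rewrite /a two_k1 ler_pdivrMr// mul1r -natrM ler_nat.
apply: (@le_trans _ _ ((c * varsigma g S') `^ a)).
  by apply: ge0_ler_powR => //; rewrite nnegrE// mulr_ge0.
rewrite powRM// ler_wpM2r ?powR_ge0//.
by rewrite -[leRHS]powRr1// ler_powR.
Qed.

End Gamma.

Section Eventually.
Variable R : realType.

Lemma near_inv_le (a b : R) : 0 < b -> \forall K \near \oo, a / K%:R <= b.
Proof.
move=> b0; exists (Num.truncn (`|a| / b)).+1 => // K /= hK.
have K0 : 0 < K%:R :> R by rewrite ltr0n (leq_trans _ hK).
rewrite ler_pdivrMr// mulrC -ler_pdivrMr//.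
rewrite (@le_trans _ _ (`|a| / b))//; first by rewrite ler_pM2r ?invr_gt0// ler_norm.
by rewrite (le_trans (ltW (truncnS_gt _)))// ler_nat.
Qed.

Lemma near_le_nat (a : R) : \forall K \near \oo, a <= K%:R.
Proof.
exists (Num.truncn `|a|).+1 => // K /= hK; rewrite (le_trans (ler_norm a))//.
by rewrite (le_trans (ltW (truncnS_gt _)))// ler_nat.
Qed.

Lemma tp_energy_atom (k q : nat) : exists2 C : R, 0 <= C & forall N (i : 'I_N),
  energy k q k (fun i' => (i' == i)%:R) <=
  (pi * i.+1%:R) ^+ (2 * k) + C * ((pi * i.+1%:R) ^+ (2 * k) / (pi * i.+1%:R)).
Proof.
have [x x01|C C0 hC] := @tp_energy R k (cutoff_poly R q k.+1).
  rewrite cutoff_polyE exprMn sqr_sqrtr//.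
  have /andP[h0 h1] := cutoff01 q k.+1 x01.
  by rewrite -[leRHS]mulr1 ler_wpM2l// exprn_ile1.
exists C => // N i; rewrite -lee_fin -energyE.
apply: le_trans (hC i (freq R i) erefl).
rewrite le_eqVlt; apply/orP; left; apply/eqP; apply: eq_integral => x _.
rewrite (bigD1 i)//= big1 ?addr0 ?eqxx ?mul1r// => i' /negbTE ->.
by rewrite mul0r.
Qed.

End Eventually.

(** * The lower bound for fixed n and K *)

Section Fixed.
Variable R : realType.
Local Notation leb := (@lebesgue_measure R).
Variables (xistar : R) (k : nat) (r : R).
Variables (g : R -> (R -> R) -> R) (L : R -> (R -> R) -> (R -> R) -> R) (Cs : R).
Hypothesis xi3 : 3 <= xistar.
Hypothesis k0 : (0 < k)%N.
Hypothesis r0 : 0 < r.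
Hypothesis adm : g_admissible g.
Hypothesis h4 : H4 g.
Hypothesis h2 : H2 g L.
Hypothesis Cs0 : 0 < Cs.
Hypothesis h3 : forall S f x, C01 S -> C01 f -> x \in @I01 R ->
      `|L x S f| <= Cs * (`|S x * f x| + L1norm f + L2norm S * L2norm f).

Definition base_var (x : R) : R := g x (fun=> 0) ^+ 2.

Variables (q N M : nat) (u : 'I_N -> R) (eta vmin vmax rho : R).
Local Notation blkT := {ffun 'I_N -> 'I_M.+1}.
Hypothesis M0 : (0 < M)%N.
Hypothesis u0 : forall i, 0 <= u i.
Hypothesis eta0 : 0 < eta.
Hypothesis eta1 : eta <= 1 / 20.
Hypothesis vmin0 : 0 < vmin.
Hypothesis vminP : forall x, I01 x -> vmin <= base_var x.
Hypothesis vmaxP : forall x, I01 x -> base_var x <= vmax.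
Local Notation e := (eta * vmin / 8).
Hypothesis rho0 : 0 <= rho.
Hypothesis rho1 : rho <= 1.
Hypothesis hd : forall S, L1fun S -> (forall t, `|S t| <= rho) ->
  forall x, I01 x -> `|g x S ^+ 2 - base_var x| <= e.
Variables (K n : nat).
Hypothesis n0 : (0 < n)%N.
Hypothesis K0 : (0 < K)%N.
Hypothesis Kn : (K <= n)%N.
Local Notation S_ om := (@prior_fun R k q.+1 N M u base_var K n om).
Local Notation t := (K%:R / n%:R : R).
Hypothesis hu : forall x y, I01 x -> I01 y -> `|x - y| <= K%:R^-1 -> `|base_var x - base_var y| <= e.
Hypothesis hrho : forall om x, `|S_ om x| <= rho.
Hypothesis hrho2 : forall om (m : 'I_K) i (s x : R), `|s| <= `|step M u base_var K n m i| ->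
  `|S_ om x + s * bump_fun k q.+1 K m i x| <= rho.
Hypothesis hD : forall (m : 'I_K) i, 72 * (step M u base_var K n m i * Cs / (vmin / 2)) ^+ 2 <= 1.
Hypothesis hLam : vmax * (12 * (Cs / (vmin / 2)) ^+ 2 * (3 * rho ^+ 2 + K%:R^-1)) <= eta.
Hypothesis heps : (4 + 8 * pi * N%:R) * t <= eta.
Hypothesis hNeps : N%:R * ((4 + 8 * pi * N%:R) * t) <= eta.
Hypothesis hc : 2 * k.+2%:R * ((2 * q.+1 + 1)%:R^-1 +
    (2 * ((2 * q.+1)%:R * 3 ^+ (2 * q.+1) * 2) + 2 * 3 ^+ (2 * q.+1)) * t) <= 2 * eta.
Hypothesis hM : M%:R^-1 <= eta / 3.
Hypothesis hM2 : forall i, 4 * u i / M%:R * (1 + 4 * eta) <= eta / 3.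

Lemma L1fun_prior_fun om : L1fun (S_ om).
Proof. by apply: C01_L1fun; exact: C01_prior_fun. Qed.

Lemma gpos_prior_fun om (l : 'I_n) : 0 < g (design R l) (S_ om).
Proof. by apply: adm.1; [exact: design01|exact: L1fun_prior_fun]. Qed.

Lemma g2_prior_fun om x : I01 x -> `|g x (S_ om) ^+ 2 - base_var x| <= e.
Proof. by apply: hd; [exact: L1fun_prior_fun|exact: hrho]. Qed.

Lemma grid01 (m : 'I_K) : I01 (m%:R / K%:R : R).
Proof.
have KR : 0 < K%:R :> R by rewrite ltr0n.
by rewrite /I01/= in_itv/= divr_ge0//= ler_pdivrMr// mul1r ler_nat ltnW.
Qed.

Lemma den_prior_fun om om' (m : 'I_K) (l : 'I_n) : cell n K m l ->
  (1 - eta) * base_var (m%:R / K%:R) <= 2 * g (design R l) (S_ om) ^+ 2 - g (design R l) (S_ om') ^+ 2.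
Proof.
move=> c; have lI : I01 (design R l) by exact/set_mem/design01.
have := g2_prior_fun om lI; have := g2_prior_fun om' lI.
have KR : 0 < K%:R :> R by rewrite ltr0n.
have : `|base_var (design R l) - base_var (m%:R / K%:R)| <= e.
  apply: hu => //; first exact: grid01.
  have /andP[a b] := upt_cell R n0 c.
  rewrite ger0_norm ?subr_ge0.
    rewrite lerBlDr -(ler_pM2l KR) (le_trans (ltW b))//.
    by rewrite mulrDr [K%:R * (_ / _)]mulrC mulfVK ?gt_eqF// mulfV ?gt_eqF// addrC natr1.
  by rewrite ler_pdivrMr// mulrC.
rewrite !ler_norml => /andP[a1 a2] /andP[b1 b2] /andP[c1 c2].
have := ler_wpM2l (ltW eta0) (vminP (grid01 m)).
move: a1 a2 b1 b2 c1 c2; move: (base_var _) (base_var _) (g _ _ ^+ 2) (g _ _ ^+ 2) => w1 w2 w3 w4.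
have : 0 < eta * vmin by rewrite mulr_gt0.
by lra.
Qed.

Lemma chi_prior_fun om om' (m : 'I_K) (i : 'I_N) :
  S_ om = (fun x => S_ om' x + (- step M u base_var K n m i) * bump_fun k q.+1 K m i x) ->
  let a (l : 'I_n) := (g (design R l) (S_ om) ^+ 2 - g (design R l) (S_ om') ^+ 2) / g (design R l) (S_ om') ^+ 2 in
  (forall l, 2 * a l ^+ 2 <= 1) /\
  \sum_(l < n) (a l ^+ 2 + (S_ om (design R l) - S_ om' (design R l)) ^+ 2 /
     (2 * g (design R l) (S_ om') ^+ 2 - g (design R l) (S_ om) ^+ 2)) <=
  4 * u i / M%:R * (1 + 4 * eta).
Proof.
move=> SE a.
have vm0 := lt_le_trans vmin0 (vminP (grid01 m)).
have MR : 0 < M%:R :> R by rewrite ltr0n.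
have nR : 0 < n%:R :> R by rewrite ltr0n.
have KR : 0 < K%:R :> R by rewrite ltr0n.
have [] := @chi_exponent R k q.+1 N g L Cs h2 Cs0 h3 n K m i (S_ om') (S_ om)
  (- step M u base_var K n m i) rho (vmin / 2) (base_var (m%:R / K%:R)) eta n0 Kn (ltn_ord m) eta0.
- by move: eta1; lra.
- exact: C01_prior_fun.
- exact: SE.
- exact: rho0.
- exact: rho1.
- by move=> s x; rewrite normrN => sx _; exact: hrho2.
- by rewrite divr_gt0.
- move=> x /set_mem xI; have := g2_prior_fun om' xI; have := vminP xI.
  rewrite ler_norml => h /andP[h1 h2']; move: h h1 h2'; move: (base_var _) (g _ _ ^+ 2) => w1 w2.
  have : 0 < eta * vmin by rewrite mulr_gt0.
  have : eta * vmin <= vmin by rewrite ler_piMl ?(ltW vmin0)//; move: eta1; lra.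
  by lra.
- exact: vm0.
- by move=> l c; exact: den_prior_fun.
- by rewrite !mulNr sqrrN; exact: hD.
move=> ha hsum; split; first exact: ha.
apply: (le_trans hsum).
have -> : (- step M u base_var K n m i) ^+ 2 * (n%:R / K%:R) = base_var (m%:R / K%:R) * (4 * u i / M%:R).
  have vt0 : 0 <= base_var (m%:R / K%:R) * t by rewrite (mulr_ge0 (ltW vm0))// divr_ge0.
  rewrite sqrrN /step /noise_scale !exprMn exprVn !sqr_sqrtr//.
  by move: (base_var _) => w; field; rewrite !gt_eqF.
rewrite [leLHS](_ : _ = (4 * u i / M%:R) * (base_var (m%:R / K%:R) * (12 * (Cs / (vmin / 2)) ^+ 2 * (3 * rho ^+ 2 + K%:R^-1) +
   (1 + (4 + 8 * pi * N%:R) * t) / ((1 - eta) * base_var (m%:R / K%:R))))); last by ring.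
rewrite ler_wpM2l ?divr_ge0 ?mulr_ge0// mulrDr.
have c0 : 0 <= 12 * (Cs / (vmin / 2)) ^+ 2 * (3 * rho ^+ 2 + K%:R^-1).
  apply: mulr_ge0; first by apply: mulr_ge0 => //; exact: sqr_ge0.
  by apply: addr_ge0; rewrite ?invr_ge0//; apply: mulr_ge0 => //; exact: sqr_ge0.
have h1 := le_trans (ler_wpM2r c0 (vmaxP (grid01 m))) hLam.
apply: (le_trans (lerD h1 (lexx _))).
have -> : base_var (m%:R / K%:R) * ((1 + (4 + 8 * pi * N%:R) * t) / ((1 - eta) * base_var (m%:R / K%:R))) =
   (1 + (4 + 8 * pi * N%:R) * t) / (1 - eta).
  by field; rewrite !gt_eqF//; move: eta1; lra.
rewrite -lerBrDl ler_pdivrMr; last by move: eta1; lra.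
move: heps eta0 eta1; move: ((4 + 8 * pi * N%:R) * t) => ep; nra.
Qed.

Variables (Sh : n.-tuple R -> R -> R) (V pw : R).
Hypothesis mSh : estimator Sh.
Hypothesis V0 : 0 <= V.
Hypothesis hV : forall S, Wkr k r S -> 0 < gammak k r g S -> (risk xistar g Sh S <= (V * gammak k r g S)%:E)%E.
Hypothesis hpw : \sum_(om : {ffun 'I_K -> blkT} | ~~ `[< Wkr k r (S_ om) >]) prodw (@block_weight R N M) om <= pw.
Local Notation vs := (varsigma g (fun=> 0)).
Local Notation A := (\sum_(i < N) (u i / (1 + u i))).
Hypothesis hpw2 : pw * (N%:R * (64 * rho ^+ 2)) <= eta * (t * vs * A).

Lemma bayes_prior_fun (m : 'I_K) (i : 'I_N) :
  (1 - 3 * eta) ^+ 2 / ((1 + 4 * eta) * (1 + eta)) * (base_var (m%:R / K%:R) * t * (u i / (1 + u i))) <=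
  \sum_(om : {ffun 'I_K -> blkT}) prodw (@block_weight R N M) om * coord_risk g K Sh (4 * rho) m i (S_ om).
Proof.
have vm0 := lt_le_trans vmin0 (vminP (grid01 m)).
have MR : 0 < M%:R :> R by rewrite ltr0n.
have t0 : 0 <= t by rewrite divr_ge0.
have b0 : 0 <= 4 * rho by rewrite mulr_ge0.
have tb (om : {ffun 'I_K -> blkT}) : `|coord_mean n K (S_ om) m i| <= 4 * rho.
  by apply: coord_mean_bound => //; exact: hrho.
have kap0 : 0 <= 4 * u i / M%:R * (1 + 4 * eta).
  by rewrite mulr_ge0 ?divr_ge0 ?mulr_ge0// addr_ge0// mulr_ge0// ltW.
have := @bayes_coordinate R g k q.+1 N M u base_var M0 u0 n K Sh m i (4 * rho) _ mSh b0 kap0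
  (ltW vm0) tb gpos_prior_fun (fun om om' => @chi_prior_fun om om' m i).
set Z := \sum_om _; set X := 1 + _ * _; set c := coord_mean _ _ _ _ _ => hb.
have Z0 : 0 <= Z.
  apply: sumr_ge0 => om _; rewrite mulr_ge0 ?coord_risk_ge0//.
  by apply: prodw_ge0; exact: block_weight_ge0.
have hX : X <= (1 + u i) * ((1 + 4 * eta) * (1 + eta)).
  have := @kappa_bound R (u i) (1 + 4 * eta) M%:R _ (eta / 3) (u0 i) _ MR _ erefl (hM2 i).
  rewrite -/X => /(_ _ _)/le_trans; apply.
  - by move: eta0; lra.
  - by move: eta1; lra.
  rewrite ler_wpM2l ?addr_ge0// ler_pdivrMr; last by move: eta1; lra.
  rewrite -mulrA ler_wpM2l; [|by move: eta0; lra|].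
    by move: eta0; lra.
  by move: hM eta0 eta1; move: (M%:R^-1) => w; nra.
have hc' : 1 - 3 * eta <= c.
  have := @coord_mean_bump_fun_ge R k q N K n m i n0 Kn (ltn_ord m).
  rewrite -/c; apply: le_trans.
  by move: hc heps; lra.
have c2 : (1 - 3 * eta) ^+ 2 <= c ^+ 2.
  by rewrite lerXn2r ?nnegrE//; [move: eta1; lra|apply: le_trans hc'; move: eta1; lra].
have u1 : 0 < 1 + u i by rewrite ltr_wpDr.
have D0 : 0 < (1 + 4 * eta) * (1 + eta) by move: eta0; nra.
rewrite -(ler_pM2r (mulr_gt0 u1 D0)).
apply: (@le_trans _ _ (Z * X)); last by rewrite ler_wpM2l.
apply: le_trans hb.
rewrite [leLHS](_ : _ = base_var (m%:R / K%:R) * t * u i * (1 - 3 * eta) ^+ 2).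
  by rewrite ler_wpM2l// (mulr_ge0 (mulr_ge0 (ltW vm0) t0) (u0 i)).
by move: (base_var _) t => w tt; field; rewrite !gt_eqF//; move: eta0; lra.
Qed.

Lemma fixed_lower : t * vs * A * (1 - 20 * eta) <= V * gammak k r g (fun=> 0).
Proof.
have KR : 0 < K%:R :> R by rewrite ltr0n.
have nR : 0 < n%:R :> R by rewrite ltr0n.
have t0 : 0 < t by rewrite divr_gt0.
have z1 : L1fun (fun=> 0 : R) by apply: C01_L1fun; exact: C01_cst.
have A0 : 0 <= A by apply: sumr_ge0 => i _; rewrite divr_ge0// addr_ge0.
have e0 : 0 < e by rewrite divr_gt0// mulr_gt0.
have ev : e <= vmin / 2.
  have : eta * vmin <= vmin by rewrite ler_piMl ?(ltW vmin0)//; move: eta1; lra.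
  by lra.
have vs0 : vmin <= vs by apply: varsigma_ge => //; rewrite ltW.
have vsp : 0 < vs by exact: lt_le_trans vs0.
have evs : e <= eta * vs.
  have := ler_wpM2l (ltW eta0) vs0.
  by move: e0; lra.
set g0 := gammak k r g (fun=> 0).
have gam om : gammak k r g (S_ om) <= (1 + eta) * g0.
  apply: gammak_le; rewrite ?(ltW vsp)//; first by rewrite lerDl ltW.
    by rewrite /varsigma fine_ge0// integral_ge0// => x _; rewrite lee_fin sqr_ge0.
  apply: (@le_trans _ _ (vs + e)); last by rewrite mulrDl mul1r lerD2l.
  apply: varsigma_le => //; [exact: L1fun_prior_fun|exact: ltW|].
  by move=> x xI; have := g2_prior_fun om xI; rewrite ler_norml -/(base_var x) => /andP[_]; lra.
have g00 : 0 < g0 by exact: gammak_gt0.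
have gS om : 0 < gammak k r g (S_ om).
  apply: gammak_gt0 => //; apply: (@lt_le_trans _ _ (vmin / 2)); first by rewrite divr_gt0.
  apply: varsigma_ge => //; [exact: L1fun_prior_fun|by rewrite ltW// divr_gt0|].
  move=> x xI; have := g2_prior_fun om xI; have := vminP xI; rewrite ler_norml => h /andP[h1 _].
  by move: h h1 ev; move: (base_var _) (g _ _ ^+ 2) => w1 w2; lra.
set th := (1 - 3 * eta) ^+ 2 / ((1 + 4 * eta) * (1 + eta)).
have vg0 : 0 <= (1 + eta) * g0.
  by apply: mulr_ge0 (ltW g00); rewrite addr_ge0// ltW.
have e10 : 0 <= 1 + eta by rewrite addr_ge0// ltW.
pose C1 := (1 + eta) * (K%:R * (V * ((1 + eta) * g0))).
have b0 : 0 <= 4 * rho by rewrite mulr_ge0.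
have P0 (om : {ffun 'I_K -> blkT}) : 0 <= prodw (@block_weight R N M) om.
  by apply: prodw_ge0; exact: block_weight_ge0.
have C10 : 0 <= C1.
  by rewrite /C1; do 2![apply: mulr_ge0 => //]; exact: mulr_ge0.
have C20 : 0 <= 4 * (4 * rho) ^+ 2 by rewrite mulr_ge0// sqr_ge0.
have tb om (m i : nat) : (m < K)%N -> `|coord_mean n K (S_ om) m i| <= 4 * rho.
  by move=> mK; apply: coord_mean_bound => //; exact: hrho.
have hW om : `[< Wkr k r (S_ om) >] -> \sum_(m < K) \sum_(i < N) coord_risk g K Sh (4 * rho) m i (S_ om) <= C1.
  move=> /asboolP W.
  have hr : (risk xistar g Sh (S_ om) <= (V * ((1 + eta) * g0))%:E)%E.
    by apply: (le_trans (hV W (gS om))); rewrite lee_fin ler_wpM2l.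
  apply: (le_trans (@coord_risk_sum_le_risk R g xistar xi3 N K n Sh (4 * rho) (S_ om) _ n0 K0 Kn mSh b0 (tb om) (gpos_prior_fun om) hr)).
  rewrite /C1 ler_wpM2r//; last by rewrite lerD2l.
  by apply: mulr_ge0 => //; exact: mulr_ge0.
have := @bayes_total R K N _ (prodw (@block_weight R N M))
  (fun m i om => coord_risk g K Sh (4 * rho) m i (S_ om))
  (fun m i => th * (base_var (m%:R / K%:R) * t * (u i / (1 + u i))))
  (fun om => `[< Wkr k r (S_ om) >]) C1 (4 * (4 * rho) ^+ 2) pw
  P0 (prodw_sum _ (@block_weight_sum R N M)) C10 C20 hW
  (fun m i om => coord_risk_bound g mSh b0 (tb om m i (ltn_ord m))) hpw bayes_prior_fun.
have -> : \sum_(m < K) \sum_(i < N) th * (base_var (m%:R / K%:R) * t * (u i / (1 + u i))) =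
   th * t * A * (\sum_(m < K) base_var (m%:R / K%:R)).
  rewrite [RHS]mulr_sumr; apply: eq_bigr => m _.
  transitivity (th * (base_var (m%:R / K%:R) * t) * A); last by ring.
  by rewrite mulr_sumr; apply: eq_bigr => i _; ring.
have vle x : I01 x -> e <= base_var x by move=> /vminP; move: ev; lra.
have := @riemann_integral R base_var h4.1 K e K0 (ltW e0) vle hu.
rewrite -/vs ler_norml => /andP[+ _]; rewrite lerBrDr ler_pdivlMr//.
set Sv := \sum_(m < K) _ => hSv hmain.
have {}hSv : (1 - eta) * vs * K%:R <= Sv.
  by apply: le_trans hSv; rewrite ler_wpM2r//; move: evs; lra.
have D0 : 0 < (1 + 4 * eta) * (1 + eta) by move: eta0; nra.
have th0 : 0 <= th by rewrite divr_ge0 ?sqr_ge0// ltW.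
have th1 : 1 - 11 * eta <= th.
  by rewrite ler_pdivlMr//; move: eta0 eta1; nra.
set Y := t * vs * A.
have Y0 : 0 <= Y by apply: mulr_ge0 A0; apply: mulr_ge0 (ltW t0) (ltW vsp).
have step1 : th * (1 - eta) * Y <= (1 + eta) ^+ 2 * (V * g0) + eta * Y.
  rewrite -(ler_pM2r KR).
  apply: (@le_trans _ _ (th * t * A * Sv)).
    rewrite [leLHS](_ : _ = th * t * A * ((1 - eta) * vs * K%:R)); last by rewrite /Y; ring.
    by apply: ler_wpM2l hSv; apply: mulr_ge0 A0; exact: mulr_ge0 (ltW t0).
  apply: (le_trans hmain); rewrite [leRHS]mulrDl; apply: lerD.
    by rewrite /C1 le_eqVlt; apply/orP; left; apply/eqP; ring.
  rewrite [leLHS](_ : _ = pw * (N%:R * (64 * rho ^+ 2)) * K%:R); last by ring.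
  by rewrite ler_wpM2r.
have step2 : (1 - 13 * eta) * Y <= th * (1 - eta) * Y - eta * Y.
  rewrite -mulrBl; apply: ler_wpM2r => //.
  by move: th1 eta0 eta1 => H1 H2 H3; have := ler_wpM2r (_ : 0 <= 1 - eta) H1; nra.
have e2 : 0 < (1 + eta) ^+ 2 by rewrite exprn_gt0// ltr_pwDl// ltW.
rewrite -(ler_pM2l e2); apply: (@le_trans _ _ ((1 - 13 * eta) * Y)); last by move: step1 step2; lra.
rewrite mulrCA mulrC; apply: ler_wpM2r => //.
by move: eta0 eta1; nra.
Qed.

End Fixed.

(** * Asymptotics *)

Section Asymptotic.
Variable R : realType.
Variables (xistar : R) (k : nat) (r : R).
Variables (g : R -> (R -> R) -> R) (L : R -> (R -> R) -> (R -> R) -> R).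
Hypothesis xi3 : 3 <= xistar.
Hypothesis k0 : (0 < k)%N.
Hypothesis r0 : 0 < r.
Hypothesis adm : g_admissible g.
Hypothesis h2 : H2 g L.
Hypothesis h3 : H3 L.
Hypothesis h4 : H4 g.
Local Notation vs := (varsigma g (fun=> 0)).
Local Notation g0 := (gammak k r g (fun=> 0)).
Local Notation p := (2 * k).+1.

Lemma L1fun0 : L1fun (fun=> 0 : R).
Proof. by apply: C01_L1fun; exact: C01_cst. Qed.

Lemma base_var_gt0 x : I01 x -> 0 < base_var g x.
Proof. by move=> xI; rewrite exprn_gt0// adm.1//; [exact/mem_set|exact: L1fun0]. Qed.

Lemma varsigma0_gt0 : 0 < vs.
Proof.
have [vmin vm0 hv] := within01_lbound h4.1 base_var_gt0.
by apply: (lt_le_trans vm0); apply: varsigma_ge => //; [exact: L1fun0|exact: ltW].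
Qed.

Lemma asymptotic_lower (eta : R) : 0 < eta -> eta <= 1 / 20 ->
  exists alpha A : R, [/\ 0 < alpha, 0 < A,
    (1 - eta) ^+ p * (1 - eta) ^+ 2 * g0 ^+ p <= (vs * A) ^+ p * alpha &
    \forall K \near \oo, forall n, (0 < n)%N -> K%:R ^+ p <= alpha * n%:R ->
      forall Sh : n.-tuple R -> R -> R, estimator Sh -> forall V : R, 0 <= V ->
      (forall S, Wkr k r S -> 0 < gammak k r g S -> (risk xistar g Sh S <= (V * gammak k r g S)%:E)%E) ->
      K%:R / n%:R * vs * A * (1 - 20 * eta) <= V * g0].
Proof.
move=> eta0 eta1.
have e1 : eta < 1 by move: eta1; lra.
have vs0 := varsigma0_gt0.
have [Cs [Cs0 h3']] := h3.
have [vmin vmin0 vminP] := within01_lbound h4.1 base_var_gt0.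
have [vmax vmaxP] := within01_ubound h4.1.
have vmax0 : 0 <= vmax.
  by rewrite (le_trans (ltW vmin0))// (le_trans (vminP _ (@I01_0 R)))// vmaxP//; exact: I01_0.
set e := eta * vmin / 8.
have e0 : 0 < e by rewrite divr_gt0// mulr_gt0.
have ev : e <= vmin / 8 by rewrite ler_wpM2r// ler_piMl// ltW.
have vmvs : vmin <= vs by apply: varsigma_ge => //; [exact: L1fun0|exact: ltW].
have evs : e <= eta * vs.
  by have := ler_wpM2l (ltW eta0) vmvs; move: e0; rewrite /e; lra.
have [del [del0 hdel]] := h4.2 _ e0.
have [d d0 hd] := within01_unif h4.1 e0.
set q := Num.truncn (2 * k.+2%:R / eta).
have hq : 2 * k.+2%:R * (2 * q.+1 + 1)%:R^-1 <= eta.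
  rewrite ler_pdivrMr ?ltr0n ?addn1// [leRHS]mulrC -ler_pdivrMr//.
  rewrite (le_trans (ltW (truncnS_gt _)))// ler_nat -/q.
  by rewrite ltnW// ltnS leq_pmull.
have [C C0 hC] := @tp_energy_atom R k q.+1.
have [N [N1 A0 hA]] := pinsker_choice k0 C0 eta0 e1.
pose u (i : 'I_N) : R := pinsker_u R k N i.
have u0 i : 0 <= u i by exact: pinsker_u_ge0.
set A := \sum_(i < N) _ in A0 hA.
set B := \sum_(i < N) _ in hA.
have B0 : 0 <= B.
  apply: sumr_ge0 => i _; rewrite mulr_ge0 ?pinsker_u_ge0//.
  have pi0 : 0 <= pi * i.+1%:R :> R by rewrite mulr_ge0// ltW// pi_gt0.
  by rewrite addr_ge0 ?exprn_ge0// mulr_ge0// divr_ge0// exprn_ge0.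
set Gp := (2 * k).+1%:R * (k%:R / (pi * k.+1%:R)) ^+ (2 * k) in hA.
have Gp0 : 0 < Gp.
  by rewrite mulr_gt0// exprn_gt0// divr_gt0 ?ltr0n// mulr_gt0 ?pi_gt0.
have x10 : 0 < 1 - eta by rewrite subr_gt0.
have e11 : 0 <= 1 + eta by rewrite addr_ge0// ltW.
have e41 : 0 <= 1 + 4 * eta by rewrite addr_ge0// mulr_ge0// ltW.
have e12 : (1 + eta) * (1 - eta) <= 1 by have := sqr_ge0 eta; lra.
have evle x : I01 x -> e <= base_var g x by rewrite /base_var => /vminP; move: ev vmin0; lra.
have dd : d / 2 < d by move: d0; lra.
pose alpha := (1 - eta) ^+ 2 * r * ((1 - eta) ^+ p * Gp) / (vs * A ^+ p).
have alpha0 : 0 < alpha.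
  apply: divr_gt0; last by apply: mulr_gt0 => //; exact: exprn_gt0.
  by apply: mulr_gt0; apply: mulr_gt0 => //; exact: exprn_gt0.
have alphaB : alpha * vs * B <= (1 - eta) ^+ 2 * r.
  rewrite [leLHS](_ : _ = (1 - eta) ^+ 2 * r * ((1 - eta) ^+ p * (Gp * B) / A ^+ p)).
    apply: ler_piMr; first by apply: mulr_ge0 (ltW r0); exact: sqr_ge0.
    by rewrite ler_pdivrMr ?mul1r//; exact: exprn_gt0.
  have : A ^+ p != 0 by rewrite gt_eqF// exprn_gt0.
  rewrite /alpha; move: (A ^+ p) ((1 - eta) ^+ p) => a b a0.
  by field; rewrite a0 gt_eqF.
set U : R := \sum_i u i.
have uU i : u i <= U.
  by rewrite /U (bigD1 i)//= lerDl; apply: sumr_ge0 => j _; exact: u0.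
have U0 : 0 <= U by apply: sumr_ge0 => j _; exact: u0.
have [M [M0 hM hM2]] : exists M : nat, [/\ (0 < M)%N, M%:R^-1 <= eta / 3 &
    4 * U * (1 + 4 * eta) / M%:R <= eta / 3].
  have eta30 : 0 < eta / 3 by rewrite divr_gt0.
  near \oo => M; exists M; split.
  - near: M; exact: nbhs_infty_gt.
  - rewrite -div1r; near: M; exact: near_inv_le.
  - near: M; exact: near_inv_le.
have MR : 0 < M%:R :> R by rewrite ltr0n.
pose blkT : finType := {ffun 'I_N -> 'I_M.+1}.
pose C0b : R := \sum_(b : blkT) \sum_i `|block_coef u b i|.
have hC0b (b : blkT) i : `|block_coef u b i| <= C0b.
  rewrite /C0b (bigD1 b)//= (bigD1 i)//= -addrA lerDl addr_ge0 ?sumr_ge0// => *.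
  by rewrite sumr_ge0.
have C0b0 : 0 <= C0b by do 2!(apply: sumr_ge0 => ? _).
pose stp : R := Num.sqrt U * (2 / Num.sqrt M%:R).
have stp0 : 0 <= stp by rewrite mulr_ge0 ?divr_ge0 ?sqrtr_ge0.
pose Crho := N%:R * (C0b * 2) + stp * (N%:R * 2).
have Crho0 : 0 <= Crho by rewrite addr_ge0 ?mulr_ge0.
have [C4 C40 hprob] := @prob_notWkr R k q.+1 N M u (base_var g) M0 u0 alpha vmax eta r
  (ltW alpha0) vmax0 eta0 r0.
set eps : R := 4 + 8 * pi * N%:R.
have eps0 : 0 <= eps by rewrite addr_ge0// !mulr_ge0// ltW// pi_gt0.
set Cq : R := 2 * ((2 * q.+1)%:R * 3 ^+ (2 * q.+1) * 2) + 2 * 3 ^+ (2 * q.+1).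
have Cq0 : 0 <= Cq by rewrite addr_ge0 ?mulr_ge0 ?exprn_ge0.
set Cv : R := Cs / (vmin / 2).
have del20 : 0 < del ^+ 2 by rewrite exprn_gt0.
have vsA0 : 0 < eta * (vs * A) by rewrite !mulr_gt0.
have d20 : 0 < d / 2 by rewrite divr_gt0.
exists alpha, A; split => //.
  rewrite gammak_exp ?(ltW vs0)// -/Gp exprMn [vs ^+ p]exprS /alpha.
  rewrite le_eqVlt; apply/orP; left; apply/eqP.
  have : A ^+ p != 0 by rewrite gt_eqF// exprn_gt0.
  move: (A ^+ p) ((1 - eta) ^+ p) (vs ^+ (2 * k)) => a b c a0.
  by field; rewrite a0 gt_eqF.
near=> K => n n0 Kn Sh mSh V V0 hV.
have K0 : (0 < K)%N by near: K; exact: nbhs_infty_gt.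
have KR : 0 < K%:R :> R by rewrite ltr0n.
have nR : 0 < n%:R :> R by rewrite ltr0n.
have K1 : 1 <= K%:R :> R by rewrite ler1n.
set t : R := K%:R / n%:R.
have t0 : 0 < t by rewrite divr_gt0.
have tK : t <= alpha / K%:R.
  rewrite /t ler_pdivlMr// mulrAC ler_pdivrMr//; apply: le_trans Kn.
  by rewrite -expr2; apply: ler_weXn2l => //; rewrite mul2n ltnS -addnn addn_gt0 k0.
have tb (c b : R) : 0 <= c -> c * alpha / K%:R <= b -> c * t <= b.
  move=> c0; apply: le_trans; rewrite -mulrA; exact: ler_wpM2l.
have t1 : t <= 1.
  have := @tb 1 1 ler01; rewrite !mul1r; apply; near: K; exact: near_inv_le.
have KnN : (K <= n)%N by move: t1; rewrite /t ler_pdivrMr// mul1r ler_nat.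
pose smax : R := Num.sqrt (vmax * t).
have smax0 : 0 <= smax by exact: sqrtr_ge0.
pose rho := smax * Crho.
have rho0 : 0 <= rho by exact: mulr_ge0.
have rho2 : rho ^+ 2 = vmax * Crho ^+ 2 * t.
  rewrite /rho exprMn sqr_sqrtr; first by ring.
  by rewrite mulr_ge0// ltW.
have cr0 : 0 <= vmax * Crho ^+ 2 by rewrite mulr_ge0// sqr_ge0.
have rho1 : rho <= 1.
  rewrite -(@ler_pXn2r _ 2)// ?nnegrE// expr1n rho2; apply: tb => //.
  near: K; exact: near_inv_le.
have rhod : rho <= del.
  rewrite -(@ler_pXn2r _ 2)// ?nnegrE ?(ltW del0)// rho2; apply: tb => //.
  near: K; exact: near_inv_le.
have mI (m : 'I_K) : I01 (m%:R / K%:R : R).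
  by rewrite /I01/= in_itv/= divr_ge0//= ler_pdivrMr// mul1r ler_nat ltnW.
have hse m : (m < K)%N -> noise_scale (base_var g) K n m <= smax.
  move=> mK; rewrite ler_sqrt; last by rewrite mulr_ge0// ltW.
  exact: (ler_wpM2r (ltW t0) (vmaxP _ (mI (Ordinal mK)))).
have hstep (m : 'I_K) i : `|step M u (base_var g) K n m i| <= smax * stp.
  rewrite ger0_norm; last by rewrite mulr_ge0 ?sqrtr_ge0// mulr_ge0 ?sqrtr_ge0// divr_ge0 ?sqrtr_ge0.
  apply: ler_pM; rewrite ?sqrtr_ge0// ?hse//.
  by apply: ler_wpM2r; rewrite ?divr_ge0 ?sqrtr_ge0// ler_sqrt.
have hSo om x : `|@prior_fun R k q.+1 N M u (base_var g) K n om x| <= N%:R * (smax * C0b * 2).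
  exact: prior_fun_bound.
have hrho om x : `|@prior_fun R k q.+1 N M u (base_var g) K n om x| <= rho.
  apply: (le_trans (hSo om x)); rewrite /rho /Crho.
  rewrite [leLHS](_ : _ = smax * (N%:R * (C0b * 2))); last by ring.
  rewrite ler_wpM2l// lerDl; apply: mulr_ge0 => //; exact: mulr_ge0.
have hrho2 om (m : 'I_K) i (s x : R) : `|s| <= `|step M u (base_var g) K n m i| ->
    `|@prior_fun R k q.+1 N M u (base_var g) K n om x + s * bump_fun k q.+1 K m i x| <= rho.
  move=> hs; apply: (le_trans (ler_normD _ _)); rewrite /rho /Crho [leRHS]mulrDr; apply: lerD.
    by apply: (le_trans (hSo om x)); rewrite le_eqVlt; apply/orP; left; apply/eqP; ring.
  rewrite normrM mulrA; apply: ler_pM => //; first exact: le_trans (hstep m i).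
  exact: bump_fun_bound.
have hdS S : L1fun S -> (forall x, `|S x| <= rho) -> forall x, I01 x -> `|g x S ^+ 2 - base_var g x| <= e.
  move=> hS Sr x xI; apply: hdel => //; first exact/mem_set.
  by move=> y _; exact: le_trans rhod.
have hu x y : I01 x -> I01 y -> `|x - y| <= K%:R^-1 -> `|base_var g x - base_var g y| <= e.
  move=> xI yI xy; apply: hd => //; apply: (le_lt_trans xy).
  apply: le_lt_trans dd.
  by rewrite -div1r; near: K; exact: near_inv_le.
have hD (m : 'I_K) i : 72 * (step M u (base_var g) K n m i * Cs / (vmin / 2)) ^+ 2 <= 1.
  have st2 : step M u (base_var g) K n m i ^+ 2 <= vmax * stp ^+ 2 * t.
    rewrite -[leLHS](real_normK (num_real _)).
    apply: (@le_trans _ _ ((smax * stp) ^+ 2)).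
      by rewrite lerXn2r ?nnegrE ?mulr_ge0.
    by rewrite exprMn sqr_sqrtr ?mulr_ge0 ?(ltW t0)// mulrAC.
  rewrite -mulrA exprMn -/Cv.
  apply: (@le_trans _ _ (72 * (vmax * stp ^+ 2 * t * Cv ^+ 2))).
    by rewrite ler_wpM2l// ler_wpM2r ?sqr_ge0.
  rewrite [leLHS](_ : _ = 72 * (vmax * stp ^+ 2 * Cv ^+ 2) * t); last by ring.
  apply: tb; first by rewrite mulr_ge0// mulr_ge0 ?sqr_ge0// mulr_ge0 ?sqr_ge0.
  near: K; exact: near_inv_le.
have hLam : vmax * (12 * Cv ^+ 2 * (3 * rho ^+ 2 + K%:R^-1)) <= eta.
  apply: (@le_trans _ _ (vmax * (12 * Cv ^+ 2 * (3 * (vmax * Crho ^+ 2 * alpha) + 1)) / K%:R)); last first.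
    near: K; exact: near_inv_le.
  rewrite rho2 [leRHS](_ : _ = vmax * (12 * Cv ^+ 2 * (3 * (vmax * Crho ^+ 2 * (alpha / K%:R)) + K%:R^-1))); last by ring.
  rewrite ler_wpM2l// ler_wpM2l; [|by rewrite mulr_ge0 ?sqr_ge0|].
    by [].
  by rewrite lerD2r ler_wpM2l// ler_wpM2l.
have heps : eps * t <= eta by apply: tb => //; near: K; exact: near_inv_le.
have hNeps : N%:R * (eps * t) <= eta.
  by rewrite mulrA; apply: tb; [exact: mulr_ge0|near: K; exact: near_inv_le].
have hc : 2 * k.+2%:R * ((2 * q.+1 + 1)%:R^-1 + Cq * t) <= 2 * eta.
  rewrite mulrDr (_ : 2 * eta = eta + eta); last by ring.
  apply: lerD => //; rewrite mulrA; apply: tb; first by rewrite !mulr_ge0.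
  near: K; exact: near_inv_le.
have hM2' i : 4 * u i / M%:R * (1 + 4 * eta) <= eta / 3.
  apply: le_trans hM2; rewrite mulrAC ler_wpM2r ?invr_ge0//.
  by rewrite ler_wpM2r// ler_wpM2l.
have hvm m : (m < K)%N -> 0 <= base_var g (m%:R / K%:R) <= vmax.
  move=> mK; apply/andP; split; [exact: le_trans (ltW vmin0) (vminP _ (mI (Ordinal mK)))|exact: vmaxP _ (mI (Ordinal mK))].
have hmean : alpha * ((\sum_(m < K) base_var g (m%:R / K%:R)) / K%:R) *
    (\sum_i u i * energy k q.+1 k (fun i' => (i' == i)%:R)) <= (1 - eta) * r.
  have := riemann_integral h4.1 K0 (ltW e0) evle hu.
  rewrite ler_norml => /andP[_]; rewrite lerBlDl => hS.
  have {}hS : (\sum_(m < K) base_var g (m%:R / K%:R)) / K%:R <= (1 + eta) * vs.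
    by apply: (le_trans hS); rewrite mulrDl mul1r lerD2l.
  have Sv0 : 0 <= (\sum_(m < K) base_var g (m%:R / K%:R)) / K%:R.
    by rewrite divr_ge0//; apply: sumr_ge0 => m _; have /andP[] := hvm m (ltn_ord m).
  apply: (@le_trans _ _ (alpha * ((1 + eta) * vs) * B)).
    apply: ler_pM.
    - by apply: mulr_ge0 Sv0; exact: ltW.
    - by apply: sumr_ge0 => i _; rewrite mulr_ge0 ?energy_ge0.
    - by apply: ler_wpM2l hS; exact: ltW.
    - by apply: ler_sum => i _; rewrite ler_wpM2l// hC.
  rewrite [leLHS](_ : _ = (1 + eta) * (alpha * vs * B)); last by ring.
  apply: (le_trans (ler_wpM2l e11 alphaB)).
  rewrite [leLHS](_ : _ = ((1 + eta) * (1 - eta)) * ((1 - eta) * r)); last by ring.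
  by apply: ler_piMl => //; exact: mulr_ge0 (ltW x10) (ltW r0).
have CK : C4 <= K%:R by near: K; exact: near_le_nat.
have hpw := hprob K n K0 n0 Kn hvm hmean CK.
have hpw2 : C4 / K%:R * (N%:R * (64 * rho ^+ 2)) <= eta * (t * vs * A).
  rewrite rho2 [leLHS](_ : _ = C4 * (N%:R * (64 * (vmax * Crho ^+ 2))) / K%:R * t); last by ring.
  rewrite [leRHS](_ : _ = eta * (vs * A) * t); last by ring.
  rewrite ler_wpM2r ?(ltW t0)//.
  near: K; exact: near_inv_le.
exact: (@fixed_lower R xistar k r g L Cs xi3 k0 r0 adm h4 h2 Cs0 h3' q N M u eta vmin vmax rho
  M0 u0 eta0 eta1 vmin0 vminP vmaxP rho0 rho1 hdS K n n0 K0 KnN hu hrho hrho2 hD hLam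
  heps hNeps hc hM hM2' Sh V (C4 / K%:R) mSh V0 hV hpw hpw2).
Unshelve. all: by end_near.
Qed.

End Asymptotic.

Section Final.
Variable R : realType.

Lemma bernoulli_le (y : R) (n : nat) : 0 <= y <= 1 -> 1 - n%:R * y <= (1 - y) ^+ n.
Proof.
move=> /andP[y0 y1]; elim: n => [|n IH]; first by rewrite mul0r subr0 expr0.
rewrite exprS; apply: le_trans (ler_wpM2l _ IH); last by rewrite subr_ge0.
rewrite -subr_ge0 -natr1 (_ : _ - _ = n%:R * y ^+ 2); last by ring.
by rewrite mulr_ge0// sqr_ge0.
Qed.

Lemma largest_power (p : nat) (x eta : R) (K1 : nat) : (0 < p)%N -> 0 <= eta -> eta <= 1 ->
  p%:R <= eta * K1%:R -> K1%:R ^+ p <= x ->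
  exists K : nat, [/\ (K1 <= K)%N, K%:R ^+ p <= x & (1 - eta) * x <= K%:R ^+ p].
Proof.
move=> p0 eta0 eta1 hp hx.
have x0 : 0 <= x by apply: le_trans hx; exact: exprn_ge0.
set y := x `^ (1 / p%:R).
have yx : y ^+ p = x by exact: powR_inv_exp.
have y0 : 0 <= y by exact: powR_ge0.
have /andP[h1 h2] := truncn_itv y0.
set K := Num.truncn y in h1 h2.
have K1y : K1%:R <= y by rewrite -(@ler_pXn2r _ p)// ?nnegrE// yx.
have K1K : (K1 <= K)%N by rewrite -ltnS -(ltr_nat R) (le_lt_trans K1y).
exists K; split => //; first by rewrite -yx lerXn2r ?nnegrE.
have S0 : 0 < K.+1%:R :> R by rewrite ltr0n.
have : x <= K.+1%:R ^+ p by rewrite -yx lerXn2r ?nnegrE// ltW.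
move=> xK; apply: (le_trans (ler_wpM2l _ xK)); first by rewrite subr_ge0.
have -> : K%:R = K.+1%:R * (1 - K.+1%:R^-1) :> R.
  by rewrite mulrBr mulr1 mulfV ?gt_eqF// -natr1 addrK.
rewrite exprMn mulrC ler_wpM2l ?exprn_ge0//.
have S1 : (0 <= K.+1%:R^-1 :> R) && (K.+1%:R^-1 <= 1 :> R).
  by rewrite invr_ge0 ler0n invf_le1 ?ler1n.
apply: le_trans (bernoulli_le p S1).
rewrite lerD2l lerN2 ler_pdivrMr// (le_trans hp)// ler_wpM2l// ler_nat ltnW//.
Qed.

Lemma le_limn_einf (f : nat -> \bar R) (c : R) :
  (\forall n \near \oo, (c%:E <= f n)%E) -> (c%:E <= limn_einf f)%E.
Proof.
move=> [n0 _ h]; rewrite limn_einf_lim.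
rewrite (cvg_lim _ (ereal_nondecreasing_cvgn (@nondecreasing_einfs R f)))//.
apply: ereal_sup_ge; exists (einfs f n0); first by exists n0.
apply: le_ereal_inf_tmp => _ [m /= nm <-]; exact: h.
Qed.

Lemma power_compare (p : nat) (eta e A vs alpha g0 W t m : R) : (3 <= p)%N ->
  0 < eta -> eta <= 1 / 20 -> 24 * eta < e -> e < 1 -> 0 < A -> 0 < vs -> 0 < alpha -> 0 < g0 ->
  0 <= t -> 0 < m -> W ^+ p * m = (1 - e) ^+ p -> 0 <= W ->
  (1 - eta) * alpha <= t ^+ p * m ->
  (1 - eta) ^+ p * (1 - eta) ^+ 2 * g0 ^+ p <= (vs * A) ^+ p * alpha ->
  W * g0 < t * vs * A * (1 - 20 * eta).
Proof.
move=> p3 eta0 eta1 he e1 A0 vs0 al0 g00 t0 m0 WE W0 ht hA.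
have p0 : (0 < p)%N by exact: leq_trans p3.
have x0 : 0 <= 1 - 20 * eta by move: eta1; lra.
have x1 : 0 <= 1 - eta by move: eta1; lra.
have x1' : 1 - eta <= 1 by move: eta0; lra.
rewrite ltNge; apply/negP => hle.
have {}hle : (t * vs * A * (1 - 20 * eta)) ^+ p * m <= (W * g0) ^+ p * m.
  rewrite ler_wpM2r ?(ltW m0)// lerXn2r ?nnegrE//.
    by apply: mulr_ge0 x0; apply: mulr_ge0 (ltW A0); exact: mulr_ge0 (ltW vs0).
  by apply: mulr_ge0 (ltW g00).
have gp : 0 < g0 ^+ p by exact: exprn_gt0.
have : ((1 - eta) ^+ 4 * (1 - 20 * eta)) ^+ p * g0 ^+ p <= (1 - e) ^+ p * g0 ^+ p.
  apply: (@le_trans _ _ ((t * vs * A * (1 - 20 * eta)) ^+ p * m)); last first.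
    by apply: (le_trans hle); rewrite exprMn mulrAC WE.
  have -> : (t * vs * A * (1 - 20 * eta)) ^+ p * m = (t ^+ p * m) * (vs * A) ^+ p * (1 - 20 * eta) ^+ p.
    by rewrite !exprMn; ring.
  rewrite exprMn mulrAC ler_wpM2r ?exprn_ge0//.
  apply: (@le_trans _ _ ((1 - eta) * ((1 - eta) ^+ p * (1 - eta) ^+ 2 * g0 ^+ p))).
    rewrite -exprM -exprD mulrA -exprS ler_wpM2r ?(ltW gp)//.
    apply: ler_wiXn2l => //.
    by rewrite addn2 -[4%N]/(1 + 3)%N mulnDl mul1n -addn3 leq_add2l (leq_trans p3)// leq_pmull.
  apply: (@le_trans _ _ ((1 - eta) * ((vs * A) ^+ p * alpha))); first by rewrite ler_wpM2l.
  rewrite mulrCA mulrC; apply: ler_wpM2r => //.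
  by apply: exprn_ge0; exact: mulr_ge0 (ltW vs0) (ltW A0).
rewrite ler_pM2r// ler_pXn2r ?nnegrE//; [|by apply: mulr_ge0 => //; exact: exprn_ge0|by rewrite subr_ge0 ltW].
have h := @bernoulli_le eta 4.
have : 1 - 4 * eta <= (1 - eta) ^+ 4 by apply: h; rewrite (ltW eta0) -subr_ge0.
move=> /(ler_wpM2r x0) h1 /(le_trans h1).
by move: he eta0; nra.
Qed.

End Final.

Theorem theorem4p3 (R : realType) (xistar : R) (k : nat) (r : R)
    (g : R -> (R -> R) -> R) (L : R -> (R -> R) -> (R -> R) -> R) :
  3 <= xistar -> (1 <= k)%N -> 0 < r ->
  g_admissible g -> H2 g L -> H3 L -> H4 g ->
  (1 <= limn_einf (fun n : nat =>
     (powR n%:R (2 * k%:R / (2 * k%:R + 1)))%:E *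
     ereal_inf [set ereal_sup [set risk xistar g Sh S * ((gammak k r g S)^-1)%:E
                              | S in Wkr k r]
               | Sh in @estimator R n]))%E.
Proof.
move=> xi3 k0 r0 adm h2 h3 h4.
apply/lee_subgt0Pr => e e0; rewrite -EFinB.
apply: le_limn_einf.
wlog e1 : e e0 / e < 1.
  move=> wl.
  have [||] := (wl (Num.min e (1 / 2)) _ _).
  - by rewrite lt_min e0/=; lra.
  - by rewrite gt_min; apply/orP; right; lra.
  move=> n0 _ hn; exists n0 => // n nn; apply: le_trans (hn n nn).
  by rewrite lee_fin lerD2l lerN2 ge_min lexx.
set vs := varsigma g (fun=> 0).
have vs0 : 0 < vs by exact: varsigma0_gt0.
have g00 : 0 < gammak k r g (fun=> 0) by exact: gammak_gt0.
have eta0 : 0 < e / 48 by rewrite divr_gt0.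
have eta1 : e / 48 <= 1 / 20 by lra.
have [alpha [A [al0 A0 hA [K0 _ hK]]]] := asymptotic_lower xi3 k0 r0 adm h2 h3 h4 eta0 eta1.
set p := (2 * k).+1 in hA hK.
pose K1 := maxn K0 (maxn 1 (Num.truncn (p%:R / (e / 48))).+1).
have hK1 : p%:R <= e / 48 * K1%:R.
  rewrite mulrC -ler_pdivrMr// (le_trans (ltW (truncnS_gt _)))// ler_nat.
  by rewrite /K1 !leq_max leqnn !orbT.
near=> n.
have n0 : (0 < n)%N by near: n; exact: nbhs_infty_gt.
have nR : 0 < n%:R :> R by rewrite ltr0n.
have hn : K1%:R ^+ p <= alpha * n%:R.
  by rewrite mulrC -ler_pdivrMr//; near: n; exact: near_le_nat.
have [|K [K1K Kn1 Kn2]] := @largest_power R p (alpha * n%:R) (e / 48) K1 isT (ltW eta0) _ hK1 hn.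
  by lra.
set m : R := n%:R `^ _.
have m0 : 0 < m by exact: powR_gt0.
have mp : m ^+ p = n%:R ^+ (2 * k).
  by rewrite /m two_k1 -natrM powR_frac_exp.
pose W := (1 - e) / m.
have W0 : 0 <= W by rewrite divr_ge0 ?(ltW m0)// subr_ge0 ltW.
have -> : ((1 - e)%:E = m%:E * W%:E)%E by rewrite -EFinM /W mulrC divfK// gt_eqF.
apply: lee_wpmul2l; first by rewrite lee_fin ltW.
apply: le_ereal_inf_tmp => _ [Sh mSh <-].
rewrite leNgt; apply/negP => hlt.
have hV S : Wkr k r S -> 0 < gammak k r g S -> (risk xistar g Sh S <= (W * gammak k r g S)%:E)%E.
  move=> WS gS; rewrite EFinM -lee_pdivrMr//; apply: ltW.
  by apply: le_lt_trans hlt; apply: ereal_sup_ubound; exists S.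
have K0K : (K0 <= K)%N by rewrite (leq_trans _ K1K)// /K1 leq_max leqnn.
have := hK K K0K n n0 Kn1 Sh mSh W W0 hV; apply/negP; rewrite -ltNge.
apply: (@power_compare R p (e / 48) e A vs alpha _ W (K%:R / n%:R) (n%:R ^+ (2 * k))) => //.
- by rewrite /p ltnS mul2n -addnn (leq_add k0 k0).
- by lra.
- by rewrite exprn_gt0.
- by rewrite /W expr_div_n mp divfK// gt_eqF// exprn_gt0.
- have : (1 - e / 48) * (alpha * n%:R) / n%:R <= K%:R ^+ p / n%:R by rewrite ler_wpM2r ?invr_ge0.
  rewrite mulrA mulfK ?gt_eqF// => /le_trans; apply.
  rewrite expr_div_n [n%:R ^+ p]exprS invfM le_eqVlt; apply/orP; left; apply/eqP.
  have : n%:R ^+ (2 * k) != 0 :> R by rewrite expf_neq0// gt_eqF.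
  by move: (n%:R ^+ (2 * k)) => a a0; field; rewrite a0 gt_eqF.
Unshelve. all: by end_near.
Qed.
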